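(* Let $\mathbb{G}$ be a locally compact quantum group and let $\omega\in\mathrm{Prob}^u(\mathbb{G})$ be an idempotent state. Then $\omega$ is invariant with respect to the antipode $S^u$, the unitary antipode $R^u$ and the scaling group $\{\tau_t^u: t\in\mathbb{R}\}$ of $C_0^u(\mathbb{G})$; that is, $\omega(S^u(a))=\omega(a)$ for all $a$ in the domain of $S^u$, $\omega\circ R^u=\omega$, and $\omega\circ\tau_t^u=\omega$ for all $t\in\mathbb{R}$.
   Context: $\mathbb{G}$ is a locally compact quantum group in the sense of Kustermans and Vaes, and $C_0^u(\mathbb{G})$ is its universal C*-algebra (in the sense of Kustermans) with coproduct $\Delta_u$. $S^u$ (a densely defined, generally unbounded map), $R^u$ and $(\tau_t^u)_{t\in\mathbb{R}}$ are the antipode, the unitary antipode and the scaling group on the universal level, i.e. the canonical counterparts on $C_0^u(\mathbb{G})$ of the antipode $S$, unitary antipode $R$ and scaling automorphisms $\tau_t$ of $L^\infty(\mathbb{G})$. $\mathrm{Prob}^u(\mathbb{G})$ is the set of states of $C_0^u(\mathbb{G})$, with convolution $\mu\star\nu=(\mu\otimes\nu)\circ\Delta_u$; $\omega\in\mathrm{Prob}^u(\mathbb{G})$ is an idempotent state if $\omega\star\omega=\omega$. *)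

(* Defs.v *)
(* MathComp-Analysis, over the complex numbers R[i] of a realType R.

   Locally compact quantum groups in the von Neumann algebraic picture of
   Kustermans and Vaes, and their universal C*-algebras in the sense of
   Kustermans.  Conventions: inner products are linear in the first variable,
   W^*(Lam a (x) Lam b) = (Lam (x) Lam)(Delta(b)(a (x) 1)),
   Delta(x) = W^*(1 (x) x)W, W in Linf(G) (x) Linf(G^),
   Delta^(x) = flip (W (x (x) 1) W^* ), (id (x) Delta^)(W) = W_13 W_12. *)
From HB Require Import structures.
From mathcomp Require Import all_boot all_order all_algebra.
From mathcomp Require Import complex.
From mathcomp Require Import all_classical all_reals all_analysis.

Set Implicit Arguments.
Unset Strict Implicit.
Unset Printing Implicit Defensive.

Import Order.TTheory GRing.Theory Num.Theory.
Import numFieldNormedType.Exports.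

Local Open Scope classical_set_scope.
Local Open Scope ring_scope.

(* The library puts the topology of a numFieldType on R[i]^o only. *)
HB.instance Definition _ (R : realType) := NormedModule.copy R[i] (R[i])^o.

Record hilbert (R : realType) := Hilbert {
  hsort :> completeNormedModType R[i];
  dot : hsort -> hsort -> R[i];
  dotPl : forall (c : R[i]) (u v w : hsort),
    dot (c *: u + v) w = c * dot u w + dot v w;
  dotC : forall u v : hsort, dot u v = (dot v u)^*;
  dot_norm : forall u : hsort, dot u u = `|u| ^+ 2 }.

Section HilbertTheory.
Variables (R : realType) (H : hilbert R).
Implicit Types u v w : H.

Lemma dotDl u v w : dot (u + v) w = dot u w + dot v w.
Proof. by rewrite -[u]scale1r dotPl mul1r scale1r. Qed.

Lemma dot0l w : dot 0 w = 0.
Proof. by apply: (addrI (dot 0 w)); rewrite -dotDl !addr0. Qed.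

Lemma dotZl c u w : dot (c *: u) w = c * dot u w.
Proof. by rewrite -[c *: u]addr0 dotPl dot0l addr0. Qed.

Lemma dotDr u v w : dot u (v + w) = dot u v + dot u w.
Proof. by rewrite dotC dotDl rmorphD /= -!dotC. Qed.

Lemma dot0r u : dot u 0 = 0.
Proof. by rewrite dotC dot0l conjC0. Qed.

Lemma dotZr c u w : dot u (c *: w) = c^* * dot u w.
Proof. by rewrite dotC dotZl rmorphM /= -dotC. Qed.

Lemma dotNr u w : dot u (- w) = - dot u w.
Proof. by rewrite -scaleN1r dotZr rmorphN1 mulN1r. Qed.

Lemma dot_inj u v : (forall w, dot w u = dot w v) -> u = v.
Proof.
move=> h; apply/eqP; rewrite -subr_eq0 -normr_eq0 -sqrf_eq0 -dot_norm.
by rewrite dotDr dotNr h subrr.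
Qed.

Lemma cauchy_schwarz u v : `|dot u v| <= `|u| * `|v|.
Proof.
have [->|v0] := eqVneq v 0; first by rewrite dot0r !normr0 mulr0.
have nv0 : 0 < `|v| by rewrite normr_gt0.
pose c := dot u v / `|v| ^+ 2.
have cv : c * `|v| ^+ 2 = dot u v.
  by rewrite /c mulfVK// sqrf_eq0 gt_eqF.
have d : (dot u v)^* = c^* * `|v| ^+ 2.
  by rewrite -cv rmorphM /= [(`|v| ^+ 2)^*]conj_Creal// realX// normr_real.
have E : dot (u - c *: v) (u - c *: v) = `|u| ^+ 2 - c * (dot u v)^*.
  rewrite dotDr dotNr dotZr.
  have -> : dot (u - c *: v) v = 0.
    by rewrite dotDl -scaleNr dotZl dot_norm mulNr cv subrr.
  by rewrite mulr0 subr0 dotDl -scaleNr dotZl dot_norm (dotC v u) mulNr.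
have : 0 <= `|u| ^+ 2 - c * (dot u v)^* by rewrite -E dot_norm exprn_ge0.
rewrite subr_ge0 => h.
rewrite -(ler_pXn2r (n := 2)) ?nnegrE ?mulr_ge0// exprMn.
have -> : `|dot u v| ^+ 2 = (c * (dot u v)^*) * `|v| ^+ 2.
  by rewrite normCK -{1}cv mulrAC.
by rewrite ler_pM2r// exprn_gt0.
Qed.

(* A bounded operator, packaged with its adjoint (which exists, uniquely, by
   the Riesz representation theorem). *)
Record bop := Bop {
  bfun :> H -> H;
  badj : H -> H;
  bop_linear : linear bfun;
  bop_bounded : exists C : R[i], forall v, `|bfun v| <= C * `|v|;
  badjP : forall u v, dot (bfun u) v = dot u (badj v) }.

Implicit Types x y z : bop.

Lemma bopP (x y : bop) : (forall v, x v = y v) -> x = y.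
Proof.
case: x y => [f f' lf bf af] [g g' lg bg ag] /= h.
have E : f = g by apply/funext.
case: g / E lg bg ag {h} => lg bg ag.
have E : f' = g'.
  by apply/funext => v; apply: dot_inj => w; rewrite -af -ag.
case: g' / E ag => ag.
by rewrite (Prop_irrelevance lf lg) (Prop_irrelevance bf bg)
           (Prop_irrelevance af ag).
Qed.

Lemma bopD (x : bop) u v : x (u + v) = x u + x v.
Proof. by rewrite -[u]scale1r bop_linear scale1r scale1r. Qed.

Lemma bop0 (x : bop) : x 0 = 0.
Proof. by apply: (addrI (x 0)); rewrite -bopD !addr0. Qed.

Lemma bopZ (x : bop) c u : x (c *: u) = c *: x u.
Proof. by rewrite -[c *: u]addr0 bop_linear bop0 addr0. Qed.

Lemma bop_ge0_bounded (x : bop) :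
  exists2 C : R[i], 0 <= C & forall v, `|x v| <= C * `|v|.
Proof.
have [C hC] := bop_bounded x; exists `|C| => // v.
have := hC v; have [->|v0] := eqVneq v 0.
  by rewrite bop0 !normr0 !mulr0.
move=> h; apply: (le_trans h); rewrite ler_pM2r ?normr_gt0//.
apply: real_ler_norm; rewrite realE.
suff -> : 0 <= C by [].
by rewrite -(pmulr_lge0 _ (x := `|v|)) ?normr_gt0// (le_trans _ h).
Qed.

Lemma bstar_linear (x : bop) : linear (badj x).
Proof.
move=> c u v; apply: dot_inj => w.
by rewrite -badjP dotDr dotZr !badjP dotDr dotZr.
Qed.

Lemma bstar_bounded (x : bop) :
  exists C : R[i], forall v, `|badj x v| <= C * `|v|.
Proof.
have [C C0 hC] := bop_ge0_bounded x; exists C => v.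
have [->|n0] := eqVneq (badj x v) 0; first by rewrite normr0 mulr_ge0.
have np : 0 < `|badj x v| by rewrite normr_gt0.
rewrite -(ler_pM2l np) -expr2 -dot_norm -badjP.
have d0 : 0 <= dot (x (badj x v)) v by rewrite badjP dot_norm exprn_ge0.
rewrite -(ger0_norm d0); apply: (le_trans (cauchy_schwarz _ _)).
by rewrite mulrA [_ * C]mulrC ler_wpM2r.
Qed.

Lemma bstar_adj (x : bop) u v : dot (badj x u) v = dot u (x v).
Proof. by rewrite dotC -badjP -dotC. Qed.

Definition star (x : bop) : bop :=
  Bop (bstar_linear x) (bstar_bounded x) (bstar_adj x).

Fact bzero_subproof :
  [/\ linear (fun _ : H => 0 : H),
      exists C : R[i], forall v : H, `|0 : H| <= C * `|v|
    & forall u v, dot (0 : H) v = dot u (0 : H)].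
Proof.
split=> [c u v||u v]; first by rewrite scaler0 addr0.
  by exists 0 => v; rewrite normr0 mul0r.
by rewrite dot0l dot0r.
Qed.

Definition bzero : bop :=
  let: And3 l b a := bzero_subproof in
  @Bop (fun _ => 0) (fun _ => 0) l b a.

Fact bone_subproof :
  [/\ linear (@id H),
      exists C : R[i], forall v : H, `|v| <= C * `|v|
    & forall u v : H, dot u v = dot u v].
Proof. by split=> //; exists 1 => v; rewrite mul1r. Qed.

Definition bone : bop :=
  let: And3 l b a := bone_subproof in @Bop id id l b a.

Fact badd_subproof (x y : bop) :
  [/\ linear (fun v => x v + y v),
      exists C : R[i], forall v, `|x v + y v| <= C * `|v|
    & forall u v, dot (x u + y u) v = dot u (badj x v + badj y v)].
Proof.
split=> [c u v||u v]; first by rewrite !bop_linear scalerDr addrACA.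
  have [C hC] := bop_bounded x; have [D hD] := bop_bounded y.
  exists (C + D) => v; rewrite mulrDl.
  by apply: (le_trans (ler_normD _ _)); rewrite lerD.
by rewrite dotDl !badjP dotDr.
Qed.

Definition badd (x y : bop) : bop :=
  let: And3 l b a := badd_subproof x y in
  @Bop (fun v => x v + y v) (fun v => badj x v + badj y v) l b a.

Fact bscale_subproof (c : R[i]) (x : bop) :
  [/\ linear (fun v => c *: x v),
      exists C : R[i], forall v, `|c *: x v| <= C * `|v|
    & forall u v, dot (c *: x u) v = dot u (c^* *: badj x v)].
Proof.
split=> [d u v||u v].
- by rewrite bop_linear scalerDr !scalerA mulrC.
- have [C hC] := bop_bounded x; exists (`|c| * C) => v.
  by rewrite normrZ -mulrA ler_wpM2l.
- by rewrite dotZl badjP dotZr conjCK.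
Qed.

Definition bscale (c : R[i]) (x : bop) : bop :=
  let: And3 l b a := bscale_subproof c x in
  @Bop (fun v => c *: x v) (fun v => c^* *: badj x v) l b a.

Fact bcomp_subproof (x y : bop) :
  [/\ linear (fun v => x (y v)),
      exists C : R[i], forall v, `|x (y v)| <= C * `|v|
    & forall u v, dot (x (y u)) v = dot u (badj y (badj x v))].
Proof.
split=> [c u v||u v].
- by rewrite !bop_linear.
- have [C C0 hC] := bop_ge0_bounded x; have [D hD] := bop_bounded y.
  by exists (C * D) => v; rewrite -mulrA (le_trans (hC _))// ler_wpM2l.
- by rewrite !badjP.
Qed.

Definition bcomp (x y : bop) : bop :=
  let: And3 l b a := bcomp_subproof x y in
  @Bop (fun v => x (y v)) (fun v => badj y (badj x v)) l b a.

HB.instance Definition _ := gen_eqMixin bop.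
HB.instance Definition _ := gen_choiceMixin bop.

Lemma bzeroE v : bzero v = 0.
Proof. by rewrite /bzero; case: bzero_subproof. Qed.
Lemma boneE v : bone v = v.
Proof. by rewrite /bone; case: bone_subproof. Qed.
Lemma baddE x y v : badd x y v = x v + y v.
Proof. by rewrite /badd; case: badd_subproof. Qed.
Lemma bscaleE c x v : bscale c x v = c *: x v.
Proof. by rewrite /bscale; case: bscale_subproof. Qed.
Lemma bcompE x y v : bcomp x y v = x (y v).
Proof. by rewrite /bcomp; case: bcomp_subproof. Qed.

Fact baddA : associative badd.
Proof. by move=> x y z; apply: bopP => v; rewrite !baddE addrA. Qed.
Fact baddC : commutative badd.
Proof. by move=> x y; apply: bopP => v; rewrite !baddE addrC. Qed.
Fact badd0 : left_id bzero badd.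
Proof. by move=> x; apply: bopP => v; rewrite baddE bzeroE add0r. Qed.
Fact baddN : left_inverse bzero (bscale (-1)) badd.
Proof.
by move=> x; apply: bopP => v; rewrite baddE bscaleE bzeroE scaleN1r addNr.
Qed.

HB.instance Definition _ := GRing.isZmodule.Build bop baddA baddC badd0 baddN.

Fact bcompA : associative bcomp.
Proof. by move=> x y z; apply: bopP => v; rewrite !bcompE. Qed.
Fact bcomp1l : left_id bone bcomp.
Proof. by move=> x; apply: bopP => v; rewrite bcompE boneE. Qed.
Fact bcomp1r : right_id bone bcomp.
Proof. by move=> x; apply: bopP => v; rewrite bcompE boneE. Qed.
Fact bcompDl : left_distributive bcomp badd.
Proof. by move=> x y z; apply: bopP => v; rewrite !(bcompE, baddE). Qed.
Fact bcompDr : right_distributive bcomp badd.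
Proof. by move=> x y z; apply: bopP => v; rewrite !(bcompE, baddE) bopD. Qed.

HB.instance Definition _ :=
  GRing.Zmodule_isPzRing.Build bop bcompA bcomp1l bcomp1r bcompDl bcompDr.

Fact bscaleA c d x : bscale c (bscale d x) = bscale (c * d) x.
Proof. by apply: bopP => v; rewrite !bscaleE scalerA. Qed.
Fact bscale1 : left_id 1 bscale.
Proof. by move=> x; apply: bopP => v; rewrite bscaleE scale1r. Qed.
Fact bscaleDr : right_distributive bscale badd.
Proof. by move=> c x y; apply: bopP => v; rewrite !(baddE, bscaleE) scalerDr. Qed.
Fact bscaleDl x : {morph bscale^~ x : c d / c + d >-> badd c d}.
Proof. by move=> c d; apply: bopP => v; rewrite !(baddE, bscaleE) scalerDl. Qed.

HB.instance Definition _ :=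
  GRing.Zmodule_isLmodule.Build R[i] bop bscaleA bscale1 bscaleDr bscaleDl.

Lemma add_bopE (x y : bop) v : (x + y) v = x v + y v.
Proof. exact: baddE. Qed.
Lemma zero_bopE v : (0 : bop) v = 0.
Proof. exact: bzeroE. Qed.
Lemma one_bopE v : (1 : bop) v = v.
Proof. exact: boneE. Qed.
Lemma scale_bopE c (x : bop) v : (c *: x) v = c *: x v.
Proof. exact: bscaleE. Qed.
Lemma mul_bopE (x y : bop) v : (x * y) v = x (y v).
Proof. exact: bcompE. Qed.

(* Norms over R[i] take their values in R[i]. *)
Definition opnorm (x : bop) : R[i] :=
  (sup [set complex.Re `|x v| | v in [set v : H | `|v| <= 1]])%:C%C.

Lemma norm_ReE (V : normedModType R[i]) (v : V) :
  `|v| = (complex.Re `|v|)%:C%C.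
Proof. by rewrite RRe_real// normr_real. Qed.

Lemma has_sup_opnorm (x : bop) :
  has_sup [set complex.Re `|x v| | v in [set v : H | `|v| <= 1]].
Proof.
split; first by exists (complex.Re `|x 0|), 0 => //=; rewrite normr0 ler01.
have [C C0 hC] := bop_ge0_bounded x; exists (complex.Re C) => _ [v /= v1 <-].
rewrite -lecR -norm_ReE RRe_real ?ger0_real//.
by apply: (le_trans (hC v)); rewrite ler_piMr.
Qed.

Lemma opnorm_ge0 x : 0 <= opnorm x.
Proof.
rewrite /opnorm ler0c; apply: (@le_trans _ _ (complex.Re `|x 0|)).
  by rewrite -lecR -norm_ReE; exact: normr_ge0.
apply: ub_le_sup; first exact: (proj2 (has_sup_opnorm x)).
by exists 0 => //=; rewrite normr0 ler01.
Qed.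

Lemma opnormP x v : `|x v| <= opnorm x * `|v|.
Proof.
have [->|v0] := eqVneq v 0; first by rewrite bop0 !normr0 mulr0.
have np : 0 < `|v| by rewrite normr_gt0.
rewrite -ler_pdivrMr// mulrC.
have -> : `|v|^-1 * `|x v| = `|x (`|v|^-1 *: v)|.
  by rewrite bopZ normrZ ger0_norm// invr_ge0.
rewrite norm_ReE /opnorm lecR; apply: ub_le_sup.
  exact: (proj2 (has_sup_opnorm x)).
exists (`|v|^-1 *: v) => //=.
by rewrite normrZ ger0_norm ?invr_ge0// mulVf ?gt_eqF.
Qed.

Lemma opnorm_le x (C : R[i]) : 0 <= C ->
  (forall v, `|x v| <= C * `|v|) -> opnorm x <= C.
Proof.
move=> C0 hC; rewrite /opnorm -[leRHS]RRe_real ?ger0_real// lecR.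
apply: ge_sup; first exact: (proj1 (has_sup_opnorm x)).
move=> _ [v /= v1 <-]; rewrite -lecR -norm_ReE RRe_real ?ger0_real//.
by apply: (le_trans (hC v)); rewrite ler_piMr.
Qed.

Fact opnormD x y : opnorm (x + y) <= opnorm x + opnorm y.
Proof.
apply: opnorm_le => [|v]; first by rewrite addr_ge0 ?opnorm_ge0.
rewrite add_bopE mulrDl; apply: (le_trans (ler_normD _ _)).
by rewrite lerD ?opnormP.
Qed.

Fact opnormZ_le c x : opnorm (c *: x) <= `|c| * opnorm x.
Proof.
apply: opnorm_le => [|v]; first by rewrite mulr_ge0 ?opnorm_ge0.
by rewrite scale_bopE normrZ -mulrA ler_wpM2l ?opnormP.
Qed.

Fact opnorm0_eq0 x : opnorm x = 0 -> x = 0.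
Proof.
move=> x0; apply: bopP => v; rewrite zero_bopE; apply/eqP.
by rewrite -normr_le0 -(mul0r `|v|) -x0 opnormP.
Qed.

Fact opnormZ c x : opnorm (c *: x) = `|c| * opnorm x.
Proof.
apply/eqP; rewrite eq_le opnormZ_le /=.
have [->|c0] := eqVneq c 0; first by rewrite normr0 mul0r opnorm_ge0.
have := opnormZ_le c^-1 (c *: x).
by rewrite scalerA mulVf// scale1r normfV mulrC ler_pdivlMr ?normr_gt0// mulrC.
Qed.

HB.instance Definition _ :=
  Lmodule_isNormed.Build R[i] bop opnormD opnormZ opnorm0_eq0.

End HilbertTheory.

Section OperatorAlgebras.
Variables (R : realType) (H : hilbert R).
Implicit Types (x y z : bop H) (A B M : set (bop H)).

Definition lspan (V : lmodType R[i]) (B : set V) : set V :=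
  [set v | exists n (c : 'I_n -> R[i]) (b : 'I_n -> V),
    (forall i, B (b i)) /\ v = \sum_i c i *: b i].

Definition linear_on (V : lmodType R[i]) (A : set (bop H)) (f : bop H -> V) :=
  forall c x y, A x -> A y -> f (c *: x + y) = c *: f x + f y.

Definition star_hom (L : hilbert R) A (pi : bop H -> bop L) :=
  [/\ linear_on A pi,
      forall x y, A x -> A y -> pi (x * y) = pi x * pi y
    & forall x, A x -> pi (star x) = star (pi x)].

(* Every C*-algebra is faithfully and nondegenerately represented on some H;
   multiplier algebras and minimal tensor products are then concrete. *)
Definition cstar_alg A :=
  [/\ closed A, A 0,
      forall c x y, A x -> A y -> A (c *: x + y),
      forall x y, A x -> A y -> A (x * y)
    & forall x, A x -> A (star x)].

Definition nondegenerate A :=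
  closure (lspan [set v | exists x u, A x /\ v = x u]) = [set: H].

(* This is the multiplier algebra only for nondegenerate A. *)
Definition multiplier A : set (bop H) :=
  [set m | forall x, A x -> A (m * x) /\ A (x * m)].

Definition compacts : set (bop H) :=
  closure (lspan [set x : bop H | exists u v, forall w, x w = dot w v *: u]).

Definition commutant B : set (bop H) :=
  [set x | forall y, B y -> x * y = y * x].

Definition von_neumann M :=
  (forall x, M x -> M (star x)) /\ commutant (commutant M) = M.

Definition unitary x := star x * x = 1 /\ x * star x = 1.

Definition positive_op x := forall v, 0 <= dot (x v) v.

(* The normal functional omega(x) = sum_n <x(nl n), nr n>; every element of
   the predual of a von Neumann algebra on H is of this form, and the positive
   elements are those with nl = nr. *)
Record normal_fun := NormalFun {
  nl : nat -> H;
  nr : nat -> H;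
  nl_summable : cvgn (series (fun n => `|nl n| ^+ 2 : R[i]));
  nr_summable : cvgn (series (fun n => `|nr n| ^+ 2 : R[i])) }.

Definition nfun_app (om : normal_fun) x : R[i] :=
  limn (series (fun n => dot (x (nl om n)) (nr om n))).

Definition state A (mu : bop H -> R[i]) :=
  [/\ linear_on A (mu : bop H -> (R[i])^o),
      forall x, A x -> 0 <= mu (star x * x)
    & sup [set complex.Re `|mu x| | x in A `&` [set x | `|x| <= 1]] = 1].

(* Strict continuity on M(A): the strict topology is generated by the
   seminorms m |-> |m a| and m |-> |a m|, for a in A. *)
Definition strictly_continuous A (F : bop H -> R[i]) :=
  exists n (a : 'I_n -> bop H) (C : R[i]),
    (forall i, A (a i)) /\
    forall m, multiplier A m ->
      `|F m| <= C * \sum_i (`|m * a i| + `|a i * m|).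

Definition pos_part M : set (bop H) := [set x | M x /\ positive_op x].

Definition left_ideal M (phi : bop H -> \bar R) : set (bop H) :=
  [set x | M x /\ (phi (star x * x)%R < +oo)%E].

Definition weight M (phi : bop H -> \bar R) :=
  [/\ forall x, pos_part M x -> (0 <= phi x)%E,
      forall x y, pos_part M x -> pos_part M y ->
        phi (x + y) = (phi x + phi y)%E
    & forall (r : R) x, 0 <= r -> pos_part M x ->
        phi (r%:C%C *: x) = (r%:E * phi x)%E].

Definition faithful M (phi : bop H -> \bar R) :=
  forall x, pos_part M x -> phi x = 0%E -> x = 0.

Definition semifinite M (phi : bop H -> \bar R) :=
  commutant (commutant [set x | pos_part M x /\ (phi x < +oo)%E]) = M.

Definition op_le x y := positive_op (y - x).

Definition normal M (phi : bop H -> \bar R) :=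
  forall (D : set (bop H)) s,
    D !=set0 -> D `<=` pos_part M ->
    (forall x y, D x -> D y -> exists2 z, D z & op_le x z /\ op_le y z) ->
    pos_part M s -> (forall x, D x -> op_le x s) ->
    (forall t, pos_part M t -> (forall x, D x -> op_le x t) -> op_le s t) ->
    phi s = ereal_sup (phi @` D).

Definition nsf_weight M phi :=
  [/\ weight M phi, normal M phi, semifinite M phi & faithful M phi].

End OperatorAlgebras.

Arguments compacts {R} H _.

(* A model of the Hilbert space tensor product, which is unique up to a unique
   unitary. *)
Record htensor (R : realType) (H K : hilbert R) := HTensor {
  tsp :> hilbert R;
  tns : H -> K -> tsp;
  tns_linl : forall v, linear (tns^~ v);
  tns_linr : forall u, linear (tns u);
  dot_tns : forall u u' v v',
    dot (tns u v) (tns u' v') = dot u u' * dot v v';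
  tns_total : closure (lspan [set w | exists u v, w = tns u v]) = [set: tsp] }.

Section Tensors.
Variables (R : realType) (H1 H2 H3 : hilbert R).
Variables (T12 : htensor H1 H2) (T13 : htensor H1 H3) (T23 : htensor H2 H3).
Variable (T : htensor T12 H3).

Definition is_tensor_op (x : bop H1) (y : bop H2) (z : bop T12) :=
  forall u v, z (tns T12 u v) = tns T12 (x u) (y v).

Definition elementary (A : set (bop H1)) (B : set (bop H2)) : set (bop T12) :=
  [set z | exists x y, [/\ A x, B y & is_tensor_op x y z]].

Definition min_tensor A B := closure (lspan (elementary A B)).

Definition vn_tensor A B := commutant (commutant (elementary A B)).

(* y = (om (x) id)(X) and y = (id (x) om)(X). *)
Definition is_lslice (om : normal_fun H1) (X : bop T12) (y : bop H2) :=
  forall v v',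
    series (fun n => dot (X (tns T12 (nl om n) v)) (tns T12 (nr om n) v')) @ \oo
      --> (dot (y v) v' : R[i]).

Definition is_rslice (om : normal_fun H2) (X : bop T12) (y : bop H1) :=
  forall u u',
    series (fun n => dot (X (tns T12 u (nl om n))) (tns T12 u' (nr om n))) @ \oo
      --> (dot (y u) u' : R[i]).

(* y = (om (x) id (x) id)(X). *)
Definition is_lslice23 (om : normal_fun H1) (X : bop T) (y : bop T23) :=
  forall v v' w w',
    series (fun n => dot (X (tns T (tns T12 (nl om n) v) w))
                         (tns T (tns T12 (nr om n) v') w')) @ \oo
      --> (dot (y (tns T23 v w)) (tns T23 v' w') : R[i]).

(* Leg numbering notation: Z = X_12, X_13, X_23 on (H1 (x) H2) (x) H3. *)
Definition is_leg12 (X : bop T12) (Z : bop T) :=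
  forall u w, Z (tns T u w) = tns T (X u) w.

Definition is_leg13 (X : bop T13) (Z : bop T) :=
  forall u u' v v' w w',
    dot (Z (tns T (tns T12 u v) w)) (tns T (tns T12 u' v') w')
    = dot (X (tns T13 u w)) (tns T13 u' w') * dot v v'.

Definition is_leg23 (X : bop T23) (Z : bop T) :=
  forall u u' v v' w w',
    dot (Z (tns T (tns T12 u v) w)) (tns T (tns T12 u' v') w')
    = dot u u' * dot (X (tns T23 v w)) (tns T23 v' w').

End Tensors.

Arguments min_tensor {R H1 H2} T12 A B.
Arguments vn_tensor {R H1 H2} T12 A B.

(* Linf is Linf(G), acting on the GNS space L2 of the left Haar weight. *)
Record lcqg (R : realType) := LCQG {
  L2 : hilbert R;
  L2_2 : htensor L2 L2;
  L2_3 : htensor L2_2 L2;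
  Linf : set (bop L2);
  comul : bop L2 -> bop L2_2;
  lhaar : bop L2 -> \bar R;
  rhaar : bop L2 -> \bar R;
  gns : bop L2 -> L2;
  kac : bop L2_2;

  Linf_vn : von_neumann Linf;

  comul_hom : star_hom Linf comul;
  comul1 : comul 1 = 1;
  comul_inj : forall x y, Linf x -> Linf y -> comul x = comul y -> x = y;
  comul_tensor : forall x, Linf x -> vn_tensor L2_2 Linf Linf (comul x);
  (* sigma-weak continuity: the predual of Linf (x) Linf is pulled back into
     the predual of Linf *)
  comul_normal : forall om : normal_fun L2_2, exists om' : normal_fun L2,
    forall x, Linf x -> nfun_app om (comul x) = nfun_app om' x;
  (* Y = (comul (x) id)(comul x) = (id (x) comul)(comul x), where the two
     normal extensions are determined by their slices *)
  comul_coassoc : forall x, Linf x -> exists Y : bop L2_3,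
    (forall om y, is_rslice om (comul x) y -> is_rslice om Y (comul y)) /\
    (forall om y, is_lslice om (comul x) y -> is_lslice23 om Y (comul y));

  lhaar_nsf : nsf_weight Linf lhaar;
  rhaar_nsf : nsf_weight Linf rhaar;
  lhaar_invariant : forall (om : normal_fun L2) x y, nl om = nr om ->
    pos_part Linf x -> (lhaar x < +oo)%E -> is_lslice om (comul x) y ->
    lhaar y = ((complex.Re (nfun_app om 1))%:E * lhaar x)%E;
  rhaar_invariant : forall (om : normal_fun L2) x y, nl om = nr om ->
    pos_part Linf x -> (rhaar x < +oo)%E -> is_rslice om (comul x) y ->
    rhaar y = ((complex.Re (nfun_app om 1))%:E * rhaar x)%E;

  gns_linear : forall c x y, left_ideal Linf lhaar x ->
    left_ideal Linf lhaar y -> gns (c *: x + y) = c *: gns x + gns y;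
  gns_norm : forall x, left_ideal Linf lhaar x ->
    `|gns x| ^+ 2 = (fine (lhaar (star x * x)))%:C%C;
  gns_mul : forall x y, Linf x -> left_ideal Linf lhaar y ->
    gns (x * y) = x (gns y);
  gns_dense : closure (gns @` left_ideal Linf lhaar) = setT;

  (* W^*(Lam a (x) Lam b) = (Lam (x) Lam)(comul(b)(a (x) 1)), with the right
     hand side written through slices:
     (om (x) id)(W^* ) Lam(b) = Lam((om (x) id)(comul b)) *)
  kac_unitary : unitary kac;
  kacP : forall (om : normal_fun L2) b x y, left_ideal Linf lhaar b ->
    is_lslice om (comul b) x -> is_lslice om (star kac) y ->
    y (gns b) = gns x }.

Section LCQG.
Variables (R : realType) (G : lcqg R).

(* The reduced C*-algebra C_0(G^) of the dual. *)
Definition C0_dual : set (bop (L2 G)) :=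
  closure [set y | exists om, is_lslice om (kac G) y].

(* (id (x) Delta^)(U) = U_13 U_12.  Since
   (id (x) Delta^)(U) = flip_23 W_23 U_12 W_23^* flip_23, conjugation by
   flip_23 turns this equation into the one below. *)
Definition dual_corep (L : hilbert R) (LH : htensor L (L2 G))
    (LHH : htensor LH (L2 G)) (U : bop LH) :=
  exists U12 U13 W23 : bop LHH,
    [/\ is_leg12 U U12, is_leg13 U U13, is_leg23 (kac G) W23
      & W23 * U12 * star W23 = U12 * U13].

End LCQG.

Arguments C0_dual {R} G _.

(* The universal C*-algebra C_0^u(G), faithfully and nondegenerately
   represented on uK, with the universal unitary corepresentation
   uW in M(C_0^u(G) (x) C_0(G^)). *)
Record universal_Cstar (R : realType) (G : lcqg R) := UniversalCstar {
  uK : hilbert R;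
  uKH : htensor uK (L2 G);
  uKHH : htensor uKH (L2 G);
  uK_2 : htensor uK uK;
  uK_2H : htensor uK_2 (L2 G);
  C0u : set (bop uK);
  uW : bop uKH;
  ucomul : bop uK -> bop uK_2;

  C0u_cstar : cstar_alg C0u;
  C0u_nondegenerate : nondegenerate C0u;
  uW_unitary : unitary uW;
  uW_multiplier : multiplier (min_tensor uKH C0u (C0_dual G)) uW;
  uW_corep : dual_corep uKHH uW;
  C0u_generated : C0u = closure [set y | exists om, is_rslice om uW y];
  (* Every unitary corepresentation U is (pi (x) id)(uW) for a nondegenerate
     representation pi, which is unique by C0u_generated. *)
  uW_universal : forall (L : hilbert R) (LH : htensor L (L2 G))
      (LHH : htensor LH (L2 G)) (U : bop LH),
    unitary U -> multiplier (min_tensor LH (compacts L) (C0_dual G)) U ->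
    dual_corep LHH U ->
    exists pi : bop uK -> bop L,
      [/\ star_hom C0u pi, nondegenerate (pi @` C0u)
        & forall om y z, is_rslice om uW y -> is_rslice om U z -> pi y = z];

  ucomul_hom : star_hom C0u ucomul;
  ucomul_multiplier : forall a, C0u a ->
    multiplier (min_tensor uK_2 C0u C0u) (ucomul a);
  ucomul_nondegenerate :
    closure (lspan [set z | exists a x,
      [/\ C0u a, min_tensor uK_2 C0u C0u x & z = ucomul a * x]])
    = min_tensor uK_2 C0u C0u;
  (* (ucomul (x) id)(uW) = uW_13 uW_23 *)
  ucomulP : exists W13 W23 : bop uK_2H,
    [/\ is_leg13 uW W13, is_leg23 uW W23
      & forall om y, is_rslice om uW y ->
          is_rslice om (W13 * W23) (ucomul y)] }.

Arguments C0u {R G} u _.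

Section Universal.
Variables (R : realType) (G : lcqg R) (U : universal_Cstar G).
Implicit Types (mu nu : bop (uK U) -> R[i]) (a b : bop (uK U)).

Definition ustate mu := state (C0u U) mu.

(* F is the strictly continuous extension of mu (x) nu to
   M(C_0^u(G) (x) C_0^u(G)). *)
Definition tensor_functional mu nu (F : bop (uK_2 U) -> R[i]) :=
  let AA := min_tensor (uK_2 U) (C0u U) (C0u U) in
  [/\ linear_on (multiplier AA) (F : bop (uK_2 U) -> (R[i])^o),
      strictly_continuous AA F
    & forall a b z, C0u U a -> C0u U b -> is_tensor_op a b z ->
        F z = mu a * nu b].

(* rho = (mu (x) nu) o ucomul on C_0^u(G). *)
Definition is_convolution mu nu rho :=
  exists2 F, tensor_functional mu nu F
    & forall a, C0u U a -> rho a = F (ucomul a).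

Definition idempotent_state mu := ustate mu /\ is_convolution mu mu mu.

(* The graph of S^u: the closed map with core
   (id (x) om)(uW) |-> (id (x) om)(uW^* ), just as the antipode of G is the
   closure of (id (x) om)(W) |-> (id (x) om)(W^* ). *)
Definition antipode_graph : set (bop (uK U) * bop (uK U)) :=
  closure [set yz | exists om,
    is_rslice om (uW U) yz.1 /\ is_rslice om (star (uW U)) yz.2].

(* b = tau_z(a) for the analytic extension of tau to z, Im z <= 0. *)
Definition analytic_extension (tau : R -> bop (uK U) -> bop (uK U))
    (z : R[i]) a b :=
  let strip := [set w : R[i] | complex.Im z <= complex.Im w <= 0] in
  exists f : R[i] -> bop (uK U),
    [/\ {within strip, continuous f},
        forall w, complex.Im z < complex.Im w < 0 -> derivable f w 1,
        forall w, strip w -> C0u U (f w),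
        forall t : R, f t%:C%C = tau t a
      & f z = b].

Definition anti_automorphism (r : bop (uK U) -> bop (uK U)) :=
  [/\ forall a, C0u U a -> C0u U (r a),
      linear_on (C0u U) r,
      forall a b, C0u U a -> C0u U b -> r (a * b) = r b * r a,
      forall a, C0u U a -> r (star a) = star (r a)
    & forall a, C0u U a -> r (r a) = a].

Definition automorphism_group (tau : R -> bop (uK U) -> bop (uK U)) :=
  [/\ forall t, star_hom (C0u U) (tau t),
      forall t a, C0u U a -> C0u U (tau t a),
      forall a, C0u U a -> tau 0 a = a,
      forall s t a, C0u U a -> tau (s + t) a = tau s (tau t a)
    & forall a, C0u U a -> continuous (tau^~ a)].

(* R^u and tau^u are the constituents of the polar decomposition
   S^u = R^u o tau^u_{-i/2}, which determines them uniquely. *)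
Definition unitary_antipode_and_scaling_group
    (r : bop (uK U) -> bop (uK U)) (tau : R -> bop (uK U) -> bop (uK U)) :=
  [/\ anti_automorphism r,
      automorphism_group tau,
      forall t a, C0u U a -> r (tau t a) = tau t (r a)
    & forall a b, antipode_graph (a, b) <->
        C0u U a /\
        exists2 c, analytic_extension tau (0 +i* - 2^-1)%C a c & b = r c].

End Universal.

Arguments antipode_graph {R G} U _.

(* Main.v *)
Require Import Defs.
From mathcomp Require Import all_boot all_order all_algebra.
From mathcomp Require Import complex.
From mathcomp Require Import all_classical all_reals all_analysis.
From mathcomp Require Import ring lra zify.

(** Let W be the universal corepresentation uW and P = (omega (x) id)(W) the
    operator on L2(G) obtained by slicing it with the idempotent state omega.
    Since (ucomul (x) id)(W) = W_13 W_23, the square of P is the slice of W by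
    the convolution square of omega, so P is idempotent
    ([slice_operator_idem]). As omega has norm one and W is unitary, P is also
    a contraction, and a contractive idempotent on a Hilbert space is
    self-adjoint ([contractive_idempotent_selfadjoint]). Finally omega is
    hermitian ([state_star]), so that the adjoint of P is the slice of the
    adjoint of W: the equality of P and its adjoint says that omega takes the
    same value at (id (x) om)(W) and at its image (id (x) om)(star W) under
    the antipode. By continuity omega is invariant on the whole graph of S^u
    ([antipode_invariant]).

    The passage from R^u tau_{-i/2} = S^u to R^u and tau_t separately is
    complex analysis. Let a be in the domain of S^u, f the extension of
    t |-> tau_t a to the strip -1/2 <= Im w <= 0, F = omega o f and
    F' = omega o R^u o f. Translates of f extend the orbit of tau_t a, and
    R^u o f extends the orbit of R^u a; invariance under S^u, applied to both,
    gives F(t - i/2) = F'(t) and F'(t - i/2) = F(t). Copies of F and F' can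
    therefore be stacked alternately into one function on the plane, which is
    bounded, hence constant ([strip_liouville]). On the real line this reads
    omega(tau_t a) = omega(a) = omega(R^u a) ([strip_invariance]), and the
    slices (id (x) om)(W), which all lie in the domain of S^u, span a dense
    subspace of C_0^u(G). An analytic extension need not be bounded by
    definition: f is, because f(w + t) = tau_t (f w), after composition with a
    functional, by uniqueness of analytic continuation ([strip_unique]).

    Three tools are built on the way.
    - Complex analysis without integrals: contour integrals over the boundary
      of a square are replaced by dyadic midpoint sums. These are additive
      under quartering and vanish on affine functions, which is all that the
      bisection argument of Goursat uses ([goursat]); the kernel 1 / (w - c)
      then gives a Cauchy estimate ([cauchy_bound]), from which both theorems
      on the strip follow.
    - Tensor products: an abstract Hilbert tensor product carries x (x) y for
      all bounded x and y, because a finite sum of elementary tensors can be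
      rewritten with orthonormal first legs ([amplify], [tensor_op_exists]).
    - Strict density: ucomul maps (id (x) om_{xi,eta})(W) to the sum over an
      orthonormal basis (e_k) of (id (x) om_{e_k,eta})(W) (x)
      (id (x) om_{xi,e_k})(W), which converges strictly along finite
      orthonormal families ([strictly_small_min_tensor]). That W multiplies
      C_0^u(G) (x) C_0(G^) and that C_0(G^) acts nondegenerately reduce this
      to finite sums. *)

Set Implicit Arguments.
Unset Strict Implicit.
Unset Printing Implicit Defensive.

Import Order.TTheory GRing.Theory Num.Theory.
Import numFieldNormedType.Exports.

Local Open Scope classical_set_scope.
Local Open Scope ring_scope.

Local Notation "x %:C" := (x%:C%C) (only parsing) : ring_scope.
Local Notation "x +i* y" := (x +i* y)%C : ring_scope.

(** * Real-valued norms *)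

Section RealNorm.
Variable R : realType.

(** The library norm of a module over [R[i]] lies in [R[i]], which is only
    partially ordered; its real part lives in a totally ordered field. *)
Definition nrm (V : normedModType R[i]) (v : V) : R := complex.Re `|v|.

Section Module.
Variable V : normedModType R[i].
Implicit Types (u v w : V) (c : R[i]) (e : R).

Lemma nrmE v : `|v| = (nrm v)%:C.
Proof. exact (norm_ReE v). Qed.

Lemma nrm_ge0 v : 0 <= nrm v.
Proof. by have := normr_ge0 v; rewrite nrmE ler0c. Qed.

Lemma nrm0 : nrm (0 : V) = 0.
Proof. by apply: complexI; rewrite -nrmE normr0. Qed.

Lemma nrm_eq0 v : nrm v = 0 -> v = 0.
Proof. by move=> h; apply/eqP; rewrite -normr_eq0 nrmE h. Qed.

Lemma nrm_small v : (forall e, 0 < e -> nrm v <= e) -> v = 0.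
Proof.
move=> h; apply: nrm_eq0; apply/eqP; rewrite eq_le nrm_ge0 andbT.
by apply/ler_addgt0Pr => e /h; rewrite add0r.
Qed.

Lemma nrmN v : nrm (- v) = nrm v.
Proof. by rewrite /nrm normrN. Qed.

Lemma nrmBC u v : nrm (u - v) = nrm (v - u).
Proof. by rewrite -nrmN opprB. Qed.

Lemma nrmD u v : nrm (u + v) <= nrm u + nrm v.
Proof. by rewrite -lecR rmorphD /= -!nrmE ler_normD. Qed.

Lemma nrmB u v : nrm (u - v) <= nrm u + nrm v.
Proof. by rewrite -(nrmN v) nrmD. Qed.

Lemma nrm_dist w u v : nrm (u - v) <= nrm (u - w) + nrm (w - v).
Proof. by rewrite -[u - v](subrKA w) nrmD. Qed.

Lemma nrm_sum I (r : seq I) (P : pred I) (F : I -> V) :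
  nrm (\sum_(i <- r | P i) F i) <= \sum_(i <- r | P i) nrm (F i).
Proof.
elim/big_ind2: _ => [|u x v y ux vy|//]; first by rewrite nrm0.
exact: le_trans (nrmD _ _) (lerD ux vy).
Qed.

Lemma nrm_le v (e : R) : (`|v| <= e%:C) = (nrm v <= e).
Proof. by rewrite nrmE lecR. Qed.

Lemma nrm_lt v (e : R) : (`|v| < e%:C) = (nrm v < e).
Proof. by rewrite nrmE ltcR. Qed.

Lemma gt0_real_complex (e : R[i]) : 0 < e -> exists2 r : R, 0 < r & e = r%:C.
Proof.
move=> e0; have E : (complex.Re e)%:C = e by rewrite RRe_real// gtr0_real.
by exists (complex.Re e); rewrite ?E// -ltcR E.
Qed.

Lemma nbhs_nrmP (v : V) (A : set V) :
  nbhs v A <-> exists2 e : R, 0 < e & forall w, nrm (w - v) < e -> A w.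
Proof.
split=> [/nbhs_normP[e /= /gt0_real_complex[r r0 ->] h]|[e e0 h]].
  by exists r => // w wv; apply: h; rewrite /= -normrN opprB nrm_lt.
apply/nbhs_normP; exists e%:C => /=; first by rewrite ltcR.
by move=> w /=; rewrite -normrN opprB nrm_lt; exact: h.
Qed.

Lemma closure_nrmP (A : set V) v :
  closure A v <-> forall e, 0 < e -> exists2 w, A w & nrm (w - v) < e.
Proof.
split=> [cl e e0|h B /nbhs_nrmP[e e0 eB]].
  have /cl[w [Aw wv]] : nbhs v [set w | nrm (w - v) < e] by apply/nbhs_nrmP; exists e.
  by exists w.
by have [w Aw wv] := h _ e0; exists w; split => //; exact: eB.
Qed.

End Module.

Lemma continuous_nrmP (V W : normedModType R[i]) (f : V -> W) v :
  {for v, continuous f} <-> forall e : R, 0 < e -> exists2 d : R, 0 < d &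
    forall w, nrm (w - v) < d -> nrm (f w - f v) < e.
Proof.
split=> [cf e e0|h A /nbhs_nrmP[e e0 eA]].
  have /cf /nbhs_nrmP[d d0 dA] : nbhs (f v) [set w | nrm (w - f v) < e].
    by apply/nbhs_nrmP; exists e.
  by exists d => // w wv; exact: dA.
have [d d0 hd] := h _ e0; apply/nbhs_nrmP.
by exists d => // w wv; apply: eA; exact: hd.
Qed.

Lemma nrmZ (V : normedModType R[i]) c (v : V) : nrm (c *: v) = nrm c * nrm v.
Proof. by apply: complexI; rewrite rmorphM /= -!nrmE normrZ. Qed.

Implicit Types z w : R[i].

Lemma nrmM z w : nrm (z * w) = nrm z * nrm w.
Proof. by apply: complexI; rewrite rmorphM /= -!nrmE normrM. Qed.

Lemma nrmV z : nrm z^-1 = (nrm z)^-1.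
Proof. by apply: complexI; rewrite fmorphV /= -!nrmE normfV. Qed.

Lemma nrmX z n : nrm (z ^+ n) = nrm z ^+ n.
Proof. by apply: complexI; rewrite rmorphXn /= -!nrmE normrX. Qed.

Lemma nrm_gt0 z : z != 0 -> 0 < nrm z.
Proof.
move=> z0; rewrite lt_neqAle nrm_ge0 andbT eq_sym.
by apply: contra z0 => /eqP/nrm_eq0 ->.
Qed.

Lemma nrm_sqr z : nrm z ^+ 2 = complex.Re z ^+ 2 + complex.Im z ^+ 2.
Proof. by apply: complexI; rewrite add_Re2_Im2 nrmE rmorphXn. Qed.

Lemma nrm_conj z : nrm z^* = nrm z.
Proof. by rewrite /nrm norm_conjC. Qed.

Lemma nrm_real (x : R) : nrm x%:C = `|x|.
Proof. by rewrite /nrm normc_def /= expr0n addr0 sqrtr_sqr. Qed.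

Lemma nrm_Re z : `|complex.Re z| <= nrm z.
Proof.
rewrite -(ler_pXn2r (n := 2)) ?nnegrE ?nrm_ge0// nrm_sqr real_normK ?num_real//.
by rewrite lerDl sqr_ge0.
Qed.

Lemma nrm_Im z : `|complex.Im z| <= nrm z.
Proof.
rewrite -(ler_pXn2r (n := 2)) ?nnegrE ?nrm_ge0// nrm_sqr real_normK ?num_real//.
by rewrite lerDr sqr_ge0.
Qed.

Lemma nrm_ReIm z : nrm z <= `|complex.Re z| + `|complex.Im z|.
Proof.
rewrite -(ler_pXn2r (n := 2)) ?nnegrE ?nrm_ge0 ?addr_ge0// nrm_sqr.
by rewrite sqrrD !real_normK ?num_real// lerD2r lerDl mulrn_wge0 ?mulr_ge0.
Qed.

Lemma invS_small (e : R) : 0 < e -> exists N, forall n, (N <= n)%N -> n.+1%:R^-1 < e.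
Proof.
move=> e_gt0; exists (Num.bound e^-1) => n hn.
rewrite -ltf_pV2 ?posrE ?invr_gt0// invrK; apply: lt_le_trans (archi_boundP _) _.
  by rewrite invr_ge0 ltW.
by rewrite ler_nat ltnW.
Qed.

End RealNorm.
Arguments invS_small [R] e _.

(** * Midpoint sums around squares and the lemma of Goursat *)

Section MidpointSums.
Variable R : realType.
Implicit Types (a s t m : R) (k l : R -> R[i]) (g : R[i] -> R[i]).

(** A Riemann sum with 2 ^ n midpoints, halved recursively so that it is additive
    under bisection by definition. Midpoints make it exact on affine functions. *)
Fixpoint midpoint_sum n a s k : R[i] :=
  if n is n'.+1 then midpoint_sum n' a (s / 2) k + midpoint_sum n' (a + s / 2) (s / 2) k
  else s%:C * k (a + s / 2).

Lemma midpoint_sum_linear c n a s k l :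
  midpoint_sum n a s (fun t => c * k t + l t) = c * midpoint_sum n a s k + midpoint_sum n a s l.
Proof.
elim: n a s => [|n ih] a s /=; first ring.
rewrite !ih; ring.
Qed.

Lemma midpoint_sum_affine n a s (u v : R[i]) :
  midpoint_sum n a s (fun t => u + v * t%:C) = s%:C * (u + v * (a + s / 2)%:C).
Proof.
elim: n a s => [|n ih] a s //=.
rewrite !ih !(rmorphD, rmorphM, fmorphV, rmorph1) /=; by field.
Qed.

Lemma midpoint_sum_le n a s k m : 0 <= s ->
  (forall t, a <= t <= a + s -> nrm (k t) <= m) -> nrm (midpoint_sum n a s k) <= s * m.
Proof.
elim: n a s => [|n ih] a s s0 h /=.
  by rewrite nrmM nrm_real ger0_norm// ler_wpM2l// h//; lra.
have -> : s * m = s / 2 * m + s / 2 * m by lra.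
apply: (le_trans (nrmD _ _)).
by apply: lerD; apply: ih => [|t ht]; try apply: h; lra.
Qed.

Lemma midpoint_sum_Im_ge n a s k m : 0 <= s ->
  (forall t, a <= t <= a + s -> m <= complex.Im (k t)) ->
  s * m <= complex.Im (midpoint_sum n a s k).
Proof.
elim: n a s => [|n ih] a s s0 h /=.
  have := h (a + s / 2); case: (k _) => p q /= hq.
  rewrite mul0r addr0; apply: ler_wpM2l => //; apply: hq; lra.
have -> : s * m = s / 2 * m + s / 2 * m by lra.
rewrite raddfD /=.
by apply: lerD; apply: ih => [|t ht]; try apply: h; lra.
Qed.

(** The discrete contour integral of [g] along the boundary of the square with
    lower left corner [x +i* y] and side [s], counterclockwise. *)
Definition boundary_sum n x y s g : R[i] :=
  midpoint_sum n x s (fun t => g (t +i* y)) + 'i%C * midpoint_sum n y s (fun t => g ((x + s) +i* t))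
  - midpoint_sum n x s (fun t => g (t +i* (y + s))) - 'i%C * midpoint_sum n y s (fun t => g (x +i* t)).

(** The four inner edges are each traversed twice, in opposite directions. *)
Lemma boundary_sum_quarters n x y s g : let h := s / 2 in
  boundary_sum n.+1 x y s g = boundary_sum n x y h g + boundary_sum n (x + h) y h g
                      + boundary_sum n x (y + h) h g + boundary_sum n (x + h) (y + h) h g.
Proof.
move=> h; rewrite /boundary_sum /= -/h.
have -> : x + s = x + h + h by rewrite /h; lra.
have -> : y + s = y + h + h by rewrite /h; lra.
ring.
Qed.

Lemma boundary_sum_linear c n x y s (f g : R[i] -> R[i]) :
  boundary_sum n x y s (fun w => c * f w + g w) = c * boundary_sum n x y s f + boundary_sum n x y s g.
Proof. rewrite /boundary_sum !midpoint_sum_linear; ring. Qed.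

Lemma complex_ReIm (a b : R) : (a +i* b) = a%:C + 'i%C * b%:C.
Proof. by rewrite [LHS]complexE. Qed.

Lemma boundary_sum_affine n x y s (u v : R[i]) : boundary_sum n x y s (fun w => u + v * w) = 0.
Proof.
have E1 b : (fun t : R => u + v * (t +i* b)) = (fun t => (u + v * ('i%C * b%:C)) + v * t%:C).
  by apply/funext => t; rewrite complex_ReIm; ring.
have E2 b : (fun t : R => u + v * (b +i* t)) = (fun t => (u + v * b%:C) + (v * 'i%C) * t%:C).
  by apply/funext => t; rewrite complex_ReIm; ring.
rewrite /boundary_sum !E1 !E2 !midpoint_sum_affine !(rmorphD, rmorphM) /=; ring.
Qed.

Definition boundary x y s : set R[i] := [set w |
  [/\ x <= complex.Re w <= x + s, y <= complex.Im w <= y + s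
    & complex.Re w = x \/ complex.Re w = x + s \/ complex.Im w = y \/ complex.Im w = y + s]].

Lemma nrm_i : nrm ('i%C : R[i]) = 1.
Proof. by apply/eqP; rewrite -(@eqrXn2 _ 2) ?nrm_ge0// nrm_sqr /= expr0n add0r. Qed.

Lemma boundary_sum_le n x y s g m : 0 <= s ->
  (forall w, boundary x y s w -> nrm (g w) <= m) -> nrm (boundary_sum n x y s g) <= 4 * s * m.
Proof.
move=> s0 h; rewrite /boundary_sum.
have -> : 4 * s * m = s * m + s * m + s * m + s * m by lra.
apply: (le_trans (nrmB _ _)); apply: lerD; last first.
  by rewrite nrmM nrm_i mul1r; apply: midpoint_sum_le => // t ht; apply: h; split=> //=; try lra; tauto.
apply: (le_trans (nrmB _ _)); apply: lerD; last first.
  by apply: midpoint_sum_le => // t ht; apply: h; split=> //=; try lra; tauto.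
apply: (le_trans (nrmD _ _)); apply: lerD; last first.
  by rewrite nrmM nrm_i mul1r; apply: midpoint_sum_le => // t ht; apply: h; split=> //=; try lra; tauto.
by apply: midpoint_sum_le => // t ht; apply: h; split=> //=; try lra; tauto.
Qed.

(** Otherwise one of the four quarters of a bad square is bad, again and again;
    the nested bad squares shrink to a point, where the local hypothesis
    applies. *)
Lemma square_induction (P : R -> R -> R -> Prop) (x0 y0 s0 : R) : 0 < s0 ->
  (forall x y s, 0 < s -> let h := s / 2 in
    P x y h -> P (x + h) y h -> P x (y + h) h -> P (x + h) (y + h) h -> P x y s) ->
  (forall a b, x0 <= a <= x0 + s0 -> y0 <= b <= y0 + s0 ->
    exists2 d, 0 < d & forall x y s, 0 < s -> s < d ->
      x0 <= x -> x + s <= x0 + s0 -> y0 <= y -> y + s <= y0 + s0 ->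
      x <= a <= x + s -> y <= b <= y + s -> P x y s) ->
  P x0 y0 s0.
Proof.
move=> s0_gt0 glue loc; apply: contrapT => nP.
have split1 (q : R * R * R) : exists e : bool * bool, let: (x, y, s) := q in
    0 < s -> ~ P x y s -> ~ P (x + (s / 2) *+ e.1) (y + (s / 2) *+ e.2) (s / 2).
  move: q => [[x y] s]; apply: contrapT => hn.
  have [s_gt0 nPs] : 0 < s /\ ~ P x y s.
    apply: contrapT => h; apply: hn; exists (true, true) => h1 h2.
    by case: h.
  apply: nPs; apply: glue => //=; apply: contrapT => hP; apply: hn.
  - by exists (false, false) => _ _ /=; rewrite !mulr0n !addr0.
  - by exists (true, false) => _ _ /=; rewrite mulr0n mulr1n !addr0.
  - by exists (false, true) => _ _ /=; rewrite mulr0n mulr1n !addr0.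
  - by exists (true, true).
have [e he] := choice split1.
pose step (q : R * R * R) := let: (x, y, s) := q in
  (x + (s / 2) *+ (e q).1, y + (s / 2) *+ (e q).2, s / 2).
pose Q n := iter n step (x0, y0, s0).
pose X n := (Q n).1.1; pose Y n := (Q n).1.2; pose S n := (Q n).2.
have SE n : S n = s0 / 2 ^+ n.
  elim: n => [|n ih]; first by rewrite /S /= divr1.
  move: ih; rewrite /S /Q iterS; case: (iter n step _) => [[x y] s] /= ->.
  by rewrite exprS; field; rewrite expf_neq0.
have S_gt0 n : 0 < S n by rewrite SE divr_gt0// exprn_gt0.
have bad n : ~ P (X n) (Y n) (S n).
  elim: n => // n ih; move: ih (S_gt0 n); rewrite /X /Y /S /Q iterS.
  move: (he (iter n step (x0, y0, s0))).
  by rewrite /step; case: (iter n _ _) => [[x y] s] /= h nPs s_gt0; exact: h.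
have stepX n : X n <= X n.+1 /\ X n.+1 + S n.+1 <= X n + S n.
  move: (S_gt0 n); rewrite /X /S /Q iterS; move: (iter n step _) => q.
  case: q => [[x y] s] /= s_gt0; case: (e _) => [b1 b2] /=.
  by case: b1; rewrite ?mulr0n ?mulr1n; lra.
have stepY n : Y n <= Y n.+1 /\ Y n.+1 + S n.+1 <= Y n + S n.
  move: (S_gt0 n); rewrite /Y /S /Q iterS; move: (iter n step _) => q.
  case: q => [[x y] s] /= s_gt0; case: (e _) => [b1 b2] /=.
  by case: b2; rewrite ?mulr0n ?mulr1n; lra.
have nest (Z : nat -> R) : (forall n, Z n <= Z n.+1 /\ Z n.+1 + S n.+1 <= Z n + S n) ->
    (forall n, Z 0%N <= Z n /\ Z n + S n <= Z 0%N + S 0%N) /\ exists a, forall n, Z n <= a <= Z n + S n.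
  move=> hZ.
  have mono (m n : nat) : Z m <= Z (m + n)%N /\ Z (m + n)%N + S (m + n)%N <= Z m + S m.
    elim: n => [|n ih]; first by rewrite addn0.
    by rewrite addnS; have := hZ (m + n)%N; lra.
  split; first by move=> n; have := mono 0%N n; rewrite add0n.
  have ub (m : nat) : ubound (range Z) (Z m + S m).
    move=> _ [n _ <-]; have := mono m n; have := mono n m; rewrite addnC.
    by have := S_gt0 (m + n)%N; have := S_gt0 n; lra.
  exists (sup (range Z)) => n; apply/andP; split.
    by apply: ub_le_sup; [exists (Z 0%N + S 0%N); exact: ub|exists n].
  by apply: ge_sup; [exists (Z 0%N), 0%N|exact: ub].
have [bX [a ha]] := nest X stepX; have [bY [b hb]] := nest Y stepY.
have [d d0 hd] := loc a b (ha 0%N) (hb 0%N).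
have [n hn] : exists n, S n < d.
  exists (Num.bound (s0 / d)); rewrite SE ltr_pdivrMr ?exprn_gt0// mulrC -ltr_pdivrMr//.
  apply: lt_le_trans (archi_boundP _) _; first by rewrite divr_ge0// ltW.
  by rewrite -natrX ler_nat ltnW// ltn_expl.
have := bX n; have := bY n; rewrite /(X 0%N) /(Y 0%N) /(S 0%N) /= => -[y1 y2] [x1 x2].
by apply: (bad n); apply: hd.
Qed.

(** The gauge [mu] is any additive weight of squares. With the area as weight this
    is the classical lemma; other weights tolerate exceptional points and lines,
    at which the boundary sums are not of the order of the area. *)
Lemma goursat (mu : R -> R -> R -> R) g (x0 y0 s0 : R) : 0 < s0 ->
  (forall x y s, 0 < s -> let h := s / 2 in
     mu x y s = mu x y h + mu (x + h) y h + mu x (y + h) h + mu (x + h) (y + h) h) ->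
  (forall e a b, 0 < e -> x0 <= a <= x0 + s0 -> y0 <= b <= y0 + s0 ->
    exists2 d, 0 < d & forall x y s n, 0 < s -> s < d ->
      x0 <= x -> x + s <= x0 + s0 -> y0 <= y -> y + s <= y0 + s0 ->
      x <= a <= x + s -> y <= b <= y + s -> nrm (boundary_sum n x y s g) <= e * mu x y s) ->
  forall e, 0 < e -> exists N, forall n, (N <= n)%N -> nrm (boundary_sum n x0 y0 s0 g) <= e * mu x0 y0 s0.
Proof.
move=> s_gt0 muD loc e e_gt0.
pose P x y s := exists N, forall n, (N <= n)%N -> nrm (boundary_sum n x y s g) <= e * mu x y s.
apply: (square_induction (P := P)) => // [x y s hs h|a b ha hb].
  move=> [n1 h1] [n2 h2] [n3 h3] [n4 h4]; exists (n1 + n2 + n3 + n4).+1 => -[//|n].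
  rewrite ltnS => hn; rewrite boundary_sum_quarters -/h muD// -/h.
  have := h1 n; have := h2 n; have := h3 n; have := h4 n.
  move=> /(_ ltac:(lia)) k4 /(_ ltac:(lia)) k3 /(_ ltac:(lia)) k2 /(_ ltac:(lia)) k1.
  rewrite !mulrDr; do 3 (apply: (le_trans (nrmD _ _)); apply: lerD => //).
have [d d0 hd] := loc e a b e_gt0 ha hb.
by exists d => // x y s *; exists 0%N => n _; exact: hd.
Qed.

End MidpointSums.

(** * A Cauchy estimate *)

Section ComplexDifferentiability.
Variable R : realType.
Implicit Types (f g h : R[i] -> R[i]) (c z w : R[i]).

(** Complex differentiability in the form of Caratheodory: the difference quotient
    extends continuously to [z]. Sums, products and inverses then reduce to
    continuity. *)
Definition cdiff h z := exists2 psi : R[i] -> R[i], {for z, continuous psi} &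
  \forall w \near z, h w = h z + psi w * (w - z).

Lemma cont_cst c z : {for z, continuous (fun=> c : R[i])}.
Proof. by apply/continuous_nrmP => e e0; exists 1 => // w _; rewrite subrr nrm0. Qed.

Lemma cont_id z : {for z, continuous (id : R[i] -> R[i])}.
Proof. by apply/continuous_nrmP => e e0; exists e. Qed.

Lemma contD f g z : {for z, continuous f} -> {for z, continuous g} ->
  {for z, continuous (fun w => f w + g w)}.
Proof. by move=> cf cg; exact: (cvgD cf cg). Qed.

Lemma contN f z : {for z, continuous f} -> {for z, continuous (fun w => - f w)}.
Proof. by move=> cf; exact: (cvgN cf). Qed.

Lemma contM f g z : {for z, continuous f} -> {for z, continuous g} ->
  {for z, continuous (fun w => f w * g w)}.
Proof. by move=> cf cg; exact: (cvgM cf cg). Qed.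

Lemma contV f z : f z != 0 -> {for z, continuous f} ->
  {for z, continuous (fun w => (f w)^-1)}.
Proof. by move=> fz0 cf; exact: (cvgV fz0 cf). Qed.

Lemma continuous_near f g z : f z = g z -> (\forall w \near z, f w = g w) ->
  {for z, continuous g} -> {for z, continuous f}.
Proof.
move=> fgz fg cg; rewrite /prop_for /continuous_at fgz.
apply: cvg_trans cg; apply: (@near_eq_cvg _ _ (nbhs z)).
by apply: filterS fg => w ->.
Qed.

Lemma cdiff_continuous h z : cdiff h z -> {for z, continuous h}.
Proof.
move=> [psi cpsi hE]; apply: (continuous_near _ hE); first by rewrite subrr mulr0 addr0.
apply: contD; first exact: cont_cst.
exact (contM cpsi (contD (@cont_id z) (@cont_cst (- z) z))).
Qed.

Lemma cdiff_near f g z : f z = g z -> (\forall w \near z, f w = g w) ->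
  cdiff g z -> cdiff f z.
Proof.
move=> fgz fg [psi cpsi gE]; exists psi => //; rewrite fgz.
by near=> w; rewrite (near fg w)// (near gE w).
Unshelve. all: by end_near. Qed.

Lemma cdiff_cst c z : cdiff (fun=> c) z.
Proof.
exists (fun=> 0); first exact: cont_cst.
by near=> w; rewrite mul0r addr0.
Unshelve. all: by end_near. Qed.

Lemma cdiff_id z : cdiff id z.
Proof.
exists (fun=> 1); first exact: cont_cst.
by near=> w; rewrite mul1r addrC subrK.
Unshelve. all: by end_near. Qed.

Lemma cdiffD f g z : cdiff f z -> cdiff g z -> cdiff (fun w => f w + g w) z.
Proof.
move=> [p cp fE] [q cq gE]; exists (fun w => p w + q w); first exact: contD.
by near=> w; rewrite (near fE w)// (near gE w)//; ring.
Unshelve. all: by end_near. Qed.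

Lemma cdiffM f g z : cdiff f z -> cdiff g z -> cdiff (fun w => f w * g w) z.
Proof.
move=> df dg; have cg := cdiff_continuous dg.
move: df dg => [p cp fE] [q cq gE]; exists (fun w => f z * q w + p w * g w).
  exact (contD (contM (@cont_cst (f z) z) cq) (contM cp cg)).
near=> w; rewrite (near fE w)// mulrDl {1}(near gE w)//; ring.
Unshelve. all: by end_near. Qed.

Lemma cdiffN f z : cdiff f z -> cdiff (fun w => - f w) z.
Proof.
move=> df; apply: (cdiff_near _ _ (cdiffM (cdiff_cst (-1) z) df)); first by rewrite mulN1r.
by near=> w; rewrite mulN1r.
Unshelve. all: by end_near. Qed.

Lemma cdiffX f z n : cdiff f z -> cdiff (fun w => f w ^+ n) z.
Proof.
move=> df; elim: n => [|n ih]; first exact: cdiff_cst.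
have := cdiffM df ih; congr (cdiff _ _); apply/funext => w; exact/esym/exprS.
Qed.

Lemma cdiffV f z : f z != 0 -> cdiff f z -> cdiff (fun w => (f w)^-1) z.
Proof.
move=> fz0 df; have cf := cdiff_continuous df.
move: df => [p cp fE]; exists (fun w => - (p w * (f w)^-1 * (f z)^-1)).
  exact (contN (contM (contM cp (contV fz0 cf)) (@cont_cst (f z)^-1 z))).
have fn0 : \forall w \near z, f w != 0.
  have /continuous_nrmP/(_ _ (nrm_gt0 fz0))[d d0 hd] := cf.
  apply/nbhs_nrmP; exists d => // w /hd; apply: contraTneq => ->.
  by rewrite sub0r nrmN ltxx.
near=> w; have fw0 : f w != 0 by near: w.
have E : f w - f z = p w * (w - z) by rewrite (near fE w)//; ring.
apply/eqP; rewrite -subr_eq0; apply/eqP.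
transitivity ((f w - f z - p w * (w - z)) * - ((f w)^-1 * (f z)^-1)); last by rewrite E subrr mul0r.
by field; rewrite fw0 fz0.
Unshelve. all: by end_near. Qed.

End ComplexDifferentiability.

Section Cauchy.
Variable R : realType.
Implicit Types (a b x y s m e : R) (f g h : R[i] -> R[i]) (c z w : R[i]).

(** The number, among the two one-sided germs at [a], of those that lie in the
    interval from [x] to [x + s]. Unlike membership in a closed interval, it is
    additive under bisection, and it is at least one on intervals containing [a]. *)
Definition germ_count a x s : R :=
  ((a < x + s)%R%:R - (a < x)%R%:R) + ((a <= x + s)%R%:R - (a <= x)%R%:R).

(** As for [germ_count], with all points of (1/2)Z in place of [a]: floor counts the
    germs on the right of these points and ceil those on their left. *)
Definition level_count y s : R :=
  (Num.floor (2 * (y + s)) - Num.floor (2 * y)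
   + (Num.ceil (2 * (y + s)) - Num.ceil (2 * y)))%:~R.

Definition on_level z := exists k : int, complex.Im z = k%:~R / 2.

Lemma germ_count_split a x s : germ_count a x s = germ_count a x (s / 2) + germ_count a (x + s / 2) (s / 2).
Proof.
have telescope (p q r p' q' r' : R) :
  (p - q) + (p' - q') = ((r - q) + (r' - q')) + ((p - r) + (p' - r')) by ring.
rewrite /germ_count; have -> : x + s / 2 + s / 2 = x + s by lra.
exact: telescope.
Qed.

Lemma germ_count_ge0 a x s : 0 < s -> 0 <= germ_count a x s.
Proof.
move=> s0; rewrite /germ_count addr_ge0// subr_ge0 ler_nat.
  by have [h|] := ltP a x => //; rewrite (_ : a < x + s)//; lra.
by have [h|] := leP a x => //; rewrite (_ : a <= x + s)//; lra.
Qed.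

Lemma germ_count_ge1 a x s : 0 < s -> x <= a <= x + s -> 1 <= germ_count a x s.
Proof.
move=> s0 /andP[xa as_]; rewrite /germ_count as_ [a < x]ltNge xa /= subr0.
have [h|h] := leP a x; last by rewrite subr0 lerDr ler0n.
by rewrite (_ : a < x + s) ?subrr ?addr0//; lra.
Qed.

Lemma level_count_split y s : level_count y s = level_count y (s / 2) + level_count (y + s / 2) (s / 2).
Proof.
rewrite /level_count; have -> : y + s / 2 + s / 2 = y + s by lra.
by rewrite -rmorphD /=; congr (_%:~R); ring.
Qed.

Lemma level_count_ge0 y s : 0 < s -> 0 <= level_count y s.
Proof.
move=> s0; rewrite /level_count ler0z addr_ge0// subr_ge0.
  by apply: le_floor; lra.
by apply: le_ceil; lra.
Qed.

Lemma level_count_ge1 y s (k : int) : 0 < s -> y <= k%:~R / 2 <= y + s -> 1 <= level_count y s.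
Proof.
move=> s0 /andP[yk ks]; rewrite /level_count ler1z.
have f1 : k <= Num.floor (2 * (y + s)) by rewrite floor_ge_int//; lra.
have f2 : Num.floor (2 * y) <= k by rewrite -(ler_int R); apply: le_trans (floor_le _) _; lra.
have f3 : Num.ceil (2 * y) <= k by rewrite ceil_le_int//; lra.
have f4 : k <= Num.ceil (2 * (y + s)) by rewrite -(ler_int R); apply: le_trans (ceil_ge _); lra.
have [yk'|yk'] := ltP y (k%:~R / 2).
  have : Num.floor (2 * y) < k by rewrite floor_lt_int//; lra.
  lia.
have : k < Num.ceil (2 * (y + s)) by rewrite ceil_gt_int//; lra.
lia.
Qed.

Lemma nrm_square x y s z w : x <= complex.Re z <= x + s -> y <= complex.Im z <= y + s ->
  x <= complex.Re w <= x + s -> y <= complex.Im w <= y + s -> nrm (w - z) <= 2 * s.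
Proof.
case: z w => [p q] [p' q'] /= h1 h2 h3 h4.
apply: (le_trans (nrm_ReIm _)); have -> : 2 * s = s + s by lra.
by apply: lerD; rewrite /= ler_norml; lra.
Qed.

Definition in_square x y s z := x <= complex.Re z <= x + s /\ y <= complex.Im z <= y + s.

Lemma boundary_in_square x y s w : boundary x y s w -> in_square x y s w.
Proof. by case. Qed.

Lemma boundary_sum_sub_affine n x y s g (u v : R[i]) :
  boundary_sum n x y s g = boundary_sum n x y s (fun w => g w - (u + v * w)).
Proof.
have := boundary_sum_linear (-1) n x y s (fun w => u + v * w) g.
rewrite boundary_sum_affine mulr0 add0r => <-.
by congr boundary_sum; apply/funext => w; ring.
Qed.

(** Goursat's lemma for a function that may fail to be differentiable on the
    horizontal lines at heights in (1/2)Z, where it is continuous, and at one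
    point, near which it is bounded. *)
Lemma boundary_sum_cvg0 g c m x0 y0 s0 : 0 < s0 ->
  (exists2 d : R, 0 < d & forall w, nrm (w - c) < d -> nrm (g w) <= m) ->
  (forall z, in_square x0 y0 s0 z -> z != c -> on_level z -> {for z, continuous g}) ->
  (forall z, in_square x0 y0 s0 z -> z != c -> ~ on_level z -> cdiff g z) ->
  forall e, 0 < e -> exists N, forall n, (N <= n)%N -> nrm (boundary_sum n x0 y0 s0 g) <= e.
Proof.
move=> s0_gt0 [d d_gt0 hd] gcont gdiff e e_gt0.
have m_ge0 : 0 <= m by apply: le_trans (nrm_ge0 (g c)) (hd _ _); rewrite subrr nrm0.
pose a := complex.Re c; pose b := complex.Im c.
pose mu x y s := s ^+ 2 + germ_count a x s * germ_count b y s + s * level_count y s.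
have mu_ge0 x y s : 0 < s -> 0 <= mu x y s.
  move=> s_gt0; rewrite /mu !addr_ge0 ?sqr_ge0 ?mulr_ge0 ?germ_count_ge0 ?level_count_ge0//.
  exact: ltW.
have muD x y s : 0 < s -> let h := s / 2 in
     mu x y s = mu x y h + mu (x + h) y h + mu x (y + h) h + mu (x + h) (y + h) h.
  move=> s_gt0 h; rewrite /mu (germ_count_split a x s) (germ_count_split b y s).
  rewrite (level_count_split y s) -/h; have -> : s = h + h by rewrite /h; lra.
  ring.
have [//||N hN] := @goursat R mu g x0 y0 s0 s0_gt0 muD _ (e / (mu x0 y0 s0 + 1)) _;
  last first.
- exists N => n /hN /le_trans; apply.
  have := mu_ge0 x0 y0 _ s0_gt0 => h.
  by rewrite mulrAC ler_pdivrMr; [rewrite ler_pM2l//; lra|lra].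
- by rewrite divr_gt0//; have := mu_ge0 x0 y0 _ s0_gt0; lra.
move=> {e e_gt0} e a' b' e_gt0 ha' hb'; pose z := a' +i* b'.
have zQ : in_square x0 y0 s0 z by [].
have [zc|zc] := eqVneq z c.
  have ha : a' = a by rewrite /a -zc.
  have hb : b' = b by rewrite /b -zc.
  have d'_gt0 : 0 < Num.min (d / 2) (e / (4 * m + 1)).
    by rewrite lt_min !divr_gt0//; lra.
  exists (Num.min (d / 2) (e / (4 * m + 1))) => // x y s n s_gt0.
  rewrite lt_min => /andP[sd]; rewrite ltr_pdivlMr => [se|]; last by lra.
  move=> _ _ _ _ hx hy.
  have -> : e * mu x y s = e * (germ_count a x s * germ_count b y s) + e * (s ^+ 2 + s * level_count y s).
    rewrite /mu; ring.
  have h1 : 1 <= germ_count a x s * germ_count b y s.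
    by rewrite -[1]mulr1 ler_pM ?germ_count_ge1// -?ha -?hb.
  have h2 : 0 <= e * (s ^+ 2 + s * level_count y s).
    by rewrite mulr_ge0 ?addr_ge0 ?sqr_ge0 ?mulr_ge0 ?level_count_ge0// ltW.
  have h3 : e * 1 <= e * (germ_count a x s * germ_count b y s) by rewrite ler_pM2l.
  suff : nrm (boundary_sum n x y s g) <= 4 * s * m by lra.
  apply: boundary_sum_le => [|w /boundary_in_square[wx wy]]; first exact: ltW.
  apply: hd; apply: (@le_lt_trans _ _ (2 * s)); last by lra.
  by apply: (@nrm_square x y) => //; rewrite -/a -/b -?ha -?hb.
have [zl|zl] := pselect (on_level z).
  have /continuous_nrmP/(_ (e / 4))[|d1 d1_gt0 hd1] := gcont z zQ zc zl.
    by rewrite divr_gt0.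
  exists (d1 / 2); first by rewrite divr_gt0.
  move=> x y s n s_gt0 sd _ _ _ _ hx hy.
  have [k zk] := zl.
  have h1 : 1 <= level_count y s by apply: (level_count_ge1 (k := k)) => //; rewrite -zk.
  have h2 : 0 <= e * (s ^+ 2 + germ_count a x s * germ_count b y s).
    by rewrite mulr_ge0 ?addr_ge0 ?sqr_ge0 ?mulr_ge0 ?germ_count_ge0// ltW.
  have h3 : e * s * 1 <= e * s * level_count y s by rewrite ler_wpM2l// mulr_ge0// ltW.
  have -> : e * mu x y s = e * s * level_count y s + e * (s ^+ 2 + germ_count a x s * germ_count b y s).
    rewrite /mu; ring.
  suff : nrm (boundary_sum n x y s g) <= 4 * s * (e / 4) by lra.
  rewrite (boundary_sum_sub_affine n x y s g (g z) 0).
  apply: boundary_sum_le => [|w /boundary_in_square[wx wy]]; first exact: ltW.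
  rewrite mul0r addr0; apply/ltW/hd1; apply: (@le_lt_trans _ _ (2 * s)); last by lra.
  by apply: (@nrm_square x y).
(* At a differentiable point the remainder is o(s) on the boundary, and the weight s ^ 2
   absorbs it; the two other cases use the germ and level weights. *)
have [psi cpsi /nbhs_nrmP[d2 d2_gt0 gE]] := gdiff z zQ zc zl.
have /continuous_nrmP/(_ (e / 8))[|d1 d1_gt0 hd1] := cpsi; first by rewrite divr_gt0.
exists (Num.min d1 d2 / 2); first by rewrite divr_gt0// lt_min d1_gt0.
move=> x y s n s_gt0; rewrite ltr_pdivlMr// lt_min => /andP[sd1 sd2] _ _ _ _ hx hy.
have h2 : 0 <= e * (s * level_count y s + germ_count a x s * germ_count b y s).
  by rewrite mulr_ge0 ?addr_ge0 ?sqr_ge0 ?mulr_ge0 ?germ_count_ge0 ?level_count_ge0// ltW.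
have -> : e * mu x y s = e * s ^+ 2 + e * (s * level_count y s + germ_count a x s * germ_count b y s).
  rewrite /mu; ring.
suff : nrm (boundary_sum n x y s g) <= 4 * s * (e / 8 * (2 * s)) by lra.
rewrite (boundary_sum_sub_affine n x y s g (g z - psi z * z) (psi z)).
apply: boundary_sum_le => [|w /boundary_in_square[wx wy]]; first exact: ltW.
have wz : nrm (w - z) <= 2 * s by apply: (@nrm_square x y).
rewrite gE; last by lra.
have -> : g z + psi w * (w - z) - (g z - psi z * z + psi z * w) = (psi w - psi z) * (w - z).
  ring.
rewrite nrmM ler_pM ?nrm_ge0//; apply/ltW/hd1; lra.
Qed.

Lemma midpoint_sumZ (u : R[i]) n a s k : midpoint_sum n a s (fun t => u * k t) = u * midpoint_sum n a s k.
Proof. by elim: n a s => [|n ih] a s /=; [ring|rewrite !ih; ring]. Qed.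

Lemma ImV_ge (p q s r : R) : p ^+ 2 <= s ^+ 2 -> q ^+ 2 <= s ^+ 2 -> 0 < q ^+ 2 -> 0 <= r ->
  r <= q -> r / (2 * s ^+ 2) <= q / (p ^+ 2 + q ^+ 2).
Proof.
move=> ps qs q0 r0 rq; have p0 := sqr_ge0 p.
apply: ler_pM => //; first by rewrite invr_ge0; lra.
by rewrite lef_pV2 ?posrE; lra.
Qed.

(** The discrete form of the positivity of the winding number: on each side of the
    square the imaginary part of dw / (w - c) is at least the distance from [c] to
    that side over 2 s ^ 2, and the four distances add up to 2 s. *)
Lemma boundary_sum_pole n x y s c : x < complex.Re c < x + s -> y < complex.Im c < y + s ->
  1 <= complex.Im (boundary_sum n x y s (fun w => (w - c)^-1)).
Proof.
case: c => [a b] /= ha hb; have s_gt0 : 0 < s by lra.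
have s2 : 0 < s ^+ 2 by rewrite exprn_gt0.
rewrite /boundary_sum -!midpoint_sumZ.
set k1 := fun t => _; set k2 := fun t => _; set k3 := fun t => _; set k4 := fun t => _.
have Im_ge l k r : (forall t, l <= t <= l + s -> r / (2 * s ^+ 2) <= complex.Im (k t)) ->
    r / (2 * s) <= complex.Im (midpoint_sum n l s k).
  move=> h; have := midpoint_sum_Im_ge n (ltW s_gt0) h.
  by have -> : s * (r / (2 * s ^+ 2)) = r / (2 * s) by field; lra.
have sq (q : R) : -s <= q <= s -> q ^+ 2 <= s ^+ 2.
  by move=> h; rewrite -subr_ge0 subr_sqr mulr_ge0//; lra.
have q2 (q : R) : 0 < q -> 0 < q ^+ 2 by move=> q0; rewrite exprn_gt0.
have E1 : (b - y) / (2 * s) <= complex.Im (midpoint_sum n x s k1).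
  apply: Im_ge => t ht; rewrite /k1 /=.
  have -> : - ((y - b) / ((t - a) ^+ 2 + (y - b) ^+ 2)) =
            (b - y) / ((t - a) ^+ 2 + (b - y) ^+ 2) by rewrite -[y - b]opprB sqrrN mulNr opprK.
  by apply: ImV_ge; [apply: sq|apply: sq|apply: q2| |]; lra.
have E2 : (x + s - a) / (2 * s) <= complex.Im (midpoint_sum n y s k2).
  apply: Im_ge => t ht; rewrite /k2 /=.
  rewrite mul0r mul1r add0r [X in _ <= _ / X]addrC.
  by apply: ImV_ge; [apply: sq|apply: sq|apply: q2| |]; lra.
have E3 : (y + s - b) / (2 * s) <= - complex.Im (midpoint_sum n x s k3).
  have := Im_ge x (fun t => -1 * k3 t) (y + s - b).
  rewrite midpoint_sumZ mulN1r raddfN /=; apply => t ht; rewrite /k3 /= mulN1r opprK oppr0 mul0r addr0.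
  by apply: ImV_ge; [apply: sq|apply: sq|apply: q2| |]; lra.
have E4 : (a - x) / (2 * s) <= - complex.Im (midpoint_sum n y s k4).
  have := Im_ge y (fun t => -1 * k4 t) (a - x).
  rewrite midpoint_sumZ mulN1r raddfN /=; apply => t ht; rewrite /k4 /= !mul0r oppr0 !mul0r mul1r add0r addr0 mulN1r.
  have -> : - ((x - a) / ((x - a) ^+ 2 + (t - b) ^+ 2)) =
            (a - x) / ((t - b) ^+ 2 + (a - x) ^+ 2).
    by rewrite -[x - a]opprB sqrrN mulNr opprK [X in _ / X]addrC.
  by apply: ImV_ge; [apply: sq|apply: sq|apply: q2| |]; lra.
rewrite !(raddfD, raddfB, raddfN) /=.
have : (b - y) / (2 * s) + (x + s - a) / (2 * s) + (y + s - b) / (2 * s)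
       + (a - x) / (2 * s) = 1 by field; lra.
lra.
Qed.

(** Goursat's lemma for (h w - h c) / (w - c), which is bounded near [c]: the
    boundary sum of h w / (w - c) is close to h c times that of the pole. *)
Lemma cauchy_bound h c x y s m : x < complex.Re c < x + s -> y < complex.Im c < y + s ->
  (forall z, in_square x y s z -> on_level z -> {for z, continuous h}) ->
  (forall z, in_square x y s z -> ~ on_level z -> cdiff h z) ->
  ~ on_level c ->
  (forall w, boundary x y s w -> nrm (h w / (w - c)) <= m) ->
  nrm (h c) <= 4 * s * m.
Proof.
move=> hx hy hcont hdiff cl hm; have s_gt0 : 0 < s by lra.
have cQ : in_square x y s c by split; lra.
pose g w := (h w - h c) / (w - c).
have wc z : z != c -> z - c != 0 by rewrite subr_eq0.
apply/ler_addgt0Pr => e e_gt0.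
have [psi cpsi /nbhs_nrmP[d d_gt0 hE]] := hdiff c cQ cl.
have [d' d'_gt0 hd'] : exists2 d : R, 0 < d &
    forall w, nrm (w - c) < d -> nrm (g w) <= nrm (psi c) + 1.
  have /continuous_nrmP/(_ 1 ltr01)[d1 d1_gt0 hd1] := cpsi.
  exists (Num.min d d1); first by rewrite lt_min d_gt0.
  move=> w; rewrite lt_min => /andP[wd wd1]; rewrite /g.
  have [->|wc'] := eqVneq w c; first by rewrite subrr mul0r nrm0 addr_ge0 ?nrm_ge0.
  rewrite hE// addrC addKr mulfK ?wc//.
  have := nrmD (psi w - psi c) (psi c); rewrite subrK; have := hd1 w wd1; lra.
have gcont z : in_square x y s z -> z != c -> on_level z -> {for z, continuous g}.
  move=> zQ zc zl; apply: contM; first by apply: contD; [exact: hcont|exact: cont_cst].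
  by apply: contV; [exact: wc|apply: contD; [exact: cont_id|exact: cont_cst]].
have gdiff z : in_square x y s z -> z != c -> ~ on_level z -> cdiff g z.
  move=> zQ zc zl; apply: cdiffM; first by apply: cdiffD; [exact: hdiff|exact: cdiff_cst].
  by apply: cdiffV; [exact: wc|apply: cdiffD; [exact: cdiff_id|exact: cdiff_cst]].
have [N hN] := boundary_sum_cvg0 s_gt0 (ex_intro2 _ _ d' d'_gt0 hd') gcont gdiff e_gt0.
have {hN} hN := hN N (leqnn N).
have E : boundary_sum N x y s g = - h c * boundary_sum N x y s (fun w => (w - c)^-1)
                          + boundary_sum N x y s (fun w => h w / (w - c)).
  rewrite -boundary_sum_linear; congr boundary_sum; apply/funext => w; rewrite /g; ring.
have B1 : 1 <= nrm (boundary_sum N x y s (fun w => (w - c)^-1)).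
  by apply: (le_trans (boundary_sum_pole N hx hy)); apply: (le_trans (ler_norm _)); exact: nrm_Im.
have B2 := boundary_sum_le N (ltW s_gt0) hm.
have B3 : nrm (h c * boundary_sum N x y s (fun w => (w - c)^-1)) <= 4 * s * m + e.
  have -> : h c * boundary_sum N x y s (fun w => (w - c)^-1)
      = boundary_sum N x y s (fun w => h w / (w - c)) - boundary_sum N x y s g by rewrite E; ring.
  by apply: (le_trans (nrmB _ _)); exact: lerD.
apply: le_trans B3; rewrite nrmM.
by rewrite -[leLHS]mulr1 ler_wpM2l// nrm_ge0.
Qed.

End Cauchy.

(** * Uniqueness of analytic continuation from the edge of a strip *)

Section Strip.
Variable R : realType.
Implicit Types (a b x y s m e t : R) (f g h F : R[i] -> R[i]) (c z w p : R[i]).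

Definition strip : set R[i] := [set z | - 2^-1 <= complex.Im z <= 0].
Definition open_strip : set R[i] := [set z | - 2^-1 < complex.Im z < 0].

Definition cont_on (S : set R[i]) f := forall z, S z -> forall e, 0 < e ->
  exists2 d, 0 < d & forall w, S w -> nrm (w - z) < d -> nrm (f w - f z) < e.

Lemma open_strip_strip z : open_strip z -> strip z.
Proof. by rewrite /open_strip /strip /=; lra. Qed.

Lemma Im_dist z w : `|complex.Im w - complex.Im z| <= nrm (w - z).
Proof. by have := nrm_Im (w - z); rewrite raddfB. Qed.

Lemma Re_dist z w : `|complex.Re w - complex.Re z| <= nrm (w - z).
Proof. by have := nrm_Re (w - z); rewrite raddfB. Qed.

Lemma cont_on_closure f c : cont_on strip f ->
  (forall z, open_strip z -> f z = c) -> forall z, strip z -> f z = c.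
Proof.
move=> cf fo z Sz; apply/eqP; rewrite -subr_eq0; apply/eqP/nrm_small => e e_gt0.
have [d d_gt0 hd] := cf z Sz e e_gt0.
pose r := Num.min d 1 / 2.
have [m1 m2 m0] : [/\ Num.min d 1 <= d, Num.min d 1 <= 1 & 0 < Num.min d 1].
  by split; rewrite ?ge_min ?lexx ?orbT// lt_min d_gt0 /=.
have [r_gt0 rd r1] : [/\ 0 < r, r < d & r < 1] by rewrite /r; split; lra.
(* Move z slightly towards the middle line of the strip. *)
pose u := r * (- 4^-1 - complex.Im z); pose w := z + (0 +i* u).
have wE : complex.Im w = (1 - r) * complex.Im z + r * - 4^-1.
  by rewrite /w raddfD /= /u; ring.
have wS : open_strip w.
  rewrite /open_strip /= wE; move: Sz; rewrite /strip /= => /andP[h1 h2].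
  have : (1 - r) * - 2^-1 <= (1 - r) * complex.Im z by rewrite ler_wpM2l//; lra.
  have : (1 - r) * complex.Im z <= (1 - r) * 0 by rewrite ler_wpM2l//; lra.
  lra.
have uE : nrm (w - z) <= r.
  rewrite /w addrC addKr; apply: (le_trans (nrm_ReIm _)); rewrite /= normr0 add0r /u normrM.
  rewrite gtr0_norm// -[leRHS]mulr1 ler_wpM2l ?(ltW r_gt0)// ler_norml.
  by move: Sz; rewrite /strip /=; lra.
have := hd w (open_strip_strip wS) (le_lt_trans uE rd).
by rewrite fo// nrmBC => /ltW.
Qed.

Lemma square_bounded (k : R[i] -> R) x y s : 0 < s ->
  (forall z, in_square x y s z -> exists m, exists2 d, 0 < d &
     forall w, in_square x y s w -> nrm (w - z) < d -> k w <= m) ->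
  exists m, forall w, in_square x y s w -> k w <= m.
Proof.
move=> s_gt0 kb.
apply: (@square_induction R (fun x y s => exists m, forall w, in_square x y s w -> k w <= m)) => //.
  move=> x' y' s' s'_gt0 h [m1 h1] [m2 h2] [m3 h3] [m4 h4].
  exists (Num.max (Num.max m1 m2) (Num.max m3 m4)) => w [wx wy].
  rewrite !le_max; have hE : h = s' / 2 by [].
  have [wx'|wx'] := leP (complex.Re w) (x' + h); have [wy'|wy'] := leP (complex.Im w) (y' + h).
  - by rewrite h1//; split; lra.
  - by rewrite h3 ?orbT//; split; lra.
  - by rewrite h2 ?orbT//; split; lra.
  - by rewrite h4 ?orbT//; split; lra.
move=> a b ha hb; have zQ : in_square x y s (a +i* b) by [].
have [m [d d_gt0 hd]] := kb _ zQ.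
exists (d / 2); first by rewrite divr_gt0.
move=> x' y' s' s'_gt0 sd h1 h2 h3 h4 hx hy; exists m => w [wx wy].
apply: hd; first by split; lra.
by apply: (@le_lt_trans _ _ (2 * s')); [exact: (@nrm_square _ x' y')|lra].
Qed.

Lemma cont_bounded g x y s : 0 < s ->
  (forall z, in_square x y s z -> {for z, continuous g}) ->
  exists m, forall w, in_square x y s w -> nrm (g w) <= m.
Proof.
move=> s_gt0 gc; apply: square_bounded => // z /gc/continuous_nrmP/(_ 1 ltr01)[d d_gt0 hd].
exists (nrm (g z) + 1), d => // w _ /hd.
by have := nrmD (g w - g z) (g z); rewrite subrK; lra.
Qed.

Lemma geometric_small (K q e : R) : 0 <= q < 1 -> 0 < e -> exists n, K * q ^+ n < e.
Proof.
move=> /andP[q0 q1] e_gt0.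
have [K0|K0] := leP K 0.
  by exists 0%N; rewrite expr0 mulr1; lra.
have /cvgrPdist_lt/(_ (e / K))[|n _ hn] : (GRing.exp q : nat -> R) @ \oo --> 0.
- by apply: cvg_expr; rewrite ger0_norm.
- by rewrite divr_gt0.
exists n; have := hn n (leqnn n).
by rewrite /= sub0r normrN ger0_norm ?exprn_ge0// ltr_pdivlMr// mulrC.
Qed.

Lemma near_Im_lt z (y : R) : complex.Im z < y -> \forall w \near z, complex.Im w < y.
Proof.
move=> zy; apply/nbhs_nrmP; exists (y - complex.Im z); first by lra.
by move=> w wz; have := le_lt_trans (Im_dist z w) wz; rewrite ltr_norml; lra.
Qed.

Lemma near_Im_gt z (y : R) : y < complex.Im z -> \forall w \near z, y < complex.Im w.
Proof.
move=> zy; apply/nbhs_nrmP; exists (complex.Im z - y); first by lra.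
by move=> w wz; have := le_lt_trans (Im_dist z w) wz; rewrite ltr_norml; lra.
Qed.

(** Extended by zero above the real line, [g] stays continuous. Fix [c] in the open
    strip, put [p] above the real line, and apply the Cauchy estimate to
    g w / (w - p) ^ n on a square with center line through [c] whose lower edge is
    below [c]. The points of its boundary at which [g] does not vanish are
    farther from [p] than [c] is, so the estimate tends to zero with [n]. *)
Lemma strip_unique g : cont_on strip g -> (forall z, open_strip z -> cdiff g z) ->
  (forall t, g t%:C = 0) -> forall z, strip z -> g z = 0.
Proof.
move=> gcont gdiff g0; apply: cont_on_closure => // c /andP[b1 b2].
set b := complex.Im c in b1 b2; pose a := complex.Re c.
(* The lower edge is halfway between c and the lower edge of the strip. The side 4 makes
   the lateral edges farther from p than c is. *)
pose y := (b - 2^-1) / 2; pose x := a - 2.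
pose G w := if complex.Im w < 0 then g w else 0.
pose p : R[i] := a +i* 1.
have Gneg z : complex.Im z < 0 -> \forall w \near z, G w = g w.
  by move=> /near_Im_lt; apply: filterS => w; rewrite /G => ->.
have Gpos z : 0 < complex.Im z -> \forall w \near z, G w = 0.
  by move=> /near_Im_gt; apply: filterS => w w0; rewrite /G ltNge (ltW w0).
have Gdiff z : y <= complex.Im z -> complex.Im z != 0 -> cdiff G z.
  move=> yz; have [zn _|zp|//] := ltgtP (complex.Im z) 0.
    apply: (@cdiff_near _ _ g) => //; [by rewrite /G zn|exact: Gneg|].
    by apply: gdiff; rewrite /open_strip /= zn andbT; rewrite /y in yz; lra.
  move=> _; apply: (@cdiff_near _ _ (fun=> 0)); [by rewrite /G ltNge (ltW zp)|exact: Gpos|].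
  exact: cdiff_cst.
have Gcont z : y <= complex.Im z -> {for z, continuous G}.
  move=> yz; have [z0|zn0] := eqVneq (complex.Im z) 0; last exact/cdiff_continuous/Gdiff.
  have zE : z = (complex.Re z)%:C by case: z z0 {yz} => p' q' /= ->.
  have Sz : strip z by rewrite /strip /= z0; lra.
  apply/continuous_nrmP => e e_gt0; have [d d_gt0 hd] := gcont z Sz e e_gt0.
  exists (Num.min d 2^-1); first by rewrite lt_min d_gt0 /=; lra.
  move=> w; rewrite lt_min => /andP[wd w2].
  rewrite {2}/G z0 ltxx subr0 /G; case: ifPn => [w0|_]; last by rewrite nrm0.
  rewrite -[g w]subr0 -(g0 (complex.Re z)) -zE; apply: hd => //.
  have := le_lt_trans (Im_dist z w) w2; rewrite z0 ltr_norml /strip /=; lra.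
have [m hm] : exists m, forall w, in_square x y 4 w -> nrm (G w) <= m.
  by apply: cont_bounded => // z [_ /andP[hz _]]; exact: Gcont.
have cQ : in_square x y 4 c by split; rewrite /x /y -/a -/b; lra.
have m_ge0 : 0 <= m := le_trans (nrm_ge0 _) (hm _ cQ).
have GC : G c = g c by rewrite /G b2.
have b_y : 0 < b - y by rewrite /y; lra.
have key n : nrm (g c) <= (16 * m / (b - y)) * ((1 - b) / (1 - y)) ^+ n.
  have cp : nrm (c - p) = 1 - b.
    have -> : c - p = 0 +i* (b - 1).
      by rewrite /p /a /b; case: (c) => p' q' /=; apply/eqP; rewrite eq_complex /= subrr !eqxx.
    apply/eqP; rewrite -(@eqrXn2 _ 2) ?nrm_ge0//; last by lra.
    by rewrite nrm_sqr /= expr0n add0r -sqrrN opprB.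
  pose h w := G w * (w - p)^-1 ^+ n.
  have hpos z : 0 < complex.Im z -> cdiff h z.
    move=> z0; apply: (@cdiff_near _ _ (fun=> 0)); last exact: cdiff_cst.
      by rewrite /h /G ltNge ltW//= mul0r.
    by apply: filterS (Gpos z z0) => w; rewrite /h => ->; rewrite mul0r.
  have zp z : complex.Im z <= 0 -> z - p != 0.
    by move=> z0; rewrite subr_eq0; apply: contraTneq z0 => ->; rewrite -ltNge /=.
  have dp z : complex.Im z <= 0 -> cdiff (fun w => (w - p)^-1 ^+ n) z.
    move=> z0; apply/cdiffX/cdiffV; first exact: zp.
    by apply: cdiffD; [exact: cdiff_id|exact: cdiff_cst].
  have H : nrm (h c) <= 4 * 4 * (m / (b - y) / (1 - y) ^+ n).
    apply: (@cauchy_bound R h c x y 4); rewrite -/a -/b.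
    - by rewrite /x; lra.
    - by rewrite /y; lra.
    - move=> z [_ /andP[yz _]] zl.
      have [z0|z0] := ltP 0 (complex.Im z); first exact/cdiff_continuous/hpos.
      by apply: contM; [exact: Gcont|exact/cdiff_continuous/dp].
    - move=> z [_ /andP[yz _]] zl.
      have [z0|z0] := ltP 0 (complex.Im z); first exact: hpos.
      apply: cdiffM; last exact: dp.
      by apply: Gdiff => //; apply/eqP => zI; apply: zl; exists 0; rewrite zI mul0r.
    - case=> k; rewrite -/b => bk.
      have h1 : (-1 < k%:~R :> R) by lra.
      have h2 : (k%:~R < 0 :> R) by lra.
      move: h1 h2; rewrite -[-1]/((-1)%:~R) ltr_int ltrz0; lia.
    - move=> w wB; have [wx wy] := boundary_in_square wB.
      rewrite /h; have [w0|w0] := ltP (complex.Im w) 0; last first.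
        rewrite /G ltNge w0 /= !mul0r nrm0 !divr_ge0// ?exprn_ge0//; first exact: ltW.
        by rewrite /y; lra.
      have [d1 d2] : b - y <= nrm (w - c) /\ 1 - y <= nrm (w - p).
        have Ic := Im_dist c w; have Ip := Im_dist p w; have Rc := Re_dist c w; have Rp := Re_dist p w.
        rewrite /= -/a -/b in Ic Ip Rc Rp.
        case: wB => _ _ [E|[E|[E|E]]].
        + by move: Rc Rp; rewrite E /x !ler_norml /y; lra.
        + by move: Rc Rp; rewrite E /x !ler_norml /y; lra.
        + by move: Ic Ip; rewrite E /x !ler_norml /y; lra.
        + by move: w0; rewrite E /y; lra.
      have y1 : 0 < 1 - y by rewrite /y; lra.
      rewrite !nrmM nrmX !nrmV exprVn -!mulrA ler_pM ?nrm_ge0 ?mulr_ge0 ?invr_ge0 ?exprn_ge0 ?nrm_ge0//.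
        exact: hm.
      rewrite mulrC ler_pM ?invr_ge0 ?exprn_ge0 ?nrm_ge0// lef_pV2 ?posrE ?exprn_gt0//.
      + exact: lt_le_trans d1.
      + by rewrite lerXn2r ?nnegrE ?nrm_ge0 ?(ltW y1).
      + exact: lt_le_trans d2.
  have b1' : 0 < 1 - b by lra.
  have y1 : 0 < 1 - y by rewrite /y; lra.
  move: H; rewrite /h nrmM nrmX nrmV cp GC exprVn ler_pdivrMr ?exprn_gt0// => H.
  apply: (le_trans H); rewrite expr_div_n le_eqVlt; apply/orP; left; apply/eqP.
  by field; rewrite ?expf_neq0 ?gt_eqF.
apply: nrm_small => e e_gt0.
have y1 : 0 < 1 - y by rewrite /y; lra.
have [|n hn] := @geometric_small (16 * m / (b - y)) ((1 - b) / (1 - y)) e _ e_gt0.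
  by rewrite divr_ge0 ?ltW//=; [rewrite ltr_pdivrMr//; rewrite /y; lra|lra].
exact: le_trans (key n) (ltW hn).
Qed.

End Strip.
Arguments strip {R}.
Arguments open_strip {R}.

(** * A theorem of Liouville for stacked strips *)

Section Liouville.
Variable R : realType.
Implicit Types (a b x y s m e t : R) (f g h F : R[i] -> R[i]) (c z w p : R[i]).

Lemma cdiff_shift f z u : cdiff f (z + u) -> cdiff (fun w => f (w + u)) z.
Proof.
move=> [psi cpsi /nbhs_nrmP[d d_gt0 fE]].
have E w : w + u - (z + u) = w - z by ring.
exists (fun w => psi (w + u)).
  apply/continuous_nrmP => e e_gt0.
  have /continuous_nrmP/(_ e e_gt0)[d' d'_gt0 h] := cpsi.
  by exists d' => // w wz; apply: h; rewrite E.
apply/nbhs_nrmP; exists d => // w wz.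
by rewrite fE ?E.
Qed.

(** The function (G w - G p) ^ 2 / (w - p) is differentiable at [p], because the
    square makes the removable singularity a zero; on large squares around [c]
    the Cauchy estimate bounds its value at [c] by a multiple of the inverse of
    the side. *)
Lemma liouville G m : (forall z, {for z, continuous G}) ->
  (forall z, ~ on_level z -> cdiff G z) -> (forall z, nrm (G z) <= m) ->
  forall c p, ~ on_level c -> ~ on_level p -> G c = G p.
Proof.
move=> Gcont Gdiff Gm c p cl pl.
have [->//|cp] := eqVneq c p.
have m_ge0 : 0 <= m := le_trans (nrm_ge0 _) (Gm 0).
pose h w := (G w - G p) ^+ 2 / (w - p).
have wp z : z != p -> z - p != 0 by rewrite subr_eq0.
have hdiff z : ~ on_level z -> cdiff h z.
  move=> zl; have [->|zp] := eqVneq z p; last first.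
    apply: cdiffM; first by apply: cdiffX; apply: cdiffD; [exact: Gdiff|exact: cdiff_cst].
    by apply: cdiffV; [exact: wp|apply: cdiffD; [exact: cdiff_id|exact: cdiff_cst]].
  have [psi cpsi /nbhs_nrmP[d d_gt0 GE]] := Gdiff p pl.
  exists (fun w => psi w * psi w); first exact: contM.
  apply/nbhs_nrmP; exists d => // w wp'.
  have -> : h p = 0 by rewrite /h subrr expr0n mul0r.
  rewrite /h GE//; have [->|wp''] := eqVneq w p; first by rewrite !subrr !mulr0 addr0 subrr expr0n mul0r add0r.
  by field; exact: wp.
have hcont z : on_level z -> {for z, continuous h}.
  move=> zl; have zp : z != p by apply: contra_not_neq pl => <-.
  apply: contM; last first.
    by apply: contV; [exact: wp|apply: contD; [exact: cont_id|exact: cont_cst]].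
  have cg : {for z, continuous (fun w => G w - G p)}.
    by apply: contD; [exact: Gcont|exact: cont_cst].
  have := contM cg cg; congr {for z, continuous _}.
have key r : 2 * nrm (c - p) <= r -> 0 < r -> nrm (h c) <= 64 * m ^+ 2 / r.
  move=> cpr r_gt0.
  have -> : 64 * m ^+ 2 / r = 4 * (2 * r) * ((2 * m) ^+ 2 * 2 / r / r) by field; lra.
  apply: (@cauchy_bound R h c (complex.Re c - r) (complex.Im c - r) (2 * r));
    [lra|lra|by move=> z _ /hcont|by move=> z _ /hdiff|exact: cl|].
  move=> w wB; have wc : r <= nrm (w - c).
    have := Im_dist c w; have := Re_dist c w.
    by case: wB => _ _ [E|[E|[E|E]]]; rewrite E !ler_norml; lra.
  have wp' : r / 2 <= nrm (w - p).
    by have := nrm_dist p w c; rewrite [nrm (p - c)]nrmBC; lra.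
  have h1 : nrm (G w - G p) <= 2 * m.
    by have := nrmB (G w) (G p); have := Gm w; have := Gm p; lra.
  have -> : nrm (h w / (w - c)) = nrm (G w - G p) ^+ 2 * (nrm (w - p))^-1 * (nrm (w - c))^-1.
    by rewrite [LHS]nrmM [X in X * _]nrmM nrmX !nrmV.
  have -> : (2 * m) ^+ 2 * 2 / r / r = (2 * m) ^+ 2 * (r / 2)^-1 * r^-1 by field; lra.
  have r2 : 0 < r / 2 by lra.
  rewrite ler_pM ?mulr_ge0 ?exprn_ge0 ?invr_ge0 ?nrm_ge0//.
    rewrite ler_pM ?exprn_ge0 ?invr_ge0 ?nrm_ge0//.
      by rewrite lerXn2r ?nnegrE ?nrm_ge0//; lra.
    by rewrite lef_pV2 ?posrE//; exact: lt_le_trans wp'.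
  by rewrite lef_pV2 ?posrE//; exact: lt_le_trans wc.
have : h c = 0.
  apply: nrm_small => e e_gt0.
  have k0 : 0 <= 64 * m ^+ 2 / e by rewrite divr_ge0 ?mulr_ge0 ?sqr_ge0// ltW.
  pose r := 2 * nrm (c - p) + 64 * m ^+ 2 / e + 1.
  have n0 := nrm_ge0 (c - p).
  have r_gt0 : 0 < r by rewrite /r; lra.
  apply: (le_trans (key r _ r_gt0)); first by rewrite /r; lra.
  rewrite ler_pdivrMr// -ler_pdivrMl// [_^-1 * _]mulrC /r; lra.
move/eqP; rewrite mulf_eq0 expf_eq0 /= invr_eq0 (negbTE (wp _ cp)) orbF subr_eq0.
by move/eqP.
Qed.

Lemma on_levelP z : on_level z <-> complex.Im z = (Num.floor (2 * complex.Im z))%:~R / 2.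
Proof.
split=> [[k zk]|zk]; last by eexists; exact: zk.
suff -> : Num.floor (2 * complex.Im z) = k by [].
by apply: floor_def; rewrite zk rmorphD /=; lra.
Qed.

(** The strip of heights from k/2 to (k+1)/2 carries a translate of [F] for odd [k]
    and of [F'] for even [k]; in particular [stack F F'] is [F] for k = -1. *)
Definition stack F F' w : R[i] :=
  let k := Num.floor (2 * complex.Im w) in
  (if odd `|k|%N then F else F') (w - (0 +i* ((k + 1)%:~R / 2))).

Lemma stackE F F' (k : int) w : (forall t, F (t +i* (- 2^-1)) = F' t%:C) ->
  (forall t, F' (t +i* (- 2^-1)) = F t%:C) ->
  k%:~R / 2 <= complex.Im w <= (k + 1)%:~R / 2 ->
  stack F F' w = (if odd `|k|%N then F else F') (w - (0 +i* ((k + 1)%:~R / 2))).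
Proof.
move=> per per' /andP[kw]; rewrite le_eqVlt => /orP[/eqP wk|wk]; last first.
  rewrite /stack (_ : Num.floor _ = k)//; apply: floor_def; lra.
rewrite /stack; have -> : Num.floor (2 * complex.Im w) = k + 1.
  by apply: floor_def; rewrite wk !rmorphD /=; lra.
case: w wk {kw} => t q /= ->.
have -> : (t +i* ((k + 1)%:~R / 2)) - (0 +i* ((k + 1 + 1)%:~R / 2)) = t +i* (- 2^-1).
  apply/eqP; rewrite eq_complex /= subr0 eqxx /= !rmorphD /=; apply/eqP; lra.
have -> : (t +i* ((k + 1)%:~R / 2)) - (0 +i* ((k + 1)%:~R / 2)) = t%:C.
  by apply/eqP; rewrite eq_complex /= subr0 subrr !eqxx.
have -> : odd `|(k + 1)%R|%N = ~~ odd `|k|%N by lia.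
by case: (odd _) => /=.
Qed.

(** The two matching conditions make the stacked function continuous on the plane. *)
Lemma strip_liouville F F' m : cont_on strip F -> cont_on strip F' ->
  (forall z, open_strip z -> cdiff F z) -> (forall z, open_strip z -> cdiff F' z) ->
  (forall z, strip z -> nrm (F z) <= m) -> (forall z, strip z -> nrm (F' z) <= m) ->
  (forall t, F (t +i* (- 2^-1)) = F' t%:C) ->
  (forall t, F' (t +i* (- 2^-1)) = F t%:C) ->
  exists c, forall z, strip z -> F z = c /\ F' z = c.
Proof.
move=> Fc Fc' Fd Fd' Fm Fm' per per'.
pose G := stack F F'.
pose Fk (k : int) := if odd `|k|%N then F else F'.
pose sh (k : int) : R[i] := 0 +i* ((k + 1)%:~R / 2).
have GE k w : k%:~R / 2 <= complex.Im w <= (k + 1)%:~R / 2 -> G w = Fk k (w - sh k).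
  exact: stackE.
have Fkc k : cont_on strip (Fk k) by rewrite /Fk; case: odd.
have Fkd k z : open_strip z -> cdiff (Fk k) z by rewrite /Fk; case: odd; [exact: Fd|exact: Fd'].
have Fkm k z : strip z -> nrm (Fk k z) <= m by rewrite /Fk; case: odd; [exact: Fm|exact: Fm'].
have sh_strip k w : k%:~R / 2 <= complex.Im w <= (k + 1)%:~R / 2 -> strip (w - sh k).
  by rewrite /strip /= raddfB /= rmorphD /=; lra.
have sh_open k w : k%:~R / 2 < complex.Im w < (k + 1)%:~R / 2 -> open_strip (w - sh k).
  by rewrite /open_strip /= raddfB /= rmorphD /=; lra.
have fl w : let k := Num.floor (2 * complex.Im w) in
    k%:~R / 2 <= complex.Im w <= (k + 1)%:~R / 2 /\ complex.Im w < (k + 1)%:~R / 2.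
  by move=> k; have := floor_itv (2 * complex.Im w); rewrite -/k; lra.
have Gm z : nrm (G z) <= m.
  by have [h _] := fl z; rewrite (GE _ _ h); apply/Fkm/sh_strip.
have Gd z : ~ on_level z -> cdiff G z.
  move=> zl; have [h1 h2] := fl z; set k := Num.floor _ in h1 h2.
  have h3 : k%:~R / 2 < complex.Im z.
    rewrite lt_neqAle (andP h1).1 andbT; apply/eqP => zk; apply: zl; by exists k.
  apply: (@cdiff_near _ _ (fun w => Fk k (w - sh k))); first exact: GE.
    have := near_Im_lt h2; have := near_Im_gt h3; apply: filterS2 => w w1 w2.
    by apply: GE; rewrite !ltW.
  by apply: cdiff_shift; apply/Fkd/sh_open; rewrite h3.
have Gk k z : k%:~R / 2 <= complex.Im z <= (k + 1)%:~R / 2 -> forall e, 0 < e ->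
    exists2 d, 0 < d & forall w, k%:~R / 2 <= complex.Im w <= (k + 1)%:~R / 2 ->
      nrm (w - z) < d -> nrm (G w - G z) < e.
  move=> hz e e_gt0; have [d d_gt0 hd] := Fkc k _ (sh_strip _ _ hz) e e_gt0.
  exists d => // w hw wz; rewrite (GE _ _ hz) (GE _ _ hw); apply: hd; first exact: sh_strip.
  by have -> : w - sh k - (z - sh k) = w - z by ring.
have Gc z : {for z, continuous G}.
  have [zl|zl] := pselect (on_level z); last exact/cdiff_continuous/Gd.
  have {}zl := (on_levelP z).1 zl; set k := Num.floor _ in zl.
  apply/continuous_nrmP => e e_gt0.
  have z1 : k%:~R / 2 <= complex.Im z <= (k + 1)%:~R / 2 by rewrite zl !rmorphD /=; lra.
  have z2 : (k - 1)%:~R / 2 <= complex.Im z <= (k - 1 + 1)%:~R / 2.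
    by rewrite subrK zl rmorphB /=; lra.
  have [d1 d1_gt0 hd1] := Gk _ _ z1 e e_gt0.
  have [d2 d2_gt0 hd2] := Gk _ _ z2 e e_gt0.
  exists (Num.min (Num.min d1 d2) 2^-1); first by rewrite !lt_min d1_gt0 d2_gt0 /=.
  move=> w; rewrite !lt_min => /andP[/andP[wd1 wd2] w2].
  have := le_lt_trans (Im_dist z w) w2; rewrite ltr_norml {1 2}zl => h.
  have [kw|kw] := leP (k%:~R / 2) (complex.Im w).
    by apply: hd1 => //; rewrite kw /= rmorphD /=; lra.
  by apply: hd2 => //; rewrite subrK (ltW kw) rmorphB /=; lra.
have open_level z (k : int) : k%:~R / 2 < complex.Im z < (k + 1)%:~R / 2 -> ~ on_level z.
  move=> hz [j zj]; have h1 : (k%:~R < j%:~R :> R) by lra.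
  have h2 : (j%:~R < (k + 1)%:~R :> R) by lra.
  by move: h1 h2; rewrite !ltr_int; lia.
pose z0 : R[i] := 0 +i* (- 4^-1).
have z0l : ~ on_level z0 by apply: (open_level _ (-1)); rewrite /= addNr rmorphN1; lra.
have GC z : ~ on_level z -> G z = G z0 by move=> zl; exact: (liouville Gc Gd Gm).
have FE z : open_strip z -> F z = G z0.
  move=> /andP[hz1 hz2].
  have hz : (-1)%:~R / 2 < complex.Im z < (-1 + 1)%:~R / 2 by rewrite addNr rmorphN1; lra.
  rewrite -(GC z); last exact: (open_level _ (-1)).
  rewrite (GE (-1)); last by move: hz; lra.
  by rewrite /Fk /sh /= addNr mul0r subr0.
have FE' z : open_strip z -> F' z = G z0.
  move=> /andP[hz1 hz2]; pose w := z + (0 +i* 2^-1).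
  have hw : (0%:~R / 2 < complex.Im w < (0 + 1)%:~R / 2).
    by rewrite /w raddfD /= add0r; lra.
  rewrite -(GC w); last exact: (open_level _ 0).
  rewrite (GE 0); last by move: hw; lra.
  rewrite /Fk /sh /= add0r; congr F'; rewrite /w.
  by rewrite mul1r addrK.
exists (G z0) => z Sz; split; [exact: (cont_on_closure Fc FE)|exact: (cont_on_closure Fc' FE')].
Qed.

End Liouville.

(** * Riesz representation and bounded operators *)

Section Spans.
Variables (R : realType) (V : normedModType R[i]).
Implicit Types (B S : set V) (u v : V) (c : R[i]).

Lemma lspan_sub B S : S 0 -> (forall c u v, S u -> S v -> S (c *: u + v)) ->
  B `<=` S -> lspan B `<=` S.
Proof.
move=> S0 Slin BS v [n [c [b [hb ->]]]]; apply: (big_ind S) => // [x y Sx Sy|i _].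
  by rewrite -[x]scale1r; exact: Slin.
by rewrite -[_ *: _]addr0; apply: Slin => //; exact: BS.
Qed.

Lemma lspan0 B : lspan B 0.
Proof.
exists 0%N, (fun=> 0), (fun=> 0); split; first by case.
by rewrite big_ord0.
Qed.

Lemma lspan_gen B b : B b -> lspan B b.
Proof. by move=> Bb; exists 1%N, (fun=> 1), (fun=> b); rewrite big_ord1 scale1r. Qed.

Lemma lspan_lin B c u v : lspan B u -> lspan B v -> lspan B (c *: u + v).
Proof.
move=> [n [a [b [hb ->]]]] [n' [a' [b' [hb' ->]]]].
exists (n + n')%N, (fun i => match fintype.split i with inl j => c * a j | inr j => a' j end),
  (fun i => match fintype.split i with inl j => b j | inr j => b' j end).
split=> [i|]; first by case: fintype.split.
rewrite big_split_ord scaler_sumr; congr (_ + _); apply: eq_bigr => i _.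
  by rewrite -[lshift _ _]/(unsplit (inl i)) unsplitK scalerA.
by rewrite -[rshift _ _]/(unsplit (inr i)) unsplitK.
Qed.

Lemma closure_lin S : (forall c u v, S u -> S v -> S (c *: u + v)) ->
  forall c u v, closure S u -> closure S v -> closure S (c *: u + v).
Proof.
move=> Slin c u v /closure_nrmP hu /closure_nrmP hv; apply/closure_nrmP => e e_gt0.
have c1 : 0 < nrm c + 1 by rewrite ltr_wpDl ?nrm_ge0.
have [u' Su' hu'] := hu (e / 2 / (nrm c + 1)) ltac:(by rewrite !divr_gt0).
have [v' Sv' hv'] := hv (e / 2) ltac:(by rewrite divr_gt0).
exists (c *: u' + v'); first exact: Slin.
have -> : c *: u' + v' - (c *: u + v) = c *: (u' - u) + (v' - v).
  by rewrite scalerBr opprD addrACA.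
apply: (le_lt_trans (nrmD _ _)); rewrite nrmZ.
have : nrm c * nrm (u' - u) <= e / 2.
  apply: (@le_trans _ _ ((nrm c + 1) * (e / 2 / (nrm c + 1)))).
    by apply: ler_pM; rewrite ?nrm_ge0 ?lerDl ?ltW.
  by rewrite mulrC divfK ?gt_eqF.
lra.
Qed.

Lemma closure_sub S S' : closed S' -> S `<=` S' -> closure S `<=` S'.
Proof. by move=> cl SS' x /(closure_subset SS'); exact: cl. Qed.

End Spans.

Section HilbertSpaces.
Variables (R : realType) (H : hilbert R).
Implicit Types (u v w : H) (c : R[i]) (x y : bop H).

Lemma dotNl u w : dot (- u) w = - dot u w.
Proof. by rewrite -scaleN1r dotZl mulN1r. Qed.

Lemma dotBl u v w : dot (u - v) w = dot u w - dot v w.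
Proof. by rewrite dotDl dotNl. Qed.

Lemma dotBr u v w : dot u (v - w) = dot u v - dot u w.
Proof. by rewrite dotDr dotNr. Qed.

Lemma dot_suml I (r : seq I) (P : pred I) (F : I -> H) w :
  dot (\sum_(i <- r | P i) F i) w = \sum_(i <- r | P i) dot (F i) w.
Proof. by apply: (big_morph (fun v => dot v w)) => [u v|]; [exact: dotDl|exact: dot0l]. Qed.

Lemma dot_sumr I (r : seq I) (P : pred I) (F : I -> H) w :
  dot w (\sum_(i <- r | P i) F i) = \sum_(i <- r | P i) dot w (F i).
Proof. by apply: (big_morph (dot w)) => [u v|]; [exact: dotDr|exact: dot0r]. Qed.

Lemma dotvv u : dot u u = (nrm u ^+ 2)%:C.
Proof. by rewrite dot_norm nrmE rmorphXn. Qed.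

Lemma Re_dotvv u : complex.Re (dot u u) = nrm u ^+ 2.
Proof. by rewrite dotvv. Qed.

Lemma nrm_dot u v : nrm (dot u v) <= nrm u * nrm v.
Proof. by rewrite -nrm_le rmorphM /= -!nrmE cauchy_schwarz. Qed.

Lemma Re_conj c : complex.Re c^* = complex.Re c.
Proof. by case: c. Qed.

Lemma Re_dotC u v : complex.Re (dot u v) = complex.Re (dot v u).
Proof. by rewrite dotC Re_conj. Qed.

Lemma nrm_sqrD u v : nrm (u + v) ^+ 2 = nrm u ^+ 2 + nrm v ^+ 2 + 2 * complex.Re (dot u v).
Proof.
rewrite -!Re_dotvv dotDl !dotDr !raddfD /= (Re_dotC v u); ring.
Qed.

Lemma nrm_sqrB u v : nrm (u - v) ^+ 2 = nrm u ^+ 2 + nrm v ^+ 2 - 2 * complex.Re (dot u v).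
Proof. rewrite nrm_sqrD nrmN dotNr raddfN /=; ring. Qed.

Lemma parallelogram u v :
  nrm (u + v) ^+ 2 + nrm (u - v) ^+ 2 = 2 * (nrm u ^+ 2 + nrm v ^+ 2).
Proof. rewrite nrm_sqrD nrm_sqrB; ring. Qed.

Lemma hilbert_complete (v : nat -> H) :
  (forall e : R, 0 < e -> exists N, forall m n, (N <= m)%N -> (N <= n)%N -> nrm (v m - v n) < e) ->
  exists l, forall e : R, 0 < e -> exists N, forall n, (N <= n)%N -> nrm (v n - l) < e.
Proof.
move=> hv; have : cvg (v @ \oo).
  apply/cauchy_cvgP/cauchy_exP => e /gt0_real_complex[r r_gt0 ->].
  have [N hN] := hv r r_gt0; exists (v N); exists N => // n /= Nn.
  by rewrite -ball_normE /= nrm_lt; exact: hN.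
move=> /cvg_ex[l /cvgrPdist_lt hl]; exists l => e e_gt0.
have := hl e%:C; rewrite ltcR => /(_ e_gt0)[N _ hN].
by exists N => n /hN /=; rewrite nrm_lt nrmBC.
Qed.

(** The functional |u|^2 - 2 Re (phi u) is bounded below on [M]; by the
    parallelogram identity its minimizing sequences are Cauchy, and the limit
    represents [phi]. With [phi] = dot _ x this is the projection theorem. *)
Lemma riesz_subspace (M : set H) (phi : H -> R[i]) (C : R) :
  closed M -> M 0 -> (forall c u v, M u -> M v -> M (c *: u + v)) ->
  (forall c u v, phi (c *: u + v) = c * phi u + phi v) ->
  (forall u, nrm (phi u) <= C * nrm u) ->
  exists2 y : H, M y & forall w, M w -> phi w = dot w y.
Proof.
move=> Mcl M0 Mlin philin phiC.
have phi0 : phi 0 = 0.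
  by have := phiC 0; rewrite nrm0 mulr0 => h; apply: nrm_small => e /ltW; exact: le_trans.
have phiD u v : phi (u + v) = phi u + phi v by rewrite -[u]scale1r philin mul1r scale1r.
have phiZ c u : phi (c *: u) = c * phi u by rewrite -[c *: u]addr0 philin phi0 addr0.
have phiN u : phi (- u) = - phi u by rewrite -scaleN1r phiZ mulN1r.
have MD u v : M u -> M v -> M (u + v) by move=> Mu Mv; rewrite -[u]scale1r; exact: Mlin.
have MZ c u : M u -> M (c *: u) by move=> Mu; rewrite -[c *: u]addr0; exact: Mlin.
(* Minimizing J amounts to minimizing the distance to the vector to be found. *)
pose J u := nrm u ^+ 2 - 2 * complex.Re (phi u).
have J_ge u : - C ^+ 2 <= J u.
  rewrite /J; have h := le_trans (ler_norm _) (le_trans (nrm_Re (phi u)) (phiC u)).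
  have := sqr_ge0 (nrm u - C); rewrite sqrrB; lra.
pose d := inf [set J u | u in M].
have J_inf : has_inf [set J u | u in M].
  by split; [exists (J 0), 0|exists (- C ^+ 2) => _ [u _ <-]].
have d_le u : M u -> d <= J u by move=> Mu; apply: ge_inf; [exact: J_inf.2|exists u].
have /choice[s hs] (n : nat) : exists u, M u /\ J u < d + n.+1%:R^-1.
  have n_gt0 : 0 < n.+1%:R^-1 :> R by rewrite invr_gt0 ltr0n.
  have [_ [u Mu <-] hu] := inf_adherent n_gt0 J_inf.
  by exists u.
have near_min u v e : M u -> M v -> J u < d + e -> J v < d + e -> nrm (u - v) ^+ 2 < 4 * e.
  move=> Mu Mv Ju Jv.
  have h : d <= J (2^-1 *: (u + v)) by apply/d_le/MZ/MD.
  have E : J (2^-1 *: (u + v)) = 4^-1 * nrm (u + v) ^+ 2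
     - (complex.Re (phi u) + complex.Re (phi v)).
    rewrite /J nrmZ exprMn phiZ phiD.
    have -> : nrm (2^-1 : R[i]) = 2^-1.
      have -> : (2^-1 : R[i]) = (2^-1 : R)%:C by rewrite fmorphV rmorph_nat.
      by rewrite nrm_real ger0_norm ?invr_ge0.
    have -> : complex.Re (2^-1 * (phi u + phi v)) = 2^-1 * (complex.Re (phi u) + complex.Re (phi v)).
      have -> : (2^-1 : R[i]) = (2^-1 : R)%:C by rewrite fmorphV rmorph_nat.
      by case: (phi u) (phi v) => [? ?] [? ?] /=; rewrite mul0r subr0.
    by field.
  have P := parallelogram u v.
  move: h Ju Jv; rewrite E /J; lra.
have [y hy] : exists y : H, forall e : R, 0 < e -> exists N, forall n, (N <= n)%N -> nrm (s n - y) < e.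
  apply: hilbert_complete => e e_gt0.
  have [N hN] := invS_small (e ^+ 2 / 4) ltac:(by rewrite divr_gt0 ?exprn_gt0).
  exists N => m n hm hn; rewrite -(ltr_pXn2r (n := 2)) ?nnegrE ?nrm_ge0 ?ltW//.
  have -> : e ^+ 2 = 4 * (e ^+ 2 / 4) by field.
  have [Mm Jm] := hs m; have [Mn Jn] := hs n; have := hN m hm; have := hN n hn => h1 h2.
  by apply: near_min => //; [apply: (lt_trans Jm)|apply: (lt_trans Jn)]; rewrite ltrD2l.
have My : M y.
  apply: Mcl; apply/closure_nrmP => e /hy[N hN]; exists (s N); first exact: (hs N).1.
  exact: hN.
have Jy : J y = d.
  apply/eqP; rewrite eq_le d_le// andbT; apply/ler_addgt0Pr => e e_gt0.
  have K_gt0 : 0 < 2 * nrm y + 1 + 2 * `|C| + 1.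
    by have := nrm_ge0 y; have := normr_ge0 C; lra.
  set K := 2 * nrm y + 1 + 2 * `|C| + 1 in K_gt0.
  have [N1 hN1] := invS_small (e / 2) ltac:(by rewrite divr_gt0).
  pose r := Num.min 1 (e / 2 / K).
  have r_gt0 : 0 < r by rewrite lt_min ltr01 !divr_gt0.
  have [N2 hN2] := hy r r_gt0.
  pose n := maxn N1 N2; have h1 := hN1 n (leq_maxl _ _); have h2 := hN2 n (leq_maxr _ _).
  have Jn : J (s n) < d + e / 2 by apply: (lt_trans (hs n).2); rewrite ltrD2l.
  suff : J y <= J (s n) + e / 2 by lra.
  have r1 : r <= 1 by rewrite ge_min lexx.
  have rK : r * K <= e / 2 by rewrite -ler_pdivlMr// ge_min lexx orbT.
  set t := nrm (s n - y) in h2.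
  have t0 : 0 <= t by exact: nrm_ge0.
  have a1 : nrm y <= nrm (s n) + t.
    by have := nrm_dist (s n) y 0; rewrite !subr0 [nrm (y - _)]nrmBC -/t; lra.
  have a2 : nrm (s n) <= nrm y + t.
    by have := nrm_dist y (s n) 0; rewrite !subr0 -/t; lra.
  have a3 : complex.Re (phi (s n)) - complex.Re (phi y) <= `|C| * t.
    have -> : complex.Re (phi (s n)) - complex.Re (phi y) = complex.Re (phi (s n - y)).
      by rewrite phiD phiN raddfB.
    apply: (le_trans (ler_norm _)); apply: (le_trans (nrm_Re _)); apply: (le_trans (phiC _)).
    by rewrite -/t ler_wpM2r// ler_norm.
  have a4 : nrm y ^+ 2 - nrm (s n) ^+ 2 <= t * (2 * nrm y + 1).
    have -> : nrm y ^+ 2 - nrm (s n) ^+ 2 = (nrm y - nrm (s n)) * (nrm y + nrm (s n)) by ring.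
    have p0 : 0 <= nrm y + nrm (s n) by rewrite addr_ge0 ?nrm_ge0.
    have : (nrm y - nrm (s n)) * (nrm y + nrm (s n)) <= t * (nrm y + nrm (s n)).
      by rewrite ler_wpM2r//; lra.
    have : t * (nrm y + nrm (s n)) <= t * (2 * nrm y + 1) by rewrite ler_wpM2l//; lra.
    lra.
  have a5 : t * K <= r * K by rewrite ler_wpM2r// ltW.
  have a6 : `|C| * t = t * `|C| by rewrite mulrC.
  have a7 : t * K = t * (2 * nrm y + 1) + 2 * (t * `|C|) + t by rewrite /K; ring.
  rewrite /J; lra.
exists y => // w Mw.
have key w' : M w' -> complex.Re (phi w') = complex.Re (dot w' y).
  move=> Mw'; apply/eqP; rewrite -subr_eq0; apply/eqP.
  set a := complex.Re (phi w') - _.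
  have quad (t : R) : 0 <= t ^+ 2 * nrm w' ^+ 2 - 2 * t * a.
    have Mt : M (y + t%:C *: w') by apply: MD => //; exact: MZ.
    have := d_le _ Mt; rewrite -Jy /J nrm_sqrD nrmZ nrm_real exprMn real_normK ?num_real//.
    rewrite phiD phiZ raddfD /= dotC dotZl Re_conj.
    have rz (z : R[i]) : complex.Re (t%:C * z) = t * complex.Re z.
      by case: z => ? ? /=; rewrite mul0r subr0.
    rewrite !rz /a; lra.
  have n2 : 0 <= nrm w' ^+ 2 by rewrite sqr_ge0.
  move: quad n2; move: (nrm w' ^+ 2) => q quad q0.
  have q1 : 0 < q + 1 by rewrite ltr_wpDl.
  (* A value of t at which the quadratic polynomial is negative unless a = 0. *)
  have := quad (a / (q + 1)).
  have -> : (a / (q + 1)) ^+ 2 * q - 2 * (a / (q + 1)) * a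
    = - (a ^+ 2 * ((q + 2) / (q + 1) ^+ 2)) by field; rewrite gt_eqF.
  rewrite oppr_ge0 pmulr_lle0; last by rewrite divr_gt0 ?exprn_gt0// ltr_wpDl.
  by move=> a0; apply/eqP; rewrite -sqrf_eq0 eq_le a0 sqr_ge0.
have := key _ (MZ 'i%C _ Mw); have := key _ Mw.
rewrite phiZ dotZl; case: (phi w) (dot w y) => [a b] [a' b'] /=.
by rewrite !mul0r !mul1r !sub0r => -> /oppr_inj ->.
Qed.

Lemma riesz (phi : H -> R[i]) (C : R) :
  (forall c u v, phi (c *: u + v) = c * phi u + phi v) ->
  (forall u, nrm (phi u) <= C * nrm u) ->
  exists y : H, forall w, phi w = dot w y.
Proof.
move=> h1 h2.
have [y _ hy] := riesz_subspace (@closedT _) I (fun _ _ _ _ _ => I) h1 h2.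
by exists y => w; exact: hy.
Qed.

Lemma orth_total (B : set H) : (forall y : H, (forall b, B b -> dot b y = 0) -> y = 0) ->
  closure (lspan B) = [set: H].
Proof.
move=> hB; apply/seteqP; split => // x _.
have [y My hy] : exists2 y, closure (lspan B) y & forall w, closure (lspan B) w -> dot w x = dot w y.
  apply: (@riesz_subspace _ _ (nrm x) (@closed_closure _ (lspan B))).
  - exact/subset_closure/lspan0.
  - by apply: closure_lin => c u v; exact: lspan_lin.
  - by move=> c u v; exact: dotPl.
  - by move=> u; rewrite mulrC; exact: nrm_dot.
suff -> : x = y by [].
apply/eqP; rewrite -subr_eq0; apply/eqP/hB => b Bb.
by rewrite dotBr hy ?subrr//; exact/subset_closure/lspan_gen.
Qed.

(** Riesz representation in each variable gives the operator and its adjoint. *)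
Lemma bop_of_form (B : H -> H -> R[i]) (C : R) :
  (forall c u v w, B (c *: u + v) w = c * B u w + B v w) ->
  (forall c u v w, B w (c *: u + v) = c^* * B w u + B w v) ->
  (forall u v, nrm (B u v) <= C * nrm u * nrm v) ->
  exists x : bop H, (forall u v, dot (x u) v = B u v) /\ forall v, nrm (x v) <= C * nrm v.
Proof.
move=> Bl Br BC.
have /choice[g hg] (v : H) : exists y : H, forall u, B u v = dot u y.
  apply: (@riesz _ (C * nrm v)) => [c u w|u]; first exact: Bl.
  by rewrite mulrAC.
have /choice[f hf] (u : H) : exists y : H, forall v, (B u v)^* = dot v y.
  apply: (@riesz _ (C * nrm u)) => [c v w|v]; last by rewrite nrm_conj.
  by rewrite Br rmorphD rmorphM /= conjCK.
have fE u v : dot (f u) v = B u v by rewrite dotC -hf conjCK.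
have f_lin : linear f.
  move=> c u v; apply: dot_inj => w; rewrite -hf Bl dotDr dotZr -!hf.
  by rewrite rmorphD rmorphM.
have fC v : nrm (f v) <= C * nrm v.
  have [f0|f0] := eqVneq (nrm (f v)) 0.
    rewrite f0; have [v0|v0] := eqVneq (nrm v) 0; first by rewrite v0 mulr0.
    have vp : 0 < nrm v by rewrite lt_neqAle eq_sym v0 nrm_ge0.
    have := le_trans (nrm_ge0 _) (BC v v).
    by rewrite pmulr_lge0.
  have fp : 0 < nrm (f v) by rewrite lt_neqAle eq_sym f0 nrm_ge0.
  have := BC v (f v); rewrite -fE dotvv nrm_real ger0_norm ?sqr_ge0// expr2.
  by rewrite ler_pM2r.
have f_bd : exists D : R[i], forall v, `|f v| <= D * `|v|.
  by exists C%:C => v; rewrite !nrmE -rmorphM lecR.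
have f_adj u v : dot (f u) v = dot u (g v) by rewrite fE hg.
by exists (Bop f_lin f_bd f_adj).
Qed.

Lemma bopB x u v : x (u - v) = x u - x v.
Proof. by rewrite -scaleN1r bopD bopZ scaleN1r. Qed.

Lemma bop_nrm_le x v : nrm (x v) <= nrm x * nrm v.
Proof. by rewrite -nrm_le rmorphM /= -!nrmE; exact: opnormP. Qed.

Lemma nrm_bop_le x (C : R) : 0 <= C -> (forall v, nrm (x v) <= C * nrm v) -> nrm x <= C.
Proof.
move=> C0 h; rewrite -nrm_le; apply: opnorm_le; first by rewrite ler0c.
by move=> v; rewrite !nrmE -rmorphM lecR.
Qed.

Lemma nrm_bopM x y : nrm (x * y) <= nrm x * nrm y.
Proof.
apply: nrm_bop_le => [|v]; first by rewrite mulr_ge0 ?nrm_ge0.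
rewrite mul_bopE -mulrA; apply: (le_trans (bop_nrm_le _ _)).
by rewrite ler_wpM2l ?nrm_ge0 ?bop_nrm_le.
Qed.

Lemma nrm_bop1 : nrm (1 : bop H) <= 1.
Proof. by apply: nrm_bop_le => // v; rewrite one_bopE mul1r. Qed.

Lemma starE x u v : dot (star x u) v = dot u (x v).
Proof. exact: bstar_adj. Qed.

Lemma starEr x u v : dot u (star x v) = dot (x u) v.
Proof. by rewrite dotC starE -dotC. Qed.

Lemma bop_dotP x y : (forall u v, dot (x u) v = dot (y u) v) -> x = y.
Proof. by move=> h; apply: bopP => u; apply: dot_inj => v; rewrite dotC h -dotC. Qed.

Lemma starK x : star (star x) = x.
Proof. by apply: bop_dotP => u v; rewrite starE starEr. Qed.

Lemma starM x y : star (x * y) = star y * star x.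
Proof. by apply: bop_dotP => u v; rewrite starE !mul_bopE !starE. Qed.

Lemma starD x y : star (x + y) = star x + star y.
Proof. by apply: bop_dotP => u v; rewrite starE !add_bopE dotDr dotDl !starE. Qed.

Lemma starZ c x : star (c *: x) = c^* *: star x.
Proof. by apply: bop_dotP => u v; rewrite starE !scale_bopE dotZr dotZl starE. Qed.

Lemma star1 : star (1 : bop H) = 1.
Proof. by apply: bop_dotP => u v; rewrite starE !one_bopE. Qed.

Lemma star0 : star (0 : bop H) = 0.
Proof. by apply: bop_dotP => u v; rewrite starE !zero_bopE dot0r dot0l. Qed.

Lemma starN x : star (- x) = - star x.
Proof. by rewrite -scaleN1r starZ rmorphN1 scaleN1r. Qed.

Lemma starB x y : star (x - y) = star x - star y.
Proof. by rewrite starD starN. Qed.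

Lemma opp_bopE x v : (- x) v = - x v.
Proof. by rewrite -scaleN1r scale_bopE scaleN1r. Qed.

Lemma sub_bopE x y v : (x - y) v = x v - y v.
Proof. by rewrite add_bopE opp_bopE. Qed.

Lemma nrm_sqr_star x v : (nrm (x v) ^+ 2)%:C = dot ((star x * x) v) v.
Proof. by rewrite -dotvv mul_bopE starE. Qed.

Lemma nrm_star_le x : nrm (star x) <= nrm x.
Proof.
apply: nrm_bop_le => [|v]; first exact: nrm_ge0.
have [f0|f0] := eqVneq (nrm (star x v)) 0; first by rewrite f0 mulr_ge0 ?nrm_ge0.
have fp : 0 < nrm (star x v) by rewrite lt_neqAle eq_sym f0 nrm_ge0.
rewrite -(ler_pM2l fp) -expr2 -lecR -dotvv starEr -[leLHS]ger0_norm; last first.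
  by rewrite -starEr dotvv ler0c sqr_ge0.
rewrite nrm_le; apply: (le_trans (nrm_dot _ _)).
by rewrite mulrCA mulrA ler_wpM2r ?nrm_ge0 ?bop_nrm_le.
Qed.

Lemma nrm_star x : nrm (star x) = nrm x.
Proof. by apply/eqP; rewrite eq_le nrm_star_le -{1}(starK x) nrm_star_le. Qed.

End HilbertSpaces.

(** * Extension by density, orthonormalization *)

Section Extension.
Variable R : realType.

Definition total_in (H : hilbert R) (B : set H) := closure (lspan B) = [set: H].

Lemma linear_total0 (H : hilbert R) (V : normedModType R[i]) (B : set H) (f : H -> V) (C : R) :
  total_in B -> (forall c u v, f (c *: u + v) = c *: f u + f v) ->
  (forall v, nrm (f v) <= C * nrm v) -> (forall b, B b -> f b = 0) -> forall v, f v = 0.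
Proof.
move=> Btot flin fC fB v.
have f0 : f 0 = 0.
  by have := fC 0; rewrite nrm0 mulr0 => h; apply: nrm_small => e /ltW; exact: le_trans.
have flspan w : lspan B w -> f w = 0.
  apply: (@lspan_sub _ _ B [set w | f w = 0]) => //= c u u' hu hu'.
  by rewrite flin hu hu' scaler0 addr0.
apply: nrm_small => e e_gt0.
have C1 : 0 < `|C| + 1 by rewrite ltr_wpDl.
have : closure (lspan B) v by rewrite Btot.
move=> /closure_nrmP/(_ (e / (`|C| + 1)))[|w Bw wv]; first by rewrite divr_gt0.
have -> : f v = f ((-1) *: (w - v) + w).
  by rewrite scaleN1r opprB subrK.
rewrite flin (flspan w Bw) addr0 scaleN1r nrmN.
apply: (le_trans (fC _)); apply: (@le_trans _ _ ((`|C| + 1) * nrm (w - v))).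
  by rewrite ler_wpM2r ?nrm_ge0//; apply: le_trans (ler_norm _) _; rewrite lerDl.
by rewrite mulrC -ler_pdivlMr// ltW.
Qed.

Variables (H K : hilbert R) (I : Type) (d : I -> H) (t : I -> K) (C : R).

Definition comb (V : lmodType R[i]) (f : I -> V) (l : seq (R[i] * I)) : V :=
  \sum_(p <- l) p.1 *: f p.2.

Lemma comb_lin (V : lmodType R[i]) (f : I -> V) c l l' :
  c *: comb f l + comb f l' = comb f ([seq (c * p.1, p.2) | p <- l] ++ l').
Proof.
rewrite /comb big_cat big_map scaler_sumr; congr (_ + _).
by apply: eq_bigr => p _; rewrite scalerA.
Qed.

Hypothesis dtot : total_in [set v | exists i, v = d i].
Hypothesis C_ge0 : 0 <= C.
Hypothesis dt : forall l, nrm (comb t l) <= C * nrm (comb d l).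

Let graph w z := forall e : R, 0 < e ->
  exists l, nrm (w - comb d l) < e /\ nrm (z - comb t l) < e.

Lemma ext_graph_lin c w w' z z' : graph w z -> graph w' z' -> graph (c *: w + w') (c *: z + z').
Proof.
move=> h h' e e_gt0.
have c1 : 0 < nrm c + 1 by rewrite ltr_wpDl ?nrm_ge0.
have [l [l1 l2]] := h (e / 2 / (nrm c + 1)) ltac:(by rewrite !divr_gt0).
have [l' [l1' l2']] := h' (e / 2) ltac:(by rewrite divr_gt0).
have key (V : normedModType R[i]) (u u' a a' : V) : nrm (u - a) < e / 2 / (nrm c + 1) ->
    nrm (u' - a') < e / 2 -> nrm (c *: u + u' - (c *: a + a')) < e.
  move=> ua ua'.
  have -> : c *: u + u' - (c *: a + a') = c *: (u - a) + (u' - a').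
    by rewrite scalerBr opprD addrACA.
  apply: (le_lt_trans (nrmD _ _)); rewrite nrmZ.
  have : nrm c * nrm (u - a) <= e / 2.
    apply: (@le_trans _ _ ((nrm c + 1) * (e / 2 / (nrm c + 1)))).
      by apply: ler_pM; rewrite ?nrm_ge0 ?lerDl ?ltW.
    by rewrite mulrC divfK ?gt_eqF.
  lra.
by exists ([seq (c * p.1, p.2) | p <- l] ++ l'); rewrite -!comb_lin; split; exact: key.
Qed.

Lemma ext_graph_bound w z : graph w z -> nrm z <= C * nrm w.
Proof.
move=> h; apply/ler_addgt0Pr => e e_gt0.
have C1 : 0 < C + 1 by rewrite ltr_wpDl.
have [l [l1 l2]] := h (e / (C + 1)) ltac:(by rewrite divr_gt0).
have := nrm_dist (comb t l) z 0; rewrite !subr0 => h1.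
have := nrm_dist w (comb d l) 0; rewrite !subr0 nrmBC => h2.
have h3 : C * nrm (comb d l) <= C * (e / (C + 1) + nrm w) by rewrite ler_wpM2l//; lra.
have h4 : e / (C + 1) + C * (e / (C + 1)) = e by field; rewrite gt_eqF.
have := dt l; lra.
Qed.

Lemma ext_graph_ex w : exists z, graph w z.
Proof.
have near_comb (e : R) : 0 < e -> exists l, nrm (w - comb d l) < e.
  move=> e_gt0; have : closure (lspan [set v | exists i, v = d i]) w by rewrite dtot.
  move=> /closure_nrmP/(_ e e_gt0)[v hv vw].
  suff [l E] : exists l, v = comb d l by exists l; rewrite nrmBC -E.
  apply: (@lspan_sub _ _ _ [set v | exists l, v = comb d l] _ _ _ _ hv) => /=.
  - by exists [::]; rewrite /comb big_nil.
  - by move=> c u u' [l ->] [l' ->]; eexists; exact: comb_lin.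
  - by move=> _ [i ->]; exists [:: (1, i)]; rewrite /comb big_seq1 scale1r.
have /choice[s hs] (n : nat) : exists l, nrm (w - comb d l) < n.+1%:R^-1.
  by apply: near_comb; rewrite invr_gt0 ltr0n.
have C1 : 0 < C + 1 by rewrite ltr_wpDl.
have [z hz] : exists z : K, forall e : R, 0 < e ->
    exists N, forall n, (N <= n)%N -> nrm (comb t (s n) - z) < e.
  apply: hilbert_complete => e e_gt0.
  have [N hN] := invS_small (e / 2 / (C + 1)) ltac:(by rewrite !divr_gt0).
  exists N => m n hm hn.
  have -> : comb t (s m) - comb t (s n) = - ((-1) *: comb t (s m) + comb t (s n)).
    by rewrite scaleN1r opprD opprK.
  rewrite nrmN comb_lin; apply: (le_lt_trans (dt _)); rewrite -comb_lin scaleN1r.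
  rewrite addrC; have h1 := lt_trans (hs m) (hN m hm); have h2 := lt_trans (hs n) (hN n hn).
  have := nrm_dist w (comb d (s n)) (comb d (s m)); rewrite [nrm (_ - w)]nrmBC => h3.
  have h4 : C * nrm (comb d (s n) - comb d (s m)) <= C * (e / 2 / (C + 1) + e / 2 / (C + 1)).
    by rewrite ler_wpM2l//; lra.
  have h5 : (C + 1) * (e / 2 / (C + 1) + e / 2 / (C + 1)) = e by field; rewrite gt_eqF.
  have h6 : 0 < e / 2 / (C + 1) by rewrite !divr_gt0.
  lra.
exists z => e e_gt0; have [N hN] := hz e e_gt0; have [N' hN'] := invS_small e e_gt0.
exists (s (N + N')%N); split; first exact: lt_trans (hs _) (hN' _ (leq_addl _ _)).
by rewrite nrmBC; exact/hN/leq_addr.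
Qed.

(** The closure of the set of pairs of corresponding linear combinations is the
    graph of [L]: the inequality makes it single-valued and, [K] being complete,
    everywhere defined. *)
Lemma ext_linear : exists L : H -> K, [/\ linear L, forall i, L (d i) = t i &
  forall v, nrm (L v) <= C * nrm v].
Proof.
have [L hL] := choice ext_graph_ex.
have uniq_graph w z z' : graph w z -> graph w z' -> z = z'.
  move=> h h'; apply/eqP; rewrite -subr_eq0; apply/eqP/nrm_eq0/eqP.
  rewrite eq_le nrm_ge0 andbT.
  have := ext_graph_bound (ext_graph_lin (-1) h' h).
  by rewrite !scaleN1r addNr nrm0 mulr0 addrC.
exists L; split=> [c u v|i|v]; last exact: ext_graph_bound.
  exact: uniq_graph (hL _) (ext_graph_lin c (hL u) (hL v)).
apply: uniq_graph (hL _) _ => e e_gt0; exists [:: (1, i)].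
by rewrite /comb !big_seq1 !scale1r !subrr !nrm0.
Qed.

End Extension.

Section GramSchmidt.
Variables (R : realType) (H : hilbert R).
Implicit Types (u v x y : H) (e s : seq H).

(** Recursive, so that sums over [e] can be treated by induction. *)
Fixpoint orthonormal e := if e is x :: e' then
  [/\ dot x x = 1, forall y, y \in e' -> dot x y = 0 & orthonormal e'] else True.

Definition proj e u := \sum_(x <- e) dot u x *: x.

Lemma dot_proj e u v : dot (proj e u) v = \sum_(x <- e) dot u x * dot x v.
Proof. by rewrite dot_suml; apply: eq_bigr => x _; rewrite dotZl. Qed.

Lemma dot_proj_mem e u y : orthonormal e -> y \in e -> dot (proj e u) y = dot u y.
Proof.
elim: e => // x e ih [x1 xe oe]; rewrite dot_proj big_cons -dot_proj inE.
have [-> _|_ /= ye] := eqVneq y x.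
  rewrite x1 mulr1 dot_proj big_seq big1 ?addr0// => z ze.
  by rewrite (dotC z) xe// conjC0 mulr0.
by rewrite xe// mulr0 add0r ih.
Qed.

Lemma gram_schmidt s : exists e, orthonormal e /\ forall u, u \in s -> proj e u = u.
Proof.
elim: s => [|z s [e [oe es]]]; first by exists [::].
pose r := z - proj e z.
have re y : y \in e -> dot r y = 0 by move=> ye; rewrite dotBl dot_proj_mem// subrr.
have [r0|r0] := eqVneq r 0.
  exists e; split=> // u; rewrite inE => /predU1P[->|]; last exact: es.
  by apply/eqP; rewrite eq_sym -subr_eq0; exact/eqP.
have nr : (nrm r)%:C != 0.
  by apply: contra r0 => /eqP[/nrm_eq0 ->].
pose f := ((nrm r)%:C)^-1 *: r.
have fe y : y \in e -> dot f y = 0 by move=> ye; rewrite dotZl re// mulr0.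
have cr : ((nrm r)%:C^-1)^* = (nrm r)%:C^-1.
  by rewrite fmorphV /= conj_Creal// -nrmE normr_real.
have sqE : (nrm r ^+ 2)%:C = (nrm r)%:C ^+ 2 :> R[i] by rewrite rmorphXn.
have ff : dot f f = 1.
  by rewrite dotZl dotZr dotvv cr sqE; field.
exists (f :: e); split=> // u; rewrite inE /proj big_cons -/(proj e u) => /predU1P[->|us].
  have pf : dot (proj e z) f = 0.
    by rewrite dot_proj big_seq big1// => y ye; rewrite (dotC y) fe// conjC0 mulr0.
  have -> : dot z f = (nrm r)%:C.
    have -> : z = r + proj e z by rewrite subrK.
    by rewrite dotDl pf addr0 dotZr dotvv cr sqE; field.
  by rewrite scalerA mulfV// scale1r subrK.
rewrite -{1}(es u us) dot_proj big_seq big1 ?scale0r ?add0r ?es// => y ye.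
by rewrite (dotC y) fe// conjC0 mulr0.
Qed.

(** The orthogonal projection onto the span of [e]. *)
Lemma projection_bop e : orthonormal e -> exists E : bop H,
  [/\ forall u, E u = proj e u, star E = E & E * E = E].
Proof.
move=> oe.
have projP c u v : proj e (c *: u + v) = c *: proj e u + proj e v.
  rewrite /proj scaler_sumr -big_split; apply: eq_bigr => x _.
  by rewrite dotPl scalerDl scalerA.
have projC u v : dot (proj e u) v = dot u (proj e v).
  rewrite (dotC u) !dot_proj rmorph_sum; apply: eq_bigr => x _ /=.
  by rewrite rmorphM /= -!dotC mulrC.
have [||u v|E [EE _]] := @bop_of_form R H (fun u v => dot (proj e u) v) (\sum_(x <- e) nrm x ^+ 2).
- by move=> c u v w; rewrite projP dotPl.
- by move=> c u v w; rewrite dotDr dotZr.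
- rewrite dot_proj; apply: (le_trans (nrm_sum _ _ _)); rewrite -mulrA mulr_suml.
  apply: ler_sum => x _; rewrite nrmM.
  have -> : nrm x ^+ 2 * (nrm u * nrm v) = (nrm u * nrm x) * (nrm x * nrm v) by ring.
  by apply: ler_pM; rewrite ?nrm_ge0 ?nrm_dot.
have Ep u : E u = proj e u by apply: dot_inj => w; rewrite dotC EE -dotC.
exists E; split=> //; first by apply: bop_dotP => u v; rewrite starE !Ep projC.
apply: bopP => u; rewrite mul_bopE !Ep /proj; apply: eq_big_seq => x xe.
by rewrite -/(proj e u) dot_proj_mem.
Qed.

End GramSchmidt.

(** * Operators on tensor products, slices *)

Section TensorProducts.
Variables (R : realType) (H K : hilbert R) (T : htensor H K).
Implicit Types (u : H) (v : K) (w : T).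

Lemma tnsDl u u' v : tns T (u + u') v = tns T u v + tns T u' v.
Proof. by rewrite -[u]scale1r tns_linl !scale1r. Qed.

Lemma tns0l v : tns T 0 v = 0.
Proof. by apply: (addrI (tns T 0 v)); rewrite -tnsDl !addr0. Qed.

Lemma tnsZl c u v : tns T (c *: u) v = c *: tns T u v.
Proof. by rewrite -[c *: u]addr0 tns_linl tns0l addr0. Qed.

Lemma tnsDr u v v' : tns T u (v + v') = tns T u v + tns T u v'.
Proof. by rewrite -[v]scale1r tns_linr !scale1r. Qed.

Lemma tns0r u : tns T u 0 = 0.
Proof. by apply: (addrI (tns T u 0)); rewrite -tnsDr !addr0. Qed.

Lemma tnsZr c u v : tns T u (c *: v) = c *: tns T u v.
Proof. by rewrite -[c *: v]addr0 tns_linr tns0r addr0. Qed.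

Lemma tnsBr u v v' : tns T u (v - v') = tns T u v - tns T u v'.
Proof. by rewrite tnsDr -scaleN1r tnsZr scaleN1r. Qed.

Lemma tns_suml I (r : seq I) (F : I -> H) v :
  tns T (\sum_(i <- r) F i) v = \sum_(i <- r) tns T (F i) v.
Proof. by apply: (big_morph (fun u => tns T u v)) => [u u'|]; [exact: tnsDl|exact: tns0l]. Qed.

Lemma tns_sumr I (r : seq I) u (F : I -> K) :
  tns T u (\sum_(i <- r) F i) = \sum_(i <- r) tns T u (F i).
Proof. by apply: (big_morph (tns T u)) => [v v'|]; [exact: tnsDr|exact: tns0r]. Qed.

Lemma nrm_tns u v : nrm (tns T u v) = nrm u * nrm v.
Proof.
apply/eqP; rewrite -(@eqrXn2 _ 2) ?mulr_ge0 ?nrm_ge0// -!Re_dotvv dot_tns !dotvv.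
by rewrite -rmorphM /= exprMn.
Qed.

Definition elementary_tensors : set T := [set w | exists p : H * K, w = tns T p.1 p.2].

Lemma tns_totalP : total_in elementary_tensors.
Proof.
rewrite /total_in -(tns_total T); congr (closure (lspan _)).
apply/seteqP; split=> w; first by move=> [[u v] ->]; exists u, v.
by move=> [u [v ->]]; exists (u, v).
Qed.

Lemma tns_ext (V : normedModType R[i]) (f g : T -> V) (C D : R) :
  (forall c w w', f (c *: w + w') = c *: f w + f w') ->
  (forall c w w', g (c *: w + w') = c *: g w + g w') ->
  (forall w, nrm (f w) <= C * nrm w) -> (forall w, nrm (g w) <= D * nrm w) ->
  (forall u v, f (tns T u v) = g (tns T u v)) -> f =1 g.
Proof.
move=> flin glin fC gD fg w; apply/eqP; rewrite -subr_eq0; apply/eqP.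
apply: (@linear_total0 _ _ _ _ (fun w => f w - g w) (C + D) tns_totalP) => [c w1 w2|w1|].
- by rewrite flin glin scalerBr opprD addrACA.
- by apply: (le_trans (nrmB _ _)); rewrite mulrDl lerD.
- by move=> _ [p ->]; rewrite fg subrr.
Qed.

Lemma bop_tns_ext (x y : bop T) : (forall u v, x (tns T u v) = y (tns T u v)) -> x = y.
Proof.
move=> h; apply: bopP.
by apply: tns_ext h => [c w w'|c w w'|w|w]; [exact: bop_linear|exact: bop_linear|exact: bop_nrm_le|exact: bop_nrm_le].
Qed.

Lemma dot_tns_ext (w w' : T) : (forall u v, dot (tns T u v) w = dot (tns T u v) w') -> w = w'.
Proof.
move=> h; apply: dot_inj; apply: (@tns_ext R[i] (fun z => dot z w) (fun z => dot z w') (nrm w) (nrm w')) => // *;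
  by [rewrite dotPl|rewrite mulrC nrm_dot].
Qed.

Lemma dot_tns_extl (w w' : T) : (forall u v, dot w (tns T u v) = dot w' (tns T u v)) -> w = w'.
Proof. by move=> h; apply: dot_tns_ext => u v; rewrite dotC h -dotC. Qed.

Lemma bop_dot_tns_ext (x y : bop T) :
  (forall u v u' v', dot (x (tns T u v)) (tns T u' v') = dot (y (tns T u v)) (tns T u' v')) -> x = y.
Proof. by move=> h; apply: bop_tns_ext => u v; apply: dot_tns_extl => u' v'. Qed.

Lemma nrm_sum_orthonormal (e : seq H) (F : H -> K) : orthonormal e ->
  nrm (\sum_(x <- e) tns T x (F x)) ^+ 2 = \sum_(x <- e) nrm (F x) ^+ 2.
Proof.
elim: e => [|x e ih /= [x1 xe oe]]; first by rewrite !big_nil nrm0 expr0n.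
rewrite !big_cons nrm_sqrD ih//.
have -> : dot (tns T x (F x)) (\sum_(y <- e) tns T y (F y)) = 0.
  rewrite dot_sumr big_seq big1// => y ye.
  by rewrite dot_tns xe// mul0r.
rewrite mulr0 addr0; congr (_ + _).
by rewrite -!Re_dotvv dot_tns x1 mul1r.
Qed.

End TensorProducts.

(** Bilinearity lets the first legs be expanded along [e]; the second legs are then
    collected. The map [Y] acts on the second legs before and after, so this
    compares a sum with its image. *)
Lemma comb_orthonormal (R : realType) (H K K' : hilbert R) (T' : htensor H K') (Y : K -> K') (l : seq (R[i] * (H * K))) e :
  linear Y -> (forall p, p \in l -> proj e p.2.1 = p.2.1) ->
  comb (fun p => tns T' p.1 (Y p.2)) l
  = \sum_(x <- e) tns T' x (Y (\sum_(p <- l) (p.1 * dot p.2.1 x) *: p.2.2)).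
Proof.
move=> Ylin le.
have Y0 : Y 0 = 0.
  by have := Ylin (-1) 0 0; rewrite scaler0 addr0 scaleN1r addNr.
have YD (u v : K) : Y (u + v) = Y u + Y v by rewrite -[u]scale1r Ylin !scale1r.
have YZ c (u : K) : Y (c *: u) = c *: Y u by rewrite -[c *: u]addr0 Ylin Y0 addr0.
under [RHS]eq_bigr => x _ do rewrite (big_morph Y YD Y0) tns_sumr.
rewrite exchange_big; apply: eq_big_seq => p pl /=.
rewrite -{1}(le p pl) /proj tns_suml scaler_sumr; apply: eq_bigr => x _.
by rewrite YZ tnsZr tnsZl scalerA.
Qed.

Section Amplification.
Variables (R : realType) (H K K' : hilbert R) (T : htensor H K) (T' : htensor H K').

(** Id (x) Y, with the norm of Y: after [comb_orthonormal] the squared norms of both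
    sides are sums of squares, compared term by term. *)
Lemma amplify (Y : K -> K') (C : R) : linear Y -> 0 <= C ->
  (forall v, nrm (Y v) <= C * nrm v) ->
  exists L : T -> T', [/\ linear L, forall u v, L (tns T u v) = tns T' u (Y v) &
    forall w, nrm (L w) <= C * nrm w].
Proof.
move=> Ylin C0 YC.
have [|//|l|L [Llin Ltns LC]] := @ext_linear R T T' (H * K)%type
   (fun p => tns T p.1 p.2) (fun p => tns T' p.1 (Y p.2)) C.
- exact: tns_totalP.
- have [e [oe he]] := gram_schmidt [seq p.2.1 | p <- l].
  have le p : p \in l -> proj e p.2.1 = p.2.1 by move=> pl; apply/he/map_f.
  rewrite (comb_orthonormal _ Ylin le) (comb_orthonormal T (Y := id) _ le)//.
  rewrite -(ler_pXn2r (n := 2)) ?nnegrE ?mulr_ge0 ?nrm_ge0// exprMn.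
  rewrite !nrm_sum_orthonormal// mulr_sumr; apply: ler_sum => x _.
  by rewrite -exprMn lerXn2r ?nnegrE ?mulr_ge0 ?nrm_ge0.
by exists L; split=> // u v; rewrite (Ltns (u, v)).
Qed.

End Amplification.

Section TensorOperators.
Variables (R : realType) (H K : hilbert R) (T : htensor H K).

Lemma swap_totalP : closure (lspan [set w | exists (v : K) (u : H), w = tns T u v]) = [set: T].
Proof.
rewrite -(tns_total T); congr (closure (lspan _)).
by apply/seteqP; split=> w [u [v ->]]; exists v, u.
Qed.

(** The same Hilbert space with its legs exchanged: statements on the second leg
    apply to the first one. *)
Definition swap_tensor : htensor K H :=
  @HTensor R K H T (fun v u => tns T u v) (fun u => tns_linr T u) (fun v => tns_linl T v)
    (fun v v' u u' => etrans (dot_tns T u u' v v') (mulrC _ _)) swap_totalP.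

End TensorOperators.

Lemma ampl_exists (R : realType) (H K : hilbert R) (T : htensor H K) (y : bop K) :
  exists z : bop T, (forall u v, z (tns T u v) = tns T u (y v)) /\ nrm z <= nrm y.
Proof.
have [L [Llin Ltns LC]] := amplify T T (@bop_linear _ _ y) (nrm_ge0 y) (bop_nrm_le y).
have [||u v|z [zE zC]] := @bop_of_form R T (fun u v => dot (L u) v) (nrm y).
- by move=> c u v w; rewrite Llin dotPl.
- by move=> c u v w; rewrite dotDr dotZr.
- by apply: (le_trans (nrm_dot _ _)); rewrite ler_wpM2r ?nrm_ge0.
exists z; split; last by apply: nrm_bop_le; rewrite ?nrm_ge0.
by move=> u v; rewrite -Ltns; apply: dot_inj => w; rewrite dotC zE -dotC.
Qed.

Section TensorOp.
Variables (R : realType) (H K : hilbert R) (T : htensor H K).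

Lemma tensor_op_exists (x : bop H) (y : bop K) :
  exists z : bop T, is_tensor_op x y z /\ nrm z <= nrm x * nrm y.
Proof.
have [z1 [z1E z1n]] := ampl_exists (swap_tensor T) x.
have [z2 [z2E z2n]] := ampl_exists T y.
exists ((z1 : bop T) * z2); split.
  by move=> u v; rewrite mul_bopE z2E (z1E (y v) u).
by apply: (le_trans (nrm_bopM _ _)); rewrite ler_pM ?nrm_ge0.
Qed.

Definition tensor_op x y : bop T := projT1 (cid (tensor_op_exists x y)).

Lemma tensor_opP x y : is_tensor_op x y (tensor_op x y).
Proof. by rewrite /tensor_op; case: cid => z []. Qed.

Lemma tensor_opE x y u v : tensor_op x y (tns T u v) = tns T (x u) (y v).
Proof. exact: tensor_opP. Qed.

Lemma nrm_tensor_op x y : nrm (tensor_op x y) <= nrm x * nrm y.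
Proof. by rewrite /tensor_op; case: cid => z []. Qed.

Lemma tensor_op_unique x y z : is_tensor_op x y z -> z = tensor_op x y.
Proof. by move=> h; apply: bop_tns_ext => u v; rewrite h tensor_opE. Qed.

Lemma tensor_opM x y x' y' : tensor_op x y * tensor_op x' y' = tensor_op (x * x') (y * y').
Proof. by apply: tensor_op_unique => u v; rewrite mul_bopE !tensor_opE !mul_bopE. Qed.

Lemma star_tensor_op x y : star (tensor_op x y) = tensor_op (star x) (star y).
Proof.
apply: bop_dot_tns_ext => u v u' v'.
by rewrite starE !tensor_opE !dot_tns !starE.
Qed.

Lemma slice_exists (X : bop T) (xi eta : K) : exists y : bop H,
  (forall u u', dot (y u) u' = dot (X (tns T u xi)) (tns T u' eta)) /\
  nrm y <= nrm X * nrm xi * nrm eta.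
Proof.
have [|||y [yE yC]] := @bop_of_form R H (fun u u' => dot (X (tns T u xi)) (tns T u' eta))
   (nrm X * nrm xi * nrm eta).
- by move=> c u v w; rewrite tns_linl bop_linear dotPl.
- by move=> c u v w; rewrite tns_linl dotDr dotZr.
- move=> u v; apply: (le_trans (nrm_dot _ _)); rewrite nrm_tns.
  have := bop_nrm_le X (tns T u xi); rewrite nrm_tns => h.
  have -> : nrm X * nrm xi * nrm eta * nrm u * nrm v = nrm X * (nrm u * nrm xi) * (nrm v * nrm eta).
    by ring.
  by apply: ler_pM; rewrite ?mulr_ge0 ?nrm_ge0.
by exists y; split=> //; apply: nrm_bop_le; rewrite ?mulr_ge0 ?nrm_ge0.
Qed.

(** (id (x) om)(X) for the vector functional om(y) = dot (y xi) eta. *)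
Definition slice X xi eta : bop H := projT1 (cid (slice_exists X xi eta)).

Lemma sliceE X xi eta u u' :
  dot (slice X xi eta u) u' = dot (X (tns T u xi)) (tns T u' eta).
Proof. by rewrite /slice; case: cid => y []. Qed.

Lemma nrm_slice X xi eta : nrm (slice X xi eta) <= nrm X * nrm xi * nrm eta.
Proof. by rewrite /slice; case: cid => y []. Qed.

Lemma slice_eq (X : bop T) xi eta (y : bop H) :
  (forall u u', dot (y u) u' = dot (X (tns T u xi)) (tns T u' eta)) -> y = slice X xi eta.
Proof. by move=> h; apply: bop_dotP => u u'; rewrite h sliceE. Qed.

Lemma slice_linl (X : bop T) c xi xi' eta :
  slice X (c *: xi + xi') eta = c *: slice X xi eta + slice X xi' eta.
Proof.
apply/esym/slice_eq => u u'.
by rewrite tns_linr bop_linear dotPl add_bopE scale_bopE dotPl !sliceE.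
Qed.

Lemma slice_linr (X : bop T) c xi eta eta' :
  slice X xi (c *: eta + eta') = c^* *: slice X xi eta + slice X xi eta'.
Proof.
apply/esym/slice_eq => u u'.
by rewrite tns_linr dotDr dotZr add_bopE scale_bopE dotPl !sliceE.
Qed.

Lemma star_slice (X : bop T) xi eta : star (slice X xi eta) = slice (star X) eta xi.
Proof. by apply: slice_eq => u u'; rewrite !starE dotC sliceE -dotC. Qed.

End TensorOp.

(** * A quadratic equation in a C*-algebra *)

Section CstarAlgebras.
Variables (R : realType) (H : hilbert R) (A : set (bop H)).
Hypothesis Acs : cstar_alg A.
Implicit Types (x y q : bop H) (c : R[i]).

Lemma cstar_closed x : closure A x -> A x. Proof. by case: Acs => cl _ _ _ _; exact: cl. Qed.
Lemma cstar0 : A 0. Proof. by case: Acs. Qed.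
Lemma cstar_lin c x y : A x -> A y -> A (c *: x + y). Proof. by case: Acs => _ _ h _ _; exact: h. Qed.
Lemma cstarM x y : A x -> A y -> A (x * y). Proof. by case: Acs => _ _ _ h _; exact: h. Qed.
Lemma cstar_star x : A x -> A (star x). Proof. by case: Acs => _ _ _ _ h; exact: h. Qed.
Lemma cstarD x y : A x -> A y -> A (x + y).
Proof. by move=> Ax Ay; rewrite -[x]scale1r; exact: cstar_lin. Qed.
Lemma cstarZ c x : A x -> A (c *: x).
Proof. by move=> Ax; rewrite -[c *: x]addr0; apply: cstar_lin => //; exact: cstar0. Qed.
Lemma cstarB x y : A x -> A y -> A (x - y).
Proof. by move=> Ax Ay; rewrite -scaleN1r; apply: cstarD => //; exact: cstarZ. Qed.

Lemma bop_complete (q : nat -> bop H) :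
  (forall e : R, 0 < e -> exists N, forall m n, (N <= m)%N -> (N <= n)%N -> nrm (q m - q n) < e) ->
  exists x, forall e : R, 0 < e -> exists N, forall n, (N <= n)%N -> nrm (q n - x) < e.
Proof.
move=> hq.
have /choice[f hf] (v : H) : exists l, forall e : R, 0 < e ->
    exists N, forall n, (N <= n)%N -> nrm (q n v - l) < e.
  apply: hilbert_complete => e e_gt0.
  have v1 : 0 < nrm v + 1 by rewrite ltr_wpDl ?nrm_ge0.
  have [N hN] := hq (e / (nrm v + 1)) ltac:(by rewrite divr_gt0).
  exists N => m n hm hn; rewrite -sub_bopE; apply: (le_lt_trans (bop_nrm_le _ _)).
  have h := hN m n hm hn.
  apply: (@le_lt_trans _ _ (e / (nrm v + 1) * nrm v)).
    by rewrite ler_wpM2r ?nrm_ge0// ltW.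
  by rewrite mulrAC ltr_pdivrMr// ltr_pM2l// ltrDl.
have f_dist (e : R) : 0 < e -> exists N, forall n, (N <= n)%N -> forall v, nrm (q n v - f v) <= e * nrm v.
  move=> e_gt0; have [N hN] := hq e e_gt0; exists N => n hn v.
  apply/ler_addgt0Pr => e' e'_gt0; have [N' hN'] := hf v e' e'_gt0.
  have := hN' (N + N')%N (leq_addl _ _) => h1.
  have h2 : nrm (q n v - q (N + N')%N v) <= e * nrm v.
    rewrite -sub_bopE; apply: (le_trans (bop_nrm_le _ _)).
    by rewrite ler_wpM2r ?nrm_ge0// ltW// hN// leq_addr.
  by apply: (le_trans (nrm_dist (q (N + N')%N v) _ _)); rewrite lerD// ltW.
have [N0 hN0] := f_dist 1 ltr01.
have f_lin c u v : f (c *: u + v) = c *: f u + f v.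
  apply/eqP; rewrite -subr_eq0; apply/eqP/nrm_small => e e_gt0.
  pose M := nrm (c *: u + v) + nrm c * nrm u + nrm v + 1.
  have M_gt0 : 0 < M by rewrite ltr_wpDl ?addr_ge0 ?mulr_ge0 ?nrm_ge0.
  have M_neq0 : M != 0 by rewrite gt_eqF.
  have [N hN] := f_dist (e / M) ltac:(by rewrite divr_gt0).
  have hn := hN N (leqnn N).
  have -> : f (c *: u + v) - (c *: f u + f v) =
     - (q N (c *: u + v) - f (c *: u + v)) + (c *: (q N u - f u) + (q N v - f v)).
    have -> : c *: (q N u - f u) + (q N v - f v) = q N (c *: u + v) - (c *: f u + f v).
      by rewrite bop_linear scalerBr addrACA -opprD.
    by rewrite opprB subrKA.
  apply: (le_trans (nrmD _ _)); rewrite nrmN.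
  apply: (le_trans (lerD (hn _) (nrmD _ _))); rewrite nrmZ.
  have h1 : nrm c * nrm (q N u - f u) <= nrm c * (e / M * nrm u) by rewrite ler_wpM2l ?nrm_ge0.
  have h2 := hn v.
  have h3 : e = e / M * nrm (c *: u + v) + (nrm c * (e / M * nrm u) + e / M * nrm v) + e / M.
    rewrite -{1}(divfK M_neq0 e).
    by move: (e / M) => k; rewrite /M; ring.
  have h4 : 0 < e / M by rewrite divr_gt0.
  lra.
have f_bd v : nrm (f v) <= (1 + nrm (q N0)) * nrm v.
  have := nrm_dist (q N0 v) (f v) 0; rewrite !subr0 nrmBC.
  have := hN0 N0 (leqnn _) v; have := bop_nrm_le (q N0) v; lra.
have [||u v|x [xE _]] := @bop_of_form R H (fun u v => dot (f u) v) (1 + nrm (q N0)).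
- by move=> c u v w; rewrite f_lin dotPl.
- by move=> c u v w; rewrite dotDr dotZr.
- by apply: (le_trans (nrm_dot _ _)); rewrite ler_wpM2r ?nrm_ge0.
have xf v : x v = f v by apply: dot_inj => w; rewrite dotC xE -dotC.
exists x => e e_gt0; have [N hN] := f_dist (e / 2) ltac:(by rewrite divr_gt0).
exists N => n hn; apply: (@le_lt_trans _ _ (e / 2)); last by rewrite ltr_pdivrMr// ltr_pMr// ltr1n.
apply: nrm_bop_le => [|v]; first by rewrite ltW// divr_gt0.
by rewrite sub_bopE xf; exact: hN.
Qed.

Lemma nrm_half : nrm (2^-1 : R[i]) = 2^-1.
Proof.
have -> : (2^-1 : R[i]) = (2^-1 : R)%:C by rewrite fmorphV rmorph_nat.
by rewrite nrm_real ger0_norm ?invr_ge0.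
Qed.

Lemma conj_half : (2^-1 : R[i])^* = 2^-1.
Proof. by rewrite fmorphV rmorph_nat. Qed.

Lemma nrm_limit_eq x y : (forall e : R, 0 < e -> nrm (x - y) <= e) -> x = y.
Proof. by move=> h; apply/eqP; rewrite -subr_eq0; apply/eqP/nrm_small. Qed.

Fixpoint sqrt_iter b n : bop H :=
  if n is n'.+1 then 2^-1 *: (b + sqrt_iter b n' * sqrt_iter b n') else 0.

(** In other words b = 1 - (1 - q) ^ 2, where 1 - q is a square root of 1 - b that
    needs no unit in [A]: q is the fixed point of q |-> (b + q ^ 2) / 2, a
    contraction on the ball of radius 1/2. It stands in for the functional
    calculus in [jordan_bound]. *)
Lemma cstar_quadratic b : A b -> star b = b -> nrm b <= 3 / 4 ->
  exists q, [/\ A q, star q = q & b = q + q - q * q].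
Proof.
move=> Ab sb b34; pose q := sqrt_iter b.
have Aq n : A (q n).
  elim: n => [|n ih] /=; first exact: cstar0.
  by apply: cstarZ; apply: cstarD => //; exact: cstarM.
have sq n : star (q n) = q n.
  elim: n => [|n ih] /=; first exact: star0.
  by rewrite starZ conj_half starD starM ih sb.
have nq n : nrm (q n) <= 1 / 2.
  elim: n => [|n ih] /=; first by rewrite nrm0; lra.
  rewrite nrmZ nrm_half; have := nrmD b (q n * q n); have := nrm_bopM (q n) (q n).
  have : nrm (q n) * nrm (q n) <= 1 / 2 * (1 / 2) by rewrite ler_pM ?nrm_ge0.
  lra.
have sub_sq x y : x * x - y * y = x * (x - y) + (x - y) * y.
  by rewrite mulrBr mulrBl subrKA.
have step n : nrm (q n.+2 - q n.+1) <= 1 / 2 * nrm (q n.+1 - q n).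
  have -> : q n.+2 - q n.+1 = 2^-1 *: (q n.+1 * (q n.+1 - q n) + (q n.+1 - q n) * q n).
    by rewrite -sub_sq /= -scalerBr opprD addrACA subrr add0r.
  rewrite nrmZ nrm_half.
  have := nrmD (q n.+1 * (q n.+1 - q n)) ((q n.+1 - q n) * q n).
  have := nrm_bopM (q n.+1) (q n.+1 - q n); have := nrm_bopM (q n.+1 - q n) (q n).
  have : nrm (q n.+1) * nrm (q n.+1 - q n) <= 1 / 2 * nrm (q n.+1 - q n).
    by rewrite ler_wpM2r ?nrm_ge0.
  have : nrm (q n.+1 - q n) * nrm (q n) <= nrm (q n.+1 - q n) * (1 / 2).
    by rewrite ler_wpM2l ?nrm_ge0.
  lra.
have geo n : nrm (q n.+1 - q n) <= 2 * (1 / 2) ^+ n.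
  elim: n => [|n ih]; first by have := nrmB (q 1%N) (q 0%N); have := nq 1%N; have := nq 0%N; rewrite expr0; lra.
  by have := step n; rewrite exprS; lra.
have tail m n : nrm (q (m + n)%N - q m) <= 4 * (1 / 2) ^+ m - 4 * (1 / 2) ^+ (m + n).
  elim: n => [|n ih]; first by rewrite addn0 !subrr nrm0.
  rewrite addnS; have := nrm_dist (q (m + n)%N) (q (m + n).+1) (q m).
  have := geo (m + n)%N; rewrite exprS; lra.
have half01 : 0 <= (1 / 2 : R) < 1 by lra.
have [|x hx] := bop_complete (q := q).
  move=> e e_gt0; have [N hN] := geometric_small 8 half01 e_gt0.
  have tailN m : (N <= m)%N -> nrm (q m - q N) <= 4 * (1 / 2) ^+ N.
    move=> /subnKC <-; have := tail N (m - N)%N.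
    have : 0 <= (1 / 2 : R) ^+ (N + (m - N)) by rewrite exprn_ge0//; lra.
    lra.
  exists N => m n hm hn; have := nrm_dist (q N) (q m) (q n).
  rewrite [nrm (q N - _)]nrmBC; have := tailN m hm; have := tailN n hn; lra.
have Ax : A x.
  by apply: cstar_closed; apply/closure_nrmP => e /hx[N hN]; exists (q N) => //; exact: hN.
exists x; split=> //.
  apply: nrm_limit_eq => e e_gt0; have [N hN] := hx (e / 2) ltac:(by rewrite divr_gt0).
  have := hN N (leqnn N) => h.
  have h' : nrm (star x - q N) < e / 2.
    by rewrite -{1}(sq N) -starB nrm_star nrmBC.
  by have := nrm_dist (q N) (star x) x; lra.
apply: nrm_limit_eq => e e_gt0.
pose M := 3 + nrm x + 1 / 2.
have M_gt0 : 0 < M by have := nrm_ge0 x; rewrite /M; lra.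
have [N hN] := hx (e / M) ltac:(by rewrite divr_gt0).
have h0 := hN N (leqnn N); have h1 := hN N.+1 (leqnSn N).
have E : b = q N.+1 + q N.+1 - q N * q N.
  rewrite /= -mulr2n -scaler_nat scalerA mulfV ?pnatr_eq0// scale1r.
  by rewrite addrK.
rewrite {1}E.
have -> : q N.+1 + q N.+1 - q N * q N - (x + x - x * x)
   = ((q N.+1 - x) + (q N.+1 - x)) - (q N * q N - x * x).
  have -> : (q N.+1 - x) + (q N.+1 - x) = (q N.+1 + q N.+1) - (x + x) by rewrite addrACA -opprD.
  by rewrite !opprB addrACA [RHS]addrACA; congr (_ + _); rewrite addrC.
rewrite sub_sq; apply: (le_trans (nrmB _ _)).
have n1 := nrmD (q N.+1 - x) (q N.+1 - x).
have n2 := nrmD (q N * (q N - x)) ((q N - x) * x).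
have n3 := nrm_bopM (q N) (q N - x); have n4 := nrm_bopM (q N - x) x.
have n5 : nrm (q N) * nrm (q N - x) <= 1 / 2 * nrm (q N - x) by rewrite ler_wpM2r ?nrm_ge0.
have n6 : nrm (q N - x) * nrm x <= e / M * nrm x by rewrite ler_wpM2r ?nrm_ge0// ltW.
have n7 : e / M * M = e by rewrite divfK ?gt_eqF.
have n8 : 0 < e / M by rewrite divr_gt0.
by move: n7; rewrite {2}/M; lra.
Qed.

End CstarAlgebras.

(** * Morphisms are bounded, states are hermitian *)

Section Morphisms.
Variables (R : realType) (H L : hilbert R) (A : set (bop H)).
Hypothesis Acs : cstar_alg A.
Implicit Types (x y q : bop H) (c : R[i]) (pi : bop H -> bop L).

Lemma linear_onZ (V : lmodType R[i]) (f : bop H -> V) c x : linear_on A f -> A x ->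
  f (c *: x) = c *: f x.
Proof.
move=> lf Ax; have A0 := cstar0 Acs.
have f0 : f 0 = 0.
  by have := lf 1 0 0 A0 A0; rewrite scaler0 addr0 scale1r => /(congr1 (fun z => z - f 0)); rewrite addrK subrr.
by rewrite -[c *: x]addr0 lf// f0 addr0.
Qed.

Lemma linear_onD (V : lmodType R[i]) (f : bop H -> V) x y : linear_on A f -> A x -> A y ->
  f (x + y) = f x + f y.
Proof. by move=> lf Ax Ay; rewrite -[x]scale1r lf// !scale1r. Qed.

Lemma linear_onB (V : lmodType R[i]) (f : bop H -> V) x y : linear_on A f -> A x -> A y ->
  f (x - y) = f x - f y.
Proof. by move=> lf Ax Ay; rewrite addrC -scaleN1r lf// scaleN1r addrC. Qed.

Lemma scaled_bound (V : normedModType R[i]) (f : bop H -> V) (r : R) : linear_on A f -> 0 < r ->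
  (forall x, A x -> nrm x <= r -> nrm (f x) <= 1) ->
  forall x, A x -> nrm (f x) <= r^-1 * nrm x.
Proof.
move=> lf r_gt0 h x Ax; apply/ler_addgt0Pr => e e_gt0.
pose s := (nrm x + r * e) / r; have s_gt0 : 0 < s.
  by rewrite divr_gt0// ltr_wpDl ?nrm_ge0// mulr_gt0.
have nr (t : R) : 0 < t -> nrm (t%:C : R[i]) = t by move=> ?; rewrite nrm_real gtr0_norm.
have := h (s^-1%:C *: x) (cstarZ Acs _ Ax).
rewrite (linear_onZ _ lf Ax) !nrmZ nr ?invr_gt0//.
have nx : s^-1 * nrm x <= r.
  by rewrite ler_pdivrMl// /s divfK ?gt_eqF// lerDl mulr_ge0 ?ltW.
move=> /(_ nx); rewrite ler_pdivrMl// mulr1 => /le_trans; apply.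
by rewrite /s le_eqVlt; apply/orP; left; apply/eqP; field; rewrite gt_eqF.
Qed.

(** Write star x * x = 1 - (1 - q) ^ 2 with [q] self-adjoint; its image is
    1 - (1 - pi q) ^ 2, which is at most 1. Only squares of self-adjoint elements
    are involved, so morphisms and antimorphisms are covered at once. *)
Lemma jordan_bound pi : linear_on A pi ->
  (forall q, A q -> star q = q -> pi (q * q) = pi q * pi q /\ star (pi q) = pi q) ->
  forall x, A x -> nrm x <= 1 / 2 -> forall v, complex.Re (dot (pi (star x * x) v) v) <= nrm v ^+ 2.
Proof.
move=> lpi pisq x Ax nx v.
have Ab : A (star x * x) by apply: (cstarM Acs) => //; exact: (cstar_star Acs).
have [||q [Aq sq ->]] := cstar_quadratic Acs Ab.
- by rewrite starM starK.
- have := nrm_bopM (star x) x; rewrite nrm_star.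
  have : nrm x * nrm x <= 1 / 2 * (1 / 2) by rewrite ler_pM ?nrm_ge0.
  lra.
have Aqq := cstarM Acs Aq Aq; have [pqq spq] := pisq q Aq sq.
rewrite (linear_onB lpi (cstarD Acs Aq Aq) Aqq) (linear_onD lpi Aq Aq) pqq.
rewrite sub_bopE add_bopE mul_bopE dotBl dotDl -{3}spq starE dotvv raddfB raddfD /=.
have := sqr_ge0 (nrm (v - pi q v)); rewrite nrm_sqrB (Re_dotC v); lra.
Qed.

Lemma nrm_le1 (y : bop L) : (forall v, complex.Re (dot ((star y * y) v) v) <= nrm v ^+ 2) -> nrm y <= 1.
Proof.
move=> h; apply: nrm_bop_le => // v; rewrite mul1r.
rewrite -(ler_pXn2r (n := 2)) ?nnegrE ?nrm_ge0//; apply: le_trans (h v).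
by rewrite -nrm_sqr_star.
Qed.

(** The factor 2 comes from [jordan_bound], whose fixed point needs norm at most
    1/2. *)
Lemma star_hom_bound pi : star_hom A pi -> forall x, A x -> nrm (pi x) <= 2 * nrm x.
Proof.
move=> [lpi piM pis]; have -> : 2 = (1 / 2)^-1 :> R by rewrite div1r invrK.
apply: scaled_bound => // x Ax nx; apply: nrm_le1 => v.
rewrite -pis// -piM//; last exact: (cstar_star Acs).
by apply: jordan_bound => // q Aq sq; rewrite piM// -pis// sq.
Qed.

Lemma star_antihom_bound pi : linear_on A pi ->
  (forall x y, A x -> A y -> pi (x * y) = pi y * pi x) ->
  (forall x, A x -> pi (star x) = star (pi x)) ->
  forall x, A x -> nrm (pi x) <= 2 * nrm x.
Proof.
move=> lpi piM pis; have -> : 2 = (1 / 2)^-1 :> R by rewrite div1r invrK.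
apply: scaled_bound => // x Ax nx; rewrite -nrm_star; apply: nrm_le1 => v.
rewrite starK -pis// -piM//; last exact: (cstar_star Acs).
by apply: jordan_bound => // q Aq sq; rewrite piM// -pis// sq.
Qed.

End Morphisms.

Section States.
Variables (R : realType) (H : hilbert R) (A : set (bop H)) (mu : bop H -> R[i]).
Hypotheses (Acs : cstar_alg A) (st : state A mu).
Implicit Types (x y h k : bop H) (c : R[i]).

Lemma state_lin : linear_on A (mu : bop H -> (R[i])^o). Proof. by case: st. Qed.

Lemma stateD x y : A x -> A y -> mu (x + y) = mu x + mu y.
Proof. exact: (linear_onD state_lin). Qed.

Lemma stateB x y : A x -> A y -> mu (x - y) = mu x - mu y.
Proof. exact: (linear_onB state_lin). Qed.

Lemma stateZ c x : A x -> mu (c *: x) = c * mu x.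
Proof. exact: (linear_onZ Acs c state_lin). Qed.

(** The supremum of an unbounded set is 0 by convention, so the normalization of a
    state contains its boundedness. *)
Lemma state_le x : A x -> nrm (mu x) <= nrm x.
Proof.
case: st => lmu _ sup1 Ax.
have sup_mu : has_sup [set complex.Re `|mu x| | x in A `&` [set x | `|x| <= 1]].
  by apply: contrapT => /sup_out h; move/eqP: sup1; rewrite h eq_sym oner_eq0.
have := @scaled_bound R H A Acs R[i] mu 1 lmu ltr01 _ x Ax.
rewrite invr1 mul1r; apply=> y Ay ny; rewrite -sup1.
by apply: ub_le_sup; [exact: sup_mu.2|exists y => //; split => //=; rewrite -[1]/(1%:C) nrm_le].
Qed.

Lemma state_sqr_real x : A x -> complex.Im (mu (star x * x)) = 0.
Proof. by case: st => _ pos _ /pos/ger0_Im. Qed.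

Section SelfAdjoint.
Variable h : bop H.
Hypotheses (Ah : A h) (sh : star h = h) (nh : nrm h <= 1).

Let S : bop H := 1 - h * h.

Lemma deficit_ge0 v : 0 <= complex.Re (dot (S v) v).
Proof.
rewrite /S sub_bopE one_bopE mul_bopE dotBl raddfB /= -{1}sh starE !Re_dotvv subr_ge0.
rewrite lerXn2r ?nnegrE ?nrm_ge0//; apply: (le_trans (bop_nrm_le _ _)).
by rewrite ler_piMl ?nrm_ge0.
Qed.

Lemma deficit_sqr v : nrm (h v) ^+ 2 = nrm v ^+ 2 - complex.Re (dot (S v) v).
Proof.
by rewrite /S sub_bopE one_bopE mul_bopE dotBl raddfB /= -{2}sh starE !Re_dotvv opprB addrC subrK.
Qed.

Lemma star_deficit : star S = S.
Proof. by rewrite /S starB star1 starM !sh. Qed.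

Lemma deficit_comm : S * h = h * S.
Proof. by rewrite /S mulrBl mulrBr mul1r mulr1 mulrA. Qed.

Lemma deficit_le v : nrm (S v) ^+ 2 <= complex.Re (dot (S v) v).
Proof.
rewrite -subr_ge0 -Re_dotvv -raddfB -dotBr.
have -> : v - S v = h (h v) by rewrite /S sub_bopE one_bopE mul_bopE opprB addrC subrK.
by rewrite -{1}sh starEr -mul_bopE -deficit_comm mul_bopE deficit_ge0.
Qed.

Lemma deficit_contr v : nrm (S v) <= nrm v.
Proof.
rewrite -(ler_pXn2r (n := 2)) ?nnegrE ?nrm_ge0//; apply: (le_trans (deficit_le v)).
by have := deficit_sqr v; have := sqr_ge0 (nrm (h v)); lra.
Qed.

(** With S = 1 - h * h, the squares |h (S ^+ j v)|^2 decrease in [j] and are bounded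
    by the differences |S ^+ j v|^2 - |S ^+ j.+1 v|^2, whose sum telescopes. *)
Lemma deficit_pow_small n v : n%:R * nrm ((h * S ^+ n) v) ^+ 2 <= nrm v ^+ 2.
Proof.
have step j : nrm ((h * S ^+ j.+1) v) <= nrm ((h * S ^+ j) v).
  by rewrite exprS mulrA -deficit_comm -mulrA mul_bopE deficit_contr.
have mono j d : nrm ((h * S ^+ (j + d)) v) <= nrm ((h * S ^+ j) v).
  by elim: d => [|d ih]; rewrite ?addn0// addnS; exact: le_trans (step _) ih.
have tele j : nrm ((h * S ^+ j) v) ^+ 2 <= nrm ((S ^+ j) v) ^+ 2 - nrm ((S ^+ j.+1) v) ^+ 2.
  rewrite mul_bopE deficit_sqr [S ^+ _.+1]exprS mul_bopE.
  by have := deficit_le ((S ^+ j) v); lra.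
have main m : m%:R * nrm ((h * S ^+ m) v) ^+ 2 <= nrm v ^+ 2 - nrm ((S ^+ m) v) ^+ 2.
  elim: m => [|m ih]; first by rewrite mul0r expr0 one_bopE subrr.
  have h1 := tele m.
  have h2 : nrm ((h * S ^+ m.+1) v) ^+ 2 <= nrm ((h * S ^+ m) v) ^+ 2.
    by rewrite lerXn2r ?nnegrE ?nrm_ge0.
  rewrite -natr1 mulrDl mul1r.
  have h3 : m%:R * nrm ((h * S ^+ m.+1) v) ^+ 2 <= m%:R * nrm ((h * S ^+ m) v) ^+ 2.
    by rewrite ler_wpM2l ?ler0n.
  move: ih h1 h2 h3; move: (m%:R * _) (m%:R * _) => a b; lra.
by apply: (le_trans (main n)); rewrite lerBlDr lerDl sqr_ge0.
Qed.

(** 1 - (1 - h * h) ^+ n, by a recursion that stays inside [A]. *)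
Fixpoint approx_unit n : bop H :=
  if n is n'.+1 then approx_unit n' + (h * h - h * h * approx_unit n') else 0.

Lemma approx_unitE n : 1 - approx_unit n = S ^+ n.
Proof.
elim: n => [|n ih]; first by rewrite subr0.
by rewrite exprS -ih /S /= mulrBl mul1r mulrBr mulr1 opprD addrA.
Qed.

Lemma approx_unit_in n : A (approx_unit n).
Proof.
elim: n => [|n ih] /=; first exact: (cstar0 Acs).
have Ahh := cstarM Acs Ah Ah.
by apply: (cstarD Acs) => //; apply: (cstarB Acs) => //; exact: (cstarM Acs).
Qed.

Lemma approx_unit_props n : star (approx_unit n) = approx_unit n /\ h * approx_unit n = approx_unit n * h.
Proof.
have -> : approx_unit n = 1 - S ^+ n by rewrite -approx_unitE opprB addrC subrK.
split.
  rewrite starB star1; congr (_ - _); elim: n => [|n ih]; first by rewrite star1.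
  by rewrite exprSr starM ih star_deficit -exprS exprSr.
rewrite mulrBl mulrBr mul1r mulr1; congr (_ - _); elim: n => [|n ih]; first by rewrite mulr1 mul1r.
by rewrite exprS mulrA -deficit_comm -mulrA ih mulrA.
Qed.

Lemma nrm_deficit_pow n : (0 < n)%N -> nrm (h * S ^+ n) <= Num.sqrt n%:R^-1.
Proof.
move=> n_gt0; apply: nrm_bop_le => [|v]; first exact: sqrtr_ge0.
have n0 : (0 < n%:R :> R) by rewrite ltr0n.
rewrite -(ler_pXn2r (n := 2)) ?nnegrE ?mulr_ge0 ?nrm_ge0 ?sqrtr_ge0// exprMn.
rewrite sqr_sqrtr ?invr_ge0 ?ler0n// ler_pdivlMl//; exact: deficit_pow_small.
Qed.

(** For k the n-th approximate unit, [h] and [k] commute and 4 h k is the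
    difference of the squares of h + k and h - k, so [mu (h * k)] is real; and h k
    tends to [h]. *)
Lemma state_real_contr : complex.Im (mu h) = 0.
Proof.
apply/eqP; rewrite -normr_le0; apply/ler_addgt0Pr => e e_gt0; rewrite add0r.
have [n n_gt0 ne] : exists2 n, (0 < n)%N & Num.sqrt n%:R^-1 <= e.
  exists (Num.bound (e ^+ 2)^-1).+1 => //.
  rewrite -[leRHS](ger0_norm (ltW e_gt0)) -sqrtr_sqr ler_wsqrtr//.
  rewrite -[leRHS]invrK lef_pV2 ?posrE ?invr_gt0 ?exprn_gt0 ?ltr0n//.
  apply: ltW; apply: lt_le_trans (archi_boundP _) _; first by rewrite invr_ge0 exprn_ge0// ltW.
  by rewrite ler_nat leqnSn.
have := approx_unitE n; have := approx_unit_in n; have [] := approx_unit_props n.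
move: (approx_unit n) => k sk hk Ak Sn.
have Ahk := cstarM Acs Ah Ak.
have real_hk : complex.Im (mu (h * k)) = 0.
  have E : star (h + k) * (h + k) - star (h - k) * (h - k) = 4%:R *: (h * k).
    rewrite starD starB sh sk.
    have -> : (h + k) * (h + k) = (h * h + k * k) + (h * k + h * k).
      by rewrite mulrDl !mulrDr -hk [h * k + k * k]addrC addrACA.
    have -> : (h - k) * (h - k) = (h * h + k * k) - (h * k + h * k).
      by rewrite mulrBl !mulrBr -hk opprB addrACA -opprD.
    have -> : 4%:R = 1 + 1 + (1 + 1) :> R[i] by ring.
    rewrite !scalerDl !scale1r; move: (h * h + k * k) (h * k + h * k) => p q.
    by rewrite opprB addrA -[p + q + q]addrA addrAC subrr add0r.
  have AD := cstarD Acs Ah Ak; have AB := cstarB Acs Ah Ak.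
  have := congr1 (fun z => complex.Im (mu z)) E.
  rewrite stateB ?stateZ//;
    try by apply: (cstarM Acs) => //; exact: (cstar_star Acs).
  rewrite raddfB /= !state_sqr_real// subrr => /esym.
  have -> : 4%:R = (4%:R : R)%:C :> R[i] by rewrite rmorph_nat.
  case: (mu (h * k)) => a b /=; rewrite mul0r addr0 => /eqP; rewrite mulf_eq0 pnatr_eq0 /=.
  by move/eqP.
have E2 : h * S ^+ n = h - h * k by rewrite -Sn mulrBr mulr1.
have E3 : mu h = mu (h * k) + mu (h * S ^+ n).
  by rewrite E2 (stateB Ah Ahk) addrC subrK.
rewrite E3 raddfD /= real_hk add0r; apply: (le_trans (nrm_Im _)).
apply: (@le_trans _ _ (nrm (h * S ^+ n))).
  by apply: state_le; rewrite E2; exact: (cstarB Acs).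
exact: le_trans (nrm_deficit_pow n_gt0) ne.
Qed.

End SelfAdjoint.

Lemma state_real h : A h -> star h = h -> complex.Im (mu h) = 0.
Proof.
move=> Ah sh; pose s := nrm h + 1.
have s_gt0 : 0 < s by rewrite ltr_wpDl ?nrm_ge0.
have sE : (s^-1%:C)^* = s^-1%:C :> R[i] by rewrite conj_Creal// complex_real.
have := @state_real_contr (s^-1%:C *: h) (cstarZ Acs _ Ah).
rewrite starZ sE sh nrmZ nrm_real gtr0_norm ?invr_gt0// ler_pdivrMl// mulr1.
move=> /(_ erefl); rewrite lerDl => /(_ ler01).
rewrite stateZ//; case: (mu h) => a b /=; rewrite mul0r addr0 => /eqP.
by rewrite mulf_eq0 invr_eq0 (gt_eqF s_gt0) => /eqP.
Qed.

Lemma state_star x : A x -> mu (star x) = (mu x)^*.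
Proof.
move=> Ax; have As := cstar_star Acs Ax.
have h1 : complex.Im (mu (x + star x)) = 0.
  by apply: state_real; [exact: (cstarD Acs)|rewrite starD starK addrC].
have h2 : complex.Im (mu ('i%C *: (x - star x))) = 0.
  apply: state_real; first by apply: (cstarZ Acs); exact: (cstarB Acs).
  rewrite starZ starB starK -[x - star x]opprB scalerN -scaleNr; congr (_ *: _).
  by apply/eqP; rewrite eq_complex /= oppr0 !eqxx.
move: h1 h2; rewrite stateD// stateZ ?stateB//; last exact: (cstarB Acs).
case: (mu x) (mu (star x)) => a b [a' b'] /=; rewrite mul0r mul1r add0r => h1 h2.
apply/eqP; rewrite eq_complex /=; apply/andP; split; apply/eqP; lra.
Qed.

End States.

(** The kernel and the range are orthogonal: if P u = 0 and P v = v then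
    |v| = |P (v + c u)| is at most |v + c u| for every scalar c. *)
Lemma contractive_idempotent_selfadjoint (R : realType) (H : hilbert R) (P : bop H) :
  nrm P <= 1 -> P * P = P -> star P = P.
Proof.
move=> P1 PP.
have orth u v : P u = 0 -> P v = v -> dot u v = 0.
  move=> Pu Pv; have key (c : R[i]) : nrm v ^+ 2 <= nrm (v + c *: u) ^+ 2.
    rewrite lerXn2r ?nnegrE ?nrm_ge0//.
    have -> : nrm v = nrm (P (v + c *: u)) by rewrite bopD bopZ Pu scaler0 addr0 Pv.
    by apply: (le_trans (bop_nrm_le _ _)); rewrite ler_piMl ?nrm_ge0.
  pose d := dot u v; pose t := (nrm u ^+ 2 + 1)^-1.
  have u1 : 0 < nrm u ^+ 2 + 1 by rewrite ltr_wpDl ?sqr_ge0.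
  have t_gt0 : 0 < t by rewrite invr_gt0.
  have tu : t * nrm u ^+ 2 <= 1 by rewrite mulrC ler_pdivrMr// mul1r lerDl.
  have := key (- t%:C * d^*); rewrite nrm_sqrD nrmZ dotC dotZl -/d.
  have -> : - t%:C * d^* * d = (- t * nrm d ^+ 2)%:C.
    by rewrite -mulrA [d^* * d]mulrC -normCK nrmE rmorphM rmorphN rmorphXn.
  rewrite nrmM nrmN nrm_real gtr0_norm// nrm_conj !exprMn.
  rewrite [((_)%:C)^*]conj_Creal ?complex_real//= => h.
  apply: nrm_eq0; apply/eqP; rewrite -sqrf_eq0 eq_le sqr_ge0 andbT.
  have d0 := sqr_ge0 (nrm d).
  have h3 : t ^+ 2 * nrm d ^+ 2 * nrm u ^+ 2 = t * nrm d ^+ 2 * (t * nrm u ^+ 2) by ring.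
  have h4 : t * nrm d ^+ 2 * (t * nrm u ^+ 2) <= t * nrm d ^+ 2 * 1.
    by rewrite ler_wpM2l// mulr_ge0// ltW.
  have : t * nrm d ^+ 2 <= 0 by lra.
  by rewrite pmulr_rle0.
apply: bop_dotP => u v; rewrite starE.
have h1 : dot u (P v) = dot (P u) (P v).
  apply/eqP; rewrite -subr_eq0 -dotBl; apply/eqP/orth; last by rewrite -mul_bopE PP.
  by rewrite bopD -scaleN1r bopZ scaleN1r -mul_bopE PP subrr.
have h2 : dot (P u) v = dot (P u) (P v).
  apply/eqP; rewrite -subr_eq0 -dotBr dotC conjC_eq0; apply/eqP/orth; last by rewrite -mul_bopE PP.
  by rewrite bopD -scaleN1r bopZ scaleN1r -mul_bopE PP subrr.
by rewrite h1 h2.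
Qed.

(** * Slices approximated by finite tensors, under amplification *)

Section Associativity.
Variables (R : realType) (K0 K H : hilbert R).
Variables (K2 : htensor K0 K) (T : htensor K H) (T3 : htensor K2 H).

Lemma dot_tns3_ext (w w' : T3) :
  (forall f v u, dot w (tns T3 (tns K2 f v) u) = dot w' (tns T3 (tns K2 f v) u)) -> w = w'.
Proof.
move=> h; apply: dot_tns_extl => z u; rewrite dotC [RHS]dotC; congr (_^*).
apply: (@tns_ext _ _ _ K2 R[i] (fun z => dot (tns T3 z u) w) (fun z => dot (tns T3 z u) w')
   (nrm u * nrm w) (nrm u * nrm w')) => [c z1 z2|c z1 z2|z1|z1|f v].
- by rewrite tns_linl dotPl.
- by rewrite tns_linl dotPl.
- by apply: (le_trans (nrm_dot _ _)); rewrite nrm_tns mulrC [X in _ <= X]mulrC mulrA [nrm z1 * _]mulrC mulrC mulrA.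
- by apply: (le_trans (nrm_dot _ _)); rewrite nrm_tns mulrC [X in _ <= X]mulrC mulrA [nrm z1 * _]mulrC mulrC mulrA.
- by rewrite dotC h -dotC.
Qed.

Lemma assoc_exists (f : K0) : exists L : T -> T3, [/\ linear L,
  forall v u, L (tns T v u) = tns T3 (tns K2 f v) u & forall w, nrm (L w) <= nrm f * nrm w].
Proof.
have [|||L [Llin Lt Ln]] := @ext_linear R T T3 (K * H)%type
  (fun p => tns T p.1 p.2) (fun p => tns T3 (tns K2 f p.1) p.2) (nrm f).
- exact: tns_totalP.
- exact: nrm_ge0.
- move=> l; rewrite le_eqVlt; apply/orP; left.
  rewrite -(@eqrXn2 _ 2) ?mulr_ge0 ?nrm_ge0// exprMn -!Re_dotvv.
  have -> : complex.Re (dot f f) * complex.Re (dot (comb (fun p => tns T p.1 p.2) l) (comb (fun p => tns T p.1 p.2) l))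
     = complex.Re (dot f f * dot (comb (fun p => tns T p.1 p.2) l) (comb (fun p => tns T p.1 p.2) l)).
    by rewrite !dotvv -rmorphM.
  apply/eqP; congr complex.Re; rewrite /comb !dot_suml mulr_sumr; apply: eq_bigr => p _.
  rewrite !dot_sumr mulr_sumr; apply: eq_bigr => q _.
  by rewrite !dotZl !dotZr !dot_tns; ring.
by exists L; split => // v u; rewrite (Lt (v, u)).
Qed.

(** The map v (x) u |-> (f (x) v) (x) u. *)
Definition assoc_tns (f : K0) : T -> T3 := projT1 (cid (assoc_exists f)).

Lemma assoc_tnsE f v u : assoc_tns f (tns T v u) = tns T3 (tns K2 f v) u.
Proof. by rewrite /assoc_tns; case: cid => L []. Qed.

Lemma assoc_tns_lin f : linear (assoc_tns f).
Proof. by rewrite /assoc_tns; case: cid => L []. Qed.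

Lemma assoc_tns_le f w : nrm (assoc_tns f w) <= nrm f * nrm w.
Proof. by rewrite /assoc_tns; case: cid => L []. Qed.

Lemma dot_assoc_tns f t f' v u : dot (assoc_tns f t) (tns T3 (tns K2 f' v) u) = dot f f' * dot t (tns T v u).
Proof.
pose C := nrm (tns T3 (tns K2 f' v) u); pose D := nrm (dot f f') * nrm (tns T v u).
apply: (@tns_ext _ _ _ T R[i] (fun t => dot (assoc_tns f t) (tns T3 (tns K2 f' v) u))
  (fun t => dot f f' * dot t (tns T v u)) (nrm f * C) D) => [c w w'|c w w'|w|w|v' u'].
- by rewrite assoc_tns_lin dotPl.
- by rewrite dotPl mulrDr mulrCA.
- apply: (le_trans (nrm_dot _ _)); rewrite -/C mulrAC ler_wpM2r ?nrm_ge0//; exact: assoc_tns_le.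
- by rewrite nrmM /D -mulrA ler_wpM2l ?nrm_ge0// mulrC nrm_dot.
- by rewrite assoc_tnsE !dot_tns; ring.
Qed.

Lemma assoc_linl t : linear (assoc_tns^~ t).
Proof.
move=> c f f'; apply: dot_tns3_ext => g v u.
by rewrite dotPl !dot_assoc_tns dotPl mulrDl mulrA.
Qed.

Lemma dot_assoc_tns2 f f' t t' : dot (assoc_tns f t) (assoc_tns f' t') = dot f f' * dot t t'.
Proof.
rewrite dotC (dotC f) (dotC t) -rmorphM; congr (_^*).
pose C := nrm (assoc_tns f t).
apply: (@tns_ext _ _ _ T R[i] (fun t' => dot (assoc_tns f' t') (assoc_tns f t))
  (fun t' => dot f' f * dot t' t) (nrm f' * C) (nrm (dot f' f) * nrm t)) => [c w w'|c w w'|w|w|v' u'].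
- by rewrite assoc_tns_lin dotPl.
- by rewrite dotPl mulrDr mulrCA.
- apply: (le_trans (nrm_dot _ _)); rewrite -/C mulrAC ler_wpM2r ?nrm_ge0//; exact: assoc_tns_le.
- by rewrite nrmM -mulrA ler_wpM2l ?nrm_ge0// mulrC nrm_dot.
- by rewrite assoc_tnsE dotC dot_assoc_tns rmorphM /= -!dotC.
Qed.

Lemma assoc_total : closure (lspan [set w | exists f t, w = assoc_tns f t]) = [set: T3].
Proof.
apply: orth_total => y hy; apply: dot_tns3_ext => f v u; rewrite dot0l dotC.
by rewrite hy ?conjC0//; exists f, (tns T v u); rewrite assoc_tnsE.
Qed.

(** The Hilbert space of (K0 (x) K) (x) H is also a tensor product of [K0] and
    K (x) H; results on second legs thereby apply to the legs 2 and 3. *)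
Definition assoc_tensor : htensor K0 T :=
  @HTensor R K0 T T3 assoc_tns assoc_linl assoc_tns_lin dot_assoc_tns2 assoc_total.

(** The operator v |-> X (c v (x) xi) from [K] to K (x) H is a norm limit of finite
    sums v |-> sum_j b_j v (x) zeta_j. *)
Definition slice_approx (X : bop T) (c : bop K) (xi : H) := forall e : R, 0 < e ->
  exists l : seq (bop K * H), forall v,
    nrm (X (tns T (c v) xi) - \sum_(p <- l) tns T (p.1 v) p.2) <= e * nrm v.

Lemma selfadjoint_projection_le (Q : bop T3) v : star Q = Q -> Q * Q = Q -> nrm (Q v) <= nrm v.
Proof.
move=> sQ QQ; have [q0|q0] := eqVneq (nrm (Q v)) 0; first by rewrite q0 nrm_ge0.
have q_gt0 : 0 < nrm (Q v) by rewrite lt_neqAle eq_sym q0 nrm_ge0.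
rewrite -(ler_pM2l q_gt0) -expr2 -Re_dotvv -{1}sQ starE -mul_bopE QQ.
rewrite Re_dotC; apply: (le_trans (ler_norm _)); apply: (le_trans (nrm_Re _)); exact: nrm_dot.
Qed.

(** Amplification does not increase the norm, so v |-> X (c v (x) xi) may be replaced
    by a finite sum on the legs 2 and 3. A projection [E] fixing its vectors
    zeta_j annihilates that sum through 1 - E, whatever [E] is. *)
Lemma slice_approx_leg23 (X : bop T) c xi (Z : bop T3) (e : R) :
  slice_approx X c xi -> is_leg23 X Z -> 0 < e ->
  exists l : seq (bop K * H), forall E : bop H, star E = E -> E * E = E ->
    (forall p, p \in l -> E p.2 = p.2) ->
    forall z, nrm ((1 - tensor_op T3 1 E) (Z (tns T3 (tensor_op K2 1 c z) xi))) <= e * nrm z.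
Proof.
move=> Xapp ZX e_gt0; have [l hl] := Xapp e e_gt0.
exists l => E sE EE El z.
pose Y v := X (tns T (c v) xi) - \sum_(p <- l) tns T (p.1 v) p.2.
have Ylin : linear Y.
  move=> a u v; rewrite /Y bop_linear tns_linl bop_linear scalerBr.
  have -> : \sum_(p <- l) tns T (p.1 (a *: u + v)) p.2 =
    a *: \sum_(p <- l) tns T (p.1 u) p.2 + \sum_(p <- l) tns T (p.1 v) p.2.
    rewrite scaler_sumr -big_split; apply: eq_bigr => p _ /=.
    by rewrite bop_linear tns_linl.
  by rewrite opprD addrACA.
have [L [Llin Lt Ln]] := amplify K2 assoc_tensor Ylin (ltW e_gt0) hl.
pose F z := Z (tns T3 (tensor_op K2 1 c z) xi) - \sum_(p <- l) tns T3 (tensor_op K2 1 p.1 z) p.2.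
have LF w : L w = F w.
  pose D := nrm Z * (nrm (tensor_op K2 1 c) * nrm xi) + \sum_(p <- l) nrm (tensor_op K2 1 p.1) * nrm p.2.
  apply: (@tns_ext _ _ _ K2 T3 L F e D) => [||w'|w'|f v] //.
  - move=> a u v; rewrite /F bop_linear tns_linl bop_linear scalerBr.
    have -> : \sum_(p <- l) tns T3 (tensor_op K2 1 p.1 (a *: u + v)) p.2 =
      a *: \sum_(p <- l) tns T3 (tensor_op K2 1 p.1 u) p.2 + \sum_(p <- l) tns T3 (tensor_op K2 1 p.1 v) p.2.
      rewrite scaler_sumr -big_split; apply: eq_bigr => p _ /=.
      by rewrite bop_linear tns_linl.
    by rewrite opprD addrACA.
  - apply: (le_trans (nrmB _ _)); rewrite /D mulrDl; apply: lerD.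
      apply: (le_trans (bop_nrm_le _ _)); rewrite -mulrA ler_wpM2l ?nrm_ge0// nrm_tns.
      by rewrite mulrAC ler_wpM2r ?nrm_ge0 ?bop_nrm_le.
    apply: (le_trans (nrm_sum _ _ _)); rewrite mulr_suml; apply: ler_sum => p _.
    by rewrite nrm_tns mulrAC ler_wpM2r ?nrm_ge0 ?bop_nrm_le.
  rewrite Lt /F tensor_opE one_bopE /=.
  have -> : assoc_tns f (Y v) = assoc_tns f (X (tns T (c v) xi)) - \sum_(p <- l) tns T3 (tns K2 f (p.1 v)) p.2.
    have aD u u' : assoc_tns f (u + u') = assoc_tns f u + assoc_tns f u'.
      by rewrite -[u]scale1r assoc_tns_lin !scale1r.
    have a0 : assoc_tns f 0 = 0.
      by apply: (addrI (assoc_tns f 0)); rewrite -aD !addr0.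
    rewrite /Y -scaleN1r addrC assoc_tns_lin scaleN1r addrC (big_morph _ aD a0); congr (_ - _).
    by apply: eq_bigr => p _; rewrite assoc_tnsE.
  congr (_ - _).
    apply: dot_tns3_ext => f' v' u'.
    by rewrite dot_assoc_tns ZX.
  by apply: eq_bigr => p _; rewrite tensor_opE one_bopE.
have -> : (1 - tensor_op T3 1 E) (Z (tns T3 (tensor_op K2 1 c z) xi)) = (1 - tensor_op T3 1 E) (L z).
  rewrite LF /F; set W := Z _; set S := \sum_(p <- l) _.
  have S0 : (1 - tensor_op T3 1 E) S = 0.
    have b0 := bop0 (1 - tensor_op T3 1 E); have bD := bopD (1 - tensor_op T3 1 E).
    rewrite /S (big_morph _ bD b0) big_seq big1// => p pl.
    by rewrite sub_bopE tensor_opE !one_bopE El// subrr.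
  by rewrite bopB S0 subr0.
apply: le_trans (Ln z); apply: selfadjoint_projection_le.
  by rewrite starB star1 star_tensor_op star1 sE.
by rewrite mulrBl mul1r mulrBr mulr1 tensor_opM EE mulr1 subrr subr0.
Qed.

End Associativity.

Lemma slice_approx_leg13 (R : realType) (K0 K H : hilbert R) (K2 : htensor K K0) (T : htensor K H)
    (T3 : htensor K2 H) (X : bop T) c xi (Z : bop T3) (e : R) :
  slice_approx X c xi -> is_leg13 X Z -> 0 < e ->
  exists l : seq (bop K * H), forall E : bop H, star E = E -> E * E = E ->
    (forall p, p \in l -> E p.2 = p.2) ->
    forall z, nrm ((1 - tensor_op T3 1 E) (Z (tns T3 (tensor_op K2 c 1 z) xi))) <= e * nrm z.
Proof.
move=> Xapp ZX e_gt0.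
have ZX' : @is_leg23 R K0 K H (swap_tensor K2) T T3 X Z.
  by move=> u u' v v' w w' /=; rewrite ZX mulrC.
have [l hl] := slice_approx_leg23 (K2 := swap_tensor K2) (T3 := T3) Xapp ZX' e_gt0.
exists l => E sE EE El z.
suff -> : tensor_op K2 c 1 = tensor_op (swap_tensor K2) 1 c by exact: hl.
by apply/esym/tensor_op_unique => u v; rewrite (tensor_opE (swap_tensor K2) 1 c v u).
Qed.

(** * Slices by normal functionals *)

Section Slices.
Variables (R : realType).

Lemma cvg_nrmP (V : normedModType R[i]) (f : nat -> V) (l : V) :
  f @ \oo --> l <-> forall e : R, 0 < e -> exists N, forall n, (N <= n)%N -> nrm (f n - l) < e.
Proof.
split=> [/cvgrPdist_lt h e e_gt0|h].
  have := h e%:C; rewrite ltcR => /(_ e_gt0)[N _ hN].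
  by exists N => n /hN /=; rewrite nrm_lt nrmBC.
apply/cvgrPdist_lt => e /gt0_real_complex[r r_gt0 ->].
have [N hN] := h r r_gt0; exists N => // n /= /hN.
by rewrite nrm_lt nrmBC.
Qed.

Lemma cvg_series_single (V : normedModType R[i]) (f : nat -> V) :
  (forall n, f n.+1 = 0) -> series f @ \oo --> f 0%N.
Proof.
move=> f0; apply/cvg_nrmP => e e_gt0; exists 1%N => -[//|n] _.
rewrite /series /= big_mkord big_ord_recl /= big1 => [|i _]; last exact: f0.
by rewrite addr0 subrr nrm0.
Qed.

Lemma nrm_of_form (H : hilbert R) (x : bop H) (C : R) : 0 <= C ->
  (forall u v, nrm (dot (x u) v) <= C * nrm u * nrm v) -> nrm x <= C.
Proof.
move=> C0 h; apply: nrm_bop_le => // v.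
have [q0|q0] := eqVneq (nrm (x v)) 0; first by rewrite q0 mulr_ge0 ?nrm_ge0.
have q_gt0 : 0 < nrm (x v) by rewrite lt_neqAle eq_sym q0 nrm_ge0.
rewrite -(ler_pM2r q_gt0) -expr2; apply: le_trans (h v (x v)).
by rewrite dotvv nrm_real ger0_norm ?sqr_ge0.
Qed.

Section Vector.
Variable H : hilbert R.

Definition at0 (xi : H) (n : nat) : H := if n is 0%N then xi else 0.

Lemma at0_summable xi : cvgn (series (fun n => `|at0 xi n| ^+ 2 : R[i])).
Proof.
apply/cvg_ex; exists (`|at0 xi 0%N| ^+ 2 : R[i]); apply: cvg_series_single => n.
by rewrite normr0 expr0n.
Qed.

Definition vector_fun (xi eta : H) : Defs.normal_fun H :=
  NormalFun (@at0_summable xi) (@at0_summable eta).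

Lemma summable_tail (xs : nat -> H) : cvgn (series (fun n => `|xs n| ^+ 2 : R[i])) ->
  forall e : R, 0 < e -> exists N0, forall N M, (N0 <= N)%N -> (N <= M)%N ->
    \sum_(N <= n < M) nrm (xs n) ^+ 2 <= e.
Proof.
move=> /cvg_ex[l /cvg_nrmP h] e e_gt0.
have [N0 hN0] := h (e / 2) ltac:(by rewrite divr_gt0).
exists N0 => N M hN NM; have h1 := hN0 N hN; have h2 := hN0 M (leq_trans hN NM).
set s := series _ in h1 h2.
have E : s M - s N = (\sum_(N <= n < M) nrm (xs n) ^+ 2)%:C.
  rewrite /s sub_series_geq// rmorph_sum; apply: eq_bigr => n _.
  by rewrite nrmE rmorphXn.
have := nrm_dist l (s M) (s N); rewrite E nrm_real ger0_norm ?sumr_ge0// => [|n _]; last exact: sqr_ge0.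
rewrite [nrm (l - _)]nrmBC; lra.
Qed.

End Vector.

Section Slice.
Variables (H K : hilbert R) (T : htensor H K).

Lemma rslice_vector (X : bop T) xi eta : is_rslice (vector_fun xi eta) X (slice X xi eta).
Proof.
move=> u u'; rewrite sliceE.
apply: (@cvg_series_single R[i] (fun n => dot (X (tns T u (at0 xi n))) (tns T u' (at0 eta n)))) => n.
by rewrite /= tns0r bop0 dot0l.
Qed.

Lemma rslice_vector_dot (X : bop T) xi eta y : is_rslice (vector_fun xi eta) X y ->
  forall u u', dot (y u) u' = dot (X (tns T u xi)) (tns T u' eta).
Proof.
move=> h u u'; have h1 := h u u'.
have h2 := @rslice_vector X xi eta u u'; rewrite sliceE in h2.
exact: (cvg_unique (@norm_hausdorff _ _) h1 h2).
Qed.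

(** The tail of the series is bounded, as a form, by the tails of the two square
    summable sequences; so the slices converge in norm. *)
Lemma rslice_limit om (X : bop T) y : is_rslice om X y ->
  forall e : R, 0 < e -> exists N0, forall N, (N0 <= N)%N ->
    nrm (y - \sum_(0 <= n < N) slice X (nl om n) (nr om n)) <= e.
Proof.
move=> hy e e_gt0; pose K1 := nrm X + 1.
have K1_gt0 : 0 < K1 by rewrite ltr_wpDl ?nrm_ge0.
have e1_gt0 : 0 < e / 2 / K1 by rewrite !divr_gt0.
have [N1 hN1] := summable_tail (@nl_summable _ _ om) e1_gt0.
have [N2 hN2] := summable_tail (@nr_summable _ _ om) e1_gt0.
exists (N1 + N2)%N => N hN; apply: nrm_of_form => [|u u']; first exact: ltW.
set a := fun n => dot (X (tns T u (nl om n))) (tns T u' (nr om n)).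
have /cvg_nrmP ha : series a @ \oo --> (dot (y u) u' : R[i]) by exact: hy.
have E : dot ((y - \sum_(0 <= n < N) slice X (nl om n) (nr om n)) u) u' = dot (y u) u' - series a N.
  rewrite sub_bopE dotBl; congr (_ - _).
  have -> : (\sum_(0 <= n < N) slice X (nl om n) (nr om n)) u
     = \sum_(0 <= n < N) slice X (nl om n) (nr om n) u.
    by apply: (big_morph (fun z : bop H => z u)) => [x z|]; [exact: add_bopE|exact: zero_bopE].
  by rewrite dot_suml; apply: eq_bigr => n _; rewrite sliceE.
rewrite E; apply/ler_addgt0Pr => e' e'_gt0.
have [M0 hM0] := ha e' e'_gt0; pose M := (N + M0)%N.
have hM := hM0 M (leq_addl _ _).
have NM : (N <= M)%N := leq_addr _ _.
have S : nrm (series a M - series a N) <= e * nrm u * nrm u'.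
  rewrite sub_series_geq//; apply: (le_trans (nrm_sum _ _ _)).
  apply: (@le_trans _ _ (\sum_(N <= n < M) K1 * (nrm u * nrm u') * (nrm (nl om n) ^+ 2 + nrm (nr om n) ^+ 2))).
    apply: ler_sum => n _; apply: (le_trans (nrm_dot _ _)); rewrite nrm_tns.
    have h1 : nrm (X (tns T u (nl om n))) <= K1 * (nrm u * nrm (nl om n)).
      apply: (le_trans (bop_nrm_le _ _)); rewrite nrm_tns ler_wpM2r ?mulr_ge0 ?nrm_ge0//.
      by rewrite /K1 lerDl.
    have h2 : nrm (nl om n) * nrm (nr om n) <= nrm (nl om n) ^+ 2 + nrm (nr om n) ^+ 2.
      have := sqr_ge0 (nrm (nl om n) - nrm (nr om n)); rewrite sqrrB.
      have := sqr_ge0 (nrm (nl om n)); have := sqr_ge0 (nrm (nr om n)); lra.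
    apply: (@le_trans _ _ (K1 * (nrm u * nrm (nl om n)) * (nrm u' * nrm (nr om n)))).
      by rewrite ler_wpM2r ?mulr_ge0 ?nrm_ge0.
    have -> : K1 * (nrm u * nrm (nl om n)) * (nrm u' * nrm (nr om n))
       = K1 * (nrm u * nrm u') * (nrm (nl om n) * nrm (nr om n)) by ring.
    by rewrite ler_wpM2l ?mulr_ge0 ?nrm_ge0 ?(ltW K1_gt0).
  rewrite -mulr_sumr big_split /=.
  have h1 := hN1 N M (leq_trans (leq_addr _ _) hN) NM.
  have h2 := hN2 N M (leq_trans (leq_addl _ _) hN) NM.
  have u0 : 0 <= nrm u * nrm u' by rewrite mulr_ge0 ?nrm_ge0.
  have -> : e * nrm u * nrm u' = K1 * (nrm u * nrm u') * (e / 2 / K1 + e / 2 / K1).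
    by field; rewrite gt_eqF.
  by apply: ler_wpM2l; [rewrite mulr_ge0 ?(ltW K1_gt0)|exact: lerD].
have := nrm_dist (series a M) (dot (y u) u') (series a N).
rewrite [nrm (dot _ _ - series a M)]nrmBC; lra.
Qed.

End Slice.
End Slices.

(** * Minimal tensor products and the dual algebra *)

Section MinTensor.
Variables (R : realType) (H K : hilbert R) (T : htensor H K).
Variables (A : set (bop H)) (B : set (bop K)).

Lemma min_tensor_lin c x y : min_tensor T A B x -> min_tensor T A B y ->
  min_tensor T A B (c *: x + y).
Proof. by apply: closure_lin => a u v; exact: lspan_lin. Qed.

(** The form of induction used for all statements on the minimal tensor product. *)
Lemma min_tensor_sub (S : set (bop T)) : closed S -> S 0 ->
  (forall c x y, S x -> S y -> S (c *: x + y)) ->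
  (forall x y, A x -> B y -> S (tensor_op T x y)) -> min_tensor T A B `<=` S.
Proof.
move=> Scl S0 Slin Sel; apply: closure_sub => //; apply: lspan_sub => //.
by move=> z [x [y [Ax By /tensor_op_unique ->]]]; exact: Sel.
Qed.

Lemma min_tensor_op x y : A x -> B y -> min_tensor T A B (tensor_op T x y).
Proof.
by move=> Ax By; apply/subset_closure/lspan_gen; exists x, y; split => //; exact: tensor_opP.
Qed.

Lemma min_tensor0 : min_tensor T A B 0.
Proof. exact/subset_closure/lspan0. Qed.

Lemma closed_preim_mull (S : set (bop T)) y : closed S -> closed [set x | S (x * y)].
Proof.
move=> Scl x /closure_nrmP hx; apply: Scl; apply/closure_nrmP => e e_gt0.
have y1 : 0 < nrm y + 1 by rewrite ltr_wpDl ?nrm_ge0.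
have [x' Sx' xx'] := hx (e / (nrm y + 1)) ltac:(by rewrite divr_gt0).
exists (x' * y) => //; rewrite -mulrBl; apply: (le_lt_trans (nrm_bopM _ _)).
apply: (@le_lt_trans _ _ (e / (nrm y + 1) * nrm y)).
  by rewrite ler_wpM2r ?nrm_ge0// ltW.
by rewrite mulrAC ltr_pdivrMr// ltr_pM2l// ltrDl.
Qed.

Lemma closed_preim_mulr (S : set (bop T)) y : closed S -> closed [set x | S (y * x)].
Proof.
move=> Scl x /closure_nrmP hx; apply: Scl; apply/closure_nrmP => e e_gt0.
have y1 : 0 < nrm y + 1 by rewrite ltr_wpDl ?nrm_ge0.
have [x' Sx' xx'] := hx (e / (nrm y + 1)) ltac:(by rewrite divr_gt0).
exists (y * x') => //; rewrite -mulrBr; apply: (le_lt_trans (nrm_bopM _ _)).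
apply: (@le_lt_trans _ _ (nrm y * (e / (nrm y + 1)))).
  by rewrite ler_wpM2l ?nrm_ge0// ltW.
by rewrite mulrC mulrAC ltr_pdivrMr// ltr_pM2l// ltrDl.
Qed.

Lemma bop_scaleMl c (x y : bop T) : (c *: x) * y = c *: (x * y).
Proof. by apply: bopP => v; rewrite !(mul_bopE, scale_bopE). Qed.

Lemma bop_scaleMr c (x y : bop T) : x * (c *: y) = c *: (x * y).
Proof. by apply: bopP => v; rewrite !(mul_bopE, scale_bopE) bopZ. Qed.

Lemma min_tensorM x y : (forall a a', A a -> A a' -> A (a * a')) ->
  (forall b b', B b -> B b' -> B (b * b')) ->
  min_tensor T A B x -> min_tensor T A B y -> min_tensor T A B (x * y).
Proof.
move=> AM BM xT yT.
have cl := @closed_closure _ (lspan (@elementary R H K T A B)).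
apply: (min_tensor_sub (S := [set y | min_tensor T A B (x * y)]) _ _ _ _ yT) => [|||a b Aa Bb] /=.
- exact: closed_preim_mulr.
- rewrite mulr0; exact: min_tensor0.
- by move=> c z z' hz hz'; rewrite mulrDr bop_scaleMr; exact: min_tensor_lin.
apply: (min_tensor_sub (S := [set x | min_tensor T A B (x * tensor_op T a b)]) _ _ _ _ xT) => [|||a' b' Aa' Bb'] /=.
- exact: closed_preim_mull.
- rewrite mul0r; exact: min_tensor0.
- by move=> c z z' hz hz'; rewrite mulrDl bop_scaleMl; exact: min_tensor_lin.
by rewrite tensor_opM; apply: min_tensor_op; [exact: AM|exact: BM].
Qed.

Definition finite_slice (s : bop T) (xi : K) := exists l : seq (bop H * K),
  forall v, s (tns T v xi) = \sum_(p <- l) tns T (p.1 v) p.2.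

Lemma finite_slice_lin c s s' xi : finite_slice s xi -> finite_slice s' xi ->
  finite_slice (c *: s + s') xi.
Proof.
move=> [l hl] [l' hl']; exists ([seq (p.1, c *: p.2) | p <- l] ++ l') => v.
rewrite add_bopE scale_bopE hl hl' big_cat big_map scaler_sumr; congr (_ + _).
by apply: eq_bigr => p _; rewrite tnsZr.
Qed.

Lemma finite_slice0 xi : finite_slice 0 xi.
Proof. by exists [::] => v; rewrite zero_bopE big_nil. Qed.

Lemma finite_slice_tensor x y xi : finite_slice (tensor_op T x y) xi.
Proof. by exists [:: (x, y xi)] => v; rewrite tensor_opE big_seq1. Qed.

(** Both properties hold for finite sums of elementary tensors and pass to norm
    limits. *)
Lemma min_tensor_approx Y xi : min_tensor T A B Y ->
  (forall e : R, 0 < e -> exists l : seq (bop H * K), forall v,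
    nrm (Y (tns T v xi) - \sum_(p <- l) tns T (p.1 v) p.2) <= e * nrm v) /\
  (forall e : R, 0 < e -> exists l : seq (bop H * K), forall v,
    nrm (star Y (tns T v xi) - \sum_(p <- l) tns T (p.1 v) p.2) <= e * nrm v).
Proof.
have approx (X s : bop T) (e : R) : 0 < e -> nrm (s - X) < e / (nrm xi + 1) -> finite_slice s xi ->
    exists l : seq (bop H * K), forall v,
    nrm (X (tns T v xi) - \sum_(p <- l) tns T (p.1 v) p.2) <= e * nrm v.
  move=> e_gt0 sX [l hl]; exists l => v.
  have x1 : 0 < nrm xi + 1 by rewrite ltr_wpDl ?nrm_ge0.
  rewrite -hl -sub_bopE -nrmN -opp_bopE opprB; apply: (le_trans (bop_nrm_le _ _)).
  rewrite nrm_tns mulrCA mulrC ler_wpM2r ?nrm_ge0//.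
  apply: (@le_trans _ _ (e / (nrm xi + 1) * (nrm xi + 1))); last by rewrite divfK ?gt_eqF.
  by apply: ler_pM; rewrite ?nrm_ge0 ?(ltW sX)// lerDl.
have el s : lspan (@elementary R H K T A B) s -> finite_slice s xi /\ finite_slice (star s) xi.
  apply: (@lspan_sub _ _ (@elementary R H K T A B) [set s | finite_slice s xi /\ finite_slice (star s) xi]).
  - by rewrite /= star0; split; exact: finite_slice0.
  - move=> c s1 s2 [h1 h2] [h1' h2']; split; first exact: finite_slice_lin.
    by rewrite starD starZ; exact: finite_slice_lin.
  - move=> _ [x [y [_ _ /tensor_op_unique ->]]]; split; first exact: finite_slice_tensor.
    by rewrite star_tensor_op; exact: finite_slice_tensor.
have x1 : 0 < nrm xi + 1 by rewrite ltr_wpDl ?nrm_ge0.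
move=> /closure_nrmP hY; split=> e e_gt0;
  have [s /el[s1 s2] sY] := hY (e / (nrm xi + 1)) ltac:(by rewrite divr_gt0).
  exact: approx sY s1.
by apply: (approx _ (star s)) => //; rewrite -starB nrm_star.
Qed.

Lemma slice_approx_total (X : bop T) (c : bop H) (S : set K) : total_in S ->
  (forall xi, S xi -> slice_approx X c xi) -> forall xi, slice_approx X c xi.
Proof.
move=> Stot SX xi.
have h xi' : lspan S xi' -> slice_approx X c xi'.
  apply: (@lspan_sub _ _ S [set xi | slice_approx X c xi]) => //= [e e_gt0|a x y hx hy e e_gt0].
    by exists [::] => v; rewrite big_nil tns0r bop0 subr0 nrm0 mulr_ge0 ?nrm_ge0// ltW.
  have a1 : 0 < nrm a + 1 by rewrite ltr_wpDl ?nrm_ge0.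
  have [l hl] := hx (e / 2 / (nrm a + 1)) ltac:(by rewrite !divr_gt0).
  have [l' hl'] := hy (e / 2) ltac:(by rewrite divr_gt0).
  exists ([seq (p.1, a *: p.2) | p <- l] ++ l') => v.
  have -> : X (tns T (c v) (a *: x + y)) - \sum_(p <- [seq (p.1, a *: p.2) | p <- l] ++ l') tns T (p.1 v) p.2
     = a *: (X (tns T (c v) x) - \sum_(p <- l) tns T (p.1 v) p.2)
       + (X (tns T (c v) y) - \sum_(p <- l') tns T (p.1 v) p.2).
    rewrite tns_linr bop_linear big_cat big_map /=.
    under eq_bigr => p _ do rewrite tnsZr.
    by rewrite -scaler_sumr opprD addrACA -scalerBr.
  apply: (le_trans (nrmD _ _)); rewrite nrmZ.
  have h1 : nrm a * nrm (X (tns T (c v) x) - \sum_(p <- l) tns T (p.1 v) p.2) <= e / 2 * nrm v.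
    apply: (@le_trans _ _ ((nrm a + 1) * (e / 2 / (nrm a + 1) * nrm v))).
      by apply: ler_pM; rewrite ?nrm_ge0 ?lerDl.
    by rewrite mulrA [_ * (_ / _)]mulrC divfK ?gt_eqF.
  have := hl' v; lra.
move=> e e_gt0.
pose M := nrm X * nrm c + 1.
have M1 : 0 < M by rewrite ltr_wpDl ?mulr_ge0 ?nrm_ge0.
have : closure (lspan S) xi by rewrite Stot.
move=> /closure_nrmP/(_ (e / 2 / M))[|xi' Sxi' hxi]; first by rewrite !divr_gt0.
have [l hl] := h xi' Sxi' (e / 2) ltac:(by rewrite divr_gt0).
exists l => v.
apply: (le_trans (nrm_dist (X (tns T (c v) xi')) _ _)).
have h1 : nrm (X (tns T (c v) xi) - X (tns T (c v) xi')) <= e / 2 * nrm v.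
  rewrite -bopB -tnsBr; apply: (le_trans (bop_nrm_le _ _)); rewrite nrm_tns [nrm (xi - _)]nrmBC.
  have h2 : nrm (c v) * nrm (xi' - xi) <= (nrm c * nrm v) * (e / 2 / M).
    by apply: ler_pM; rewrite ?nrm_ge0 ?bop_nrm_le// ltW.
  apply: (@le_trans _ _ (nrm X * ((nrm c * nrm v) * (e / 2 / M)))).
    by rewrite ler_wpM2l ?nrm_ge0.
  have -> : nrm X * ((nrm c * nrm v) * (e / 2 / M)) = (nrm X * nrm c) * (e / 2 / M * nrm v) by ring.
  have k0 : 0 <= e / 2 / M * nrm v by rewrite mulr_ge0 ?nrm_ge0// ltW// !divr_gt0.
  apply: (@le_trans _ _ (M * (e / 2 / M * nrm v))).
    by rewrite ler_wpM2r// /M lerDl.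
  by rewrite mulrA [M * _]mulrC divfK ?gt_eqF.
have := hl v; lra.
Qed.

End MinTensor.

Lemma unitary_inj (R : realType) (H : hilbert R) (x : bop H) v : unitary x -> x v = 0 -> v = 0.
Proof. by move=> [xx _] xv; rewrite -[v]one_bopE -xx mul_bopE xv bop0. Qed.

Lemma unitary_star (R : realType) (H : hilbert R) (x : bop H) : unitary x -> unitary (star x).
Proof. by move=> [h1 h2]; split; rewrite starK. Qed.

Lemma nrm_unitary (R : realType) (H : hilbert R) (x : bop H) : unitary x -> nrm x <= 1.
Proof.
move=> [xx _]; apply: nrm_le1 => v.
by rewrite xx one_bopE Re_dotvv.
Qed.

Section DualTotal.
Variables (R : realType) (G : lcqg R).

(** (om (x) id)(kac G) for a vector functional om; these elements of C_0(G^) suffice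
    to see that it acts nondegenerately. *)
Definition dual_slice (u u' : L2 G) : bop (L2 G) := @slice R _ _ (swap_tensor (L2_2 G)) (kac G) u u'.

Lemma dual_sliceE u u' v v' :
  dot (dual_slice u u' v) v' = dot (kac G (tns (L2_2 G) u v)) (tns (L2_2 G) u' v').
Proof. exact: (@sliceE R _ _ (swap_tensor (L2_2 G))). Qed.

Lemma dual_slice_in u u' : C0_dual G (dual_slice u u').
Proof.
apply: subset_closure; exists (vector_fun u u') => v v'.
exact: (@rslice_vector _ _ _ (swap_tensor (L2_2 G)) (kac G) u u' v v').
Qed.

Lemma tns_eq0 (H K : hilbert R) (T : htensor H K) u v : tns T u v = 0 -> nrm u * nrm v = 0.
Proof. by rewrite -(nrm_tns T) => ->; rewrite nrm0. Qed.

Lemma nrm_mulss (H : hilbert R) (y : H) : nrm y * nrm y = 0 -> y = 0.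
Proof. by move=> /eqP; rewrite mulf_eq0 orbb => /eqP/nrm_eq0. Qed.

(** A vector y orthogonal to all these makes the adjoint of the unitary [kac G] vanish at
    u (x) y for every u. *)
Lemma dual_total : total_in [set v | exists x xi, C0_dual G x /\ v = x xi].
Proof.
apply: orth_total => y hy; apply/nrm_mulss/(@tns_eq0 _ _ (L2_2 G)).
apply: (unitary_inj (unitary_star (kac_unitary G))).
apply: dot_tns_ext => u v; rewrite dot0r starEr -dual_sliceE.
apply: hy; exists (dual_slice u y), v; split => //; exact: dual_slice_in.
Qed.

(** As for [dual_total], with [kac G] itself in place of its adjoint. *)
Lemma dual_star_total : total_in [set v | exists x xi, C0_dual G x /\ v = star x xi].
Proof.
apply: orth_total => y hy; apply/nrm_mulss/(@tns_eq0 _ _ (L2_2 G)).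
apply: (unitary_inj (kac_unitary G)).
apply: dot_tns_ext => u v; rewrite dot0r dotC -dual_sliceE -dotC -starE.
apply: hy; exists (dual_slice y u), v; split => //; exact: dual_slice_in.
Qed.

End DualTotal.

(** * The comultiplication of a slice *)

Section UniversalSlices.
Variables (R : realType) (G : lcqg R) (U : universal_Cstar G).
Local Notation A := (C0u U).
Local Notation W := (uW U).
Implicit Types (xi eta : L2 G) (a b c : bop (uK U)).

Definition uslice xi eta : bop (uK U) := slice W xi eta.

Lemma uslice_in xi eta : A (uslice xi eta).
Proof.
rewrite C0u_generated; apply: subset_closure; exists (vector_fun xi eta).
exact: rslice_vector.
Qed.

Lemma C0u_uslices : A `<=` closure (lspan [set y | exists xi eta, y = uslice xi eta]).
Proof.
rewrite C0u_generated; apply: closure_sub; first exact: closed_closure.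
move=> y [om hy]; apply/closure_nrmP => e e_gt0.
have [N hN] := rslice_limit hy (e := e / 2) ltac:(by rewrite divr_gt0).
exists (\sum_(0 <= n < N) uslice (nl om n) (nr om n)); last first.
  rewrite nrmBC; apply: (le_lt_trans (hN N (leqnn N))).
  by rewrite ltr_pdivrMr// ltr_pMr// ltr1n.
apply: (big_ind (lspan [set y | exists xi eta, y = uslice xi eta])) => [|x z hx hz|n _].
- exact: lspan0.
- by rewrite -[x]scale1r; exact: lspan_lin.
- by apply: lspan_gen; exists (nl om n), (nr om n).
Qed.

(** For xi = x xi' with x in C_0(G^), the operator uW (c (x) x) lies in
    C_0^u(G) (x) C_0(G^), where finite sums are dense; such vectors are total. *)
Lemma uW_approx c xi : A c -> slice_approx W c xi.
Proof.
move=> Ac; apply: (slice_approx_total (dual_total G)) => _ [x [xi' [Dx ->]]].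
have [h _] := uW_multiplier (min_tensor_op Ac Dx).
have [happ _] := min_tensor_approx xi' h.
move=> e e_gt0; have [l hl] := happ e e_gt0; exists l => v.
by have := hl v; rewrite mul_bopE tensor_opE.
Qed.

(** Adjoints of the approximations of (c (x) x) uW, with xi = star x xi'. *)
Lemma star_uW_approx c xi : A c -> slice_approx (star W) (star c) xi.
Proof.
move=> Ac; apply: (slice_approx_total (dual_star_total G)) => _ [x [xi' [Dx ->]]].
have [_ h] := uW_multiplier (min_tensor_op Ac Dx).
have [_ happ] := min_tensor_approx xi' h.
move=> e e_gt0; have [l hl] := happ e e_gt0; exists l => v.
by have := hl v; rewrite starM star_tensor_op mul_bopE tensor_opE.
Qed.

Section Comultiplication.
Variables (xi eta : L2 G).
Local Notation K2 := (uK_2 U).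
Local Notation K2H := (uK_2H U).
Local Notation AA := (min_tensor K2 A A).
Variables (W13 W23 : bop K2H).
Hypotheses (W13P : is_leg13 W W13) (W23P : is_leg23 W W23).
Hypothesis WP : forall om y, is_rslice om W y -> is_rslice om (W13 * W23) (ucomul y).

Lemma ucomul_uslice : ucomul (uslice xi eta) = slice (W13 * W23) xi eta.
Proof.
apply: slice_eq => z z'; apply: rslice_vector_dot.
by apply: WP; exact: rslice_vector.
Qed.

(** The finite part, along the orthonormal family [e], of the strictly convergent
    expansion of the comultiplication of a slice. *)
Definition comul_part (e : seq (L2 G)) : bop K2 :=
  \sum_(x <- e) tensor_op K2 (uslice x eta) (uslice xi x).

(** Inserting the projection onto the span of [e] between W_13 and W_23. *)
Lemma comul_partE e (E : bop (L2 G)) : (forall u, E u = proj e u) ->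
  comul_part e = slice (W13 * tensor_op K2H 1 E * W23) xi eta.
Proof.
move=> EP; apply: bop_dot_tns_ext => u v u' v'.
have -> : comul_part e (tns K2 u v) = \sum_(x <- e) tns K2 (uslice x eta u) (uslice xi x v).
  rewrite /comul_part (big_morph (fun z : bop K2 => z (tns K2 u v)) (id1 := 0) (op1 := +%R)); last 2 first.
  - by move=> x z; exact: add_bopE.
  - exact: zero_bopE.
  by apply: eq_bigr => x _; rewrite tensor_opE.
have E3 : tensor_op K2H 1 E (W23 (tns K2H (tns K2 u v) xi)) =
    \sum_(x <- e) tns K2H (tns K2 u (uslice xi x v)) x.
  apply: dot_tns3_ext => f g h.
  have sE : star E = E.
    apply: bop_dotP => p q; rewrite starE !EP dotC !dot_proj rmorph_sum; apply: eq_bigr => x _ /=.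
    by rewrite rmorphM /= -!dotC mulrC.
  rewrite -starEr star_tensor_op star1 sE tensor_opE one_bopE W23P EP /proj.
  rewrite tns_sumr dot_sumr dot_suml mulr_sumr; apply: eq_bigr => x _.
  by rewrite tnsZr dotZr !dot_tns /uslice sliceE -dotC; ring.
rewrite sliceE !mul_bopE E3 (big_morph _ (bopD W13) (bop0 W13)) !dot_suml.
by apply: eq_bigr => x _; rewrite W13P dot_tns /uslice !sliceE.
Qed.

Let rest e : bop K2 := ucomul (uslice xi eta) - comul_part e.

Lemma rest_slice e (E : bop (L2 G)) : (forall u, E u = proj e u) ->
  rest e = slice (W13 * (1 - tensor_op K2H 1 E) * W23) xi eta.
Proof.
move=> EP; rewrite /rest ucomul_uslice (comul_partE EP); apply: slice_eq => z z'.
by rewrite sub_bopE dotBl !sliceE mulrBr mulrBl mulr1 sub_bopE dotBl.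
Qed.

Lemma proj_compl (E : bop (L2 G)) : star E = E -> E * E = E -> let Q := (1 - tensor_op K2H 1 E) : bop K2H in
  star Q = Q /\ Q * Q = Q.
Proof.
move=> sE EE; split; first by rewrite starB star1 star_tensor_op star1 sE.
by rewrite mulrBl mul1r mulrBr mulr1 tensor_opM EE mulr1 subrr subr0.
Qed.

(** A bound independent of [e]: it allows [strictly_small] to pass to norm limits. *)
Lemma rest_le e : orthonormal e -> nrm (rest e) <= nrm W13 * nrm W23 * nrm xi * nrm eta.
Proof.
move=> oe; have [E [EP sE EE]] := projection_bop oe.
have [sQ QQ] := proj_compl sE EE.
rewrite (rest_slice EP); apply: (le_trans (nrm_slice _ _ _)).
rewrite !ler_wpM2r ?nrm_ge0//; apply: (le_trans (nrm_bopM _ _)).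
rewrite ler_wpM2r ?nrm_ge0//; apply: (le_trans (nrm_bopM _ _)).
rewrite ler_piMr ?nrm_ge0//; apply: nrm_bop_le => // v; rewrite mul1r.
exact: selfadjoint_projection_le.
Qed.

(** Smallness of the rest of the expansion in the strict topology, for all [e] whose
    span contains a suitable finite set. *)
Definition strictly_small (s : bop K2) := forall d : R, 0 < d -> exists l : seq (L2 G),
  forall e, orthonormal e -> (forall z, z \in l -> proj e z = z) ->
    nrm (rest e * s) <= d /\ nrm (s * rest e) <= d.

Lemma star_leg13 : is_leg13 (star W) (star W13).
Proof.
move=> u u' v v' w w'; by rewrite !starE dotC W13P rmorphM /= -!dotC.
Qed.

(** On the right, W_23 sees only the leg c of b (x) c; on the left, after taking
    adjoints, W_13 sees only the leg b. In both cases the slices are finite sums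
    up to a small error, which 1 - E annihilates. *)
Lemma strictly_small_tensor b c : A b -> A c -> strictly_small (tensor_op K2 b c).
Proof.
move=> Ab Ac d d_gt0.
pose C := (nrm W13 + nrm W23) * (nrm b + nrm c + 1) * (nrm xi + nrm eta) + 1.
have C0 : 0 <= (nrm W13 + nrm W23) * (nrm b + nrm c + 1) * (nrm xi + nrm eta).
  by rewrite !mulr_ge0 ?addr_ge0 ?nrm_ge0.
have C1 : 0 < C by rewrite ltr_wpDl.
have dC : 0 < d / C by rewrite divr_gt0.
have [l1 hl1] := slice_approx_leg23 (@uW_approx _ xi Ac) W23P dC.
have [l2 hl2] := slice_approx_leg13 (@star_uW_approx _ eta Ab) star_leg13 dC.
exists ([seq p.2 | p <- l1] ++ [seq p.2 | p <- l2]) => e oe he.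
have [E [EP sE EE]] := projection_bop oe.
have [sQ QQ] := proj_compl sE EE.
have El1 p : p \in l1 -> E p.2 = p.2.
  by move=> pl; rewrite EP he// mem_cat map_f.
have El2 p : p \in l2 -> E p.2 = p.2.
  by move=> pl; rewrite EP he// mem_cat [X in _ || X]map_f ?orbT.
have s1 := hl1 E sE EE El1; have s2 := hl2 E sE EE El2.
set Q := 1 - tensor_op K2H 1 E in sQ QQ s1 s2.
have n1 : nrm (1 : bop (uK U)) <= 1 := nrm_bop1 _.
have fin (x y z t : R) : 0 <= x -> 0 <= y -> 0 <= z -> 0 <= t ->
    x <= nrm W13 + nrm W23 -> y <= nrm b + nrm c + 1 -> z <= nrm xi + nrm eta ->
    x * (d / C * (y * t)) * z <= d * t.
  move=> x0 y0 z0 t0 hx hy hz.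
  have -> : x * (d / C * (y * t)) * z = x * y * z * (d / C * t) by ring.
  have -> : d * t = C * (d / C * t) by rewrite mulrA [C * _]mulrC divfK ?gt_eqF.
  apply: ler_wpM2r; first by rewrite mulr_ge0// ltW.
  apply: (@le_trans _ _ ((nrm W13 + nrm W23) * (nrm b + nrm c + 1) * (nrm xi + nrm eta))).
    by apply: ler_pM; rewrite ?mulr_ge0//; apply: ler_pM.
  by rewrite /C lerDl.
split.
- apply: nrm_of_form => [|z z']; first exact: ltW.
  rewrite mul_bopE (rest_slice EP) sliceE -/Q !mul_bopE.
  have -> : tensor_op K2 b c z = tensor_op K2 1 c (tensor_op K2 b 1 z).
    by rewrite -mul_bopE tensor_opM mul1r mulr1.
  apply: (le_trans (nrm_dot _ _)).
  have h1 := bop_nrm_le W13 (Q (W23 (tns K2H (tensor_op K2 1 c (tensor_op K2 b 1 z)) xi))).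
  have h2 := s1 (tensor_op K2 b 1 z).
  have h3 : nrm (tensor_op K2 b 1 z) <= nrm b * nrm z.
    apply: (le_trans (bop_nrm_le _ _)); rewrite ler_wpM2r ?nrm_ge0//.
    apply: (le_trans (nrm_tensor_op _ _ _)).
    by rewrite -[leRHS]mulr1 ler_wpM2l ?nrm_ge0.
  rewrite nrm_tns mulrCA mulrC ler_wpM2r ?nrm_ge0//.
  apply: (@le_trans _ _ (nrm W13 * (d / C * (nrm b * nrm z)) * nrm eta)).
    rewrite ler_wpM2r ?nrm_ge0//; apply: (le_trans h1).
    rewrite ler_wpM2l ?nrm_ge0//; apply: (le_trans h2).
    by rewrite ler_wpM2l ?(ltW dC).
  apply: fin; rewrite ?nrm_ge0 ?lerDl ?lerDr ?nrm_ge0//.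
  by rewrite -addrA lerDl addr_ge0 ?nrm_ge0.
- apply: nrm_of_form => [|z z']; first exact: ltW.
  rewrite mul_bopE -starEr star_tensor_op (rest_slice EP) sliceE -/Q !mul_bopE.
  rewrite -starEr -sQ starE.
  have -> : tensor_op K2 (star b) (star c) z' = tensor_op K2 (star b) 1 (tensor_op K2 1 (star c) z').
    by rewrite -mul_bopE tensor_opM mul1r mulr1.
  apply: (le_trans (nrm_dot _ _)).
  have h1 : nrm (W23 (tns K2H z xi)) <= nrm W23 * (nrm z * nrm xi).
    by apply: (le_trans (bop_nrm_le _ _)); rewrite nrm_tns.
  have h2 := s2 (tensor_op K2 1 (star c) z').
  have h3 : nrm (tensor_op K2 1 (star c) z') <= nrm c * nrm z'.
    apply: (le_trans (bop_nrm_le _ _)); rewrite ler_wpM2r ?nrm_ge0//.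
    apply: (le_trans (nrm_tensor_op _ _ _)).
    by rewrite nrm_star -[leRHS]mul1r ler_wpM2r ?nrm_ge0.
  apply: (@le_trans _ _ (nrm W23 * (nrm z * nrm xi) * (d / C * (nrm c * nrm z')))).
    apply: ler_pM; rewrite ?nrm_ge0//; apply: (le_trans h2).
    by rewrite ler_wpM2l ?(ltW dC).
  have -> : nrm W23 * (nrm z * nrm xi) * (d / C * (nrm c * nrm z'))
    = nrm z * (nrm W23 * (d / C * (nrm c * nrm z')) * nrm xi) by ring.
  have -> : d * nrm z * nrm z' = nrm z * (d * nrm z') by ring.
  rewrite ler_wpM2l ?nrm_ge0//.
  apply: fin; rewrite ?nrm_ge0 ?lerDl ?lerDr ?nrm_ge0//.
  by rewrite addrAC lerDr addr_ge0 ?nrm_ge0.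
Qed.

Lemma strictly_small_min_tensor : AA `<=` strictly_small.
Proof.
(* The uniform bound of the rests, by which the closure step is controlled. *)
pose B := nrm W13 * nrm W23 * nrm xi * nrm eta.
have B0 : 0 <= B by rewrite !mulr_ge0 ?nrm_ge0.
have B1 : 0 < B + 1 by rewrite ltr_wpDl.
apply: min_tensor_sub => [s|||]; last exact: strictly_small_tensor.
- move=> /closure_nrmP hs d d_gt0.
  have [s' s's ss'] := hs (d / 2 / (B + 1)) ltac:(by rewrite !divr_gt0).
  have [l hl] := s's (d / 2) ltac:(by rewrite divr_gt0).
  exists l => e oe he; have [h1 h2] := hl e oe he.
  have rB := rest_le oe; rewrite -/B in rB.
  have small (x y : R) : 0 <= x -> 0 <= y -> x <= B -> y <= d / 2 / (B + 1) -> x * y <= d / 2.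
    move=> x0 y0 hx hy; apply: (@le_trans _ _ ((B + 1) * (d / 2 / (B + 1)))).
      by apply: ler_pM => //; lra.
    by rewrite mulrC divfK ?gt_eqF.
  have m1 := small _ _ (nrm_ge0 (rest e)) (nrm_ge0 (s' - s)) rB (ltW ss').
  split.
    have -> : rest e * s = rest e * s' - rest e * (s' - s) by rewrite mulrBr opprB addrC subrK.
    have := nrmB (rest e * s') (rest e * (s' - s)); have := nrm_bopM (rest e) (s' - s); lra.
  have -> : s * rest e = s' * rest e - (s' - s) * rest e by rewrite mulrBl opprB addrC subrK.
  have := nrmB (s' * rest e) ((s' - s) * rest e); have := nrm_bopM (s' - s) (rest e); lra.
- by move=> d d_gt0; exists [::] => e _ _; rewrite mulr0 mul0r nrm0 ltW.
move=> a s t hs ht d d_gt0.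
have a1 : 0 < nrm a + 1 by rewrite ltr_wpDl ?nrm_ge0.
have [l hl] := hs (d / 2 / (nrm a + 1)) ltac:(by rewrite !divr_gt0).
have [l' hl'] := ht (d / 2) ltac:(by rewrite divr_gt0).
exists (l ++ l') => e oe he.
have [h1 h2] := hl e oe (fun z zl => he z ltac:(by rewrite mem_cat zl)).
have [h1' h2'] := hl' e oe (fun z zl => he z ltac:(by rewrite mem_cat zl orbT)).
have small x : x <= d / 2 / (nrm a + 1) -> nrm a * x <= d / 2.
  move=> hx; apply: (@le_trans _ _ (nrm a * (d / 2 / (nrm a + 1)))); first by rewrite ler_wpM2l ?nrm_ge0.
  have : 0 <= d / 2 / (nrm a + 1) by rewrite ltW// !divr_gt0.
  have : (nrm a + 1) * (d / 2 / (nrm a + 1)) = d / 2 by rewrite mulrC divfK ?gt_eqF.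
  lra.
split.
  rewrite mulrDr bop_scaleMr; apply: (le_trans (nrmD _ _)); rewrite nrmZ.
  by have := small _ h1; lra.
rewrite mulrDl bop_scaleMl; apply: (le_trans (nrmD _ _)); rewrite nrmZ.
by have := small _ h2; lra.
Qed.

End Comultiplication.
End UniversalSlices.

(** * The slice operator of an idempotent state, and the antipode *)

Section IdempotentStates.
Variables (R : realType) (G : lcqg R) (U : universal_Cstar G) (mu : bop (uK U) -> R[i]).
Hypothesis mu_idem : idempotent_state mu.
Local Notation A := (C0u U).
Local Notation W := (uW U).
Local Notation K2 := (uK_2 U).
Local Notation AA := (min_tensor K2 A A).
Implicit Types (xi eta : L2 G) (a b : bop (uK U)).

Let Acs : cstar_alg A := C0u_cstar U.
Let st : state A mu := mu_idem.1.

Lemma slice_operator_exists : exists P : bop (L2 G),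
  (forall xi eta, dot (P xi) eta = mu (uslice U xi eta)) /\ nrm P <= 1.
Proof.
have in_ xi eta := uslice_in U xi eta.
have [||xi eta|P [PE Pn]] := @bop_of_form R (L2 G) (fun xi eta => mu (uslice U xi eta)) 1.
- move=> c u v w; have := in_ u w; have := in_ v w; rewrite /uslice slice_linl => Av Au.
  by rewrite (stateD st (cstarZ Acs c Au) Av) (stateZ Acs st).
- move=> c u v w; have := in_ w u; have := in_ w v; rewrite /uslice slice_linr => Av Au.
  by rewrite (stateD st (cstarZ Acs _ Au) Av) (stateZ Acs st).
- apply: (le_trans (state_le Acs st (in_ _ _))); apply: (le_trans (nrm_slice _ _ _)).
  by rewrite !ler_wpM2r ?nrm_ge0 ?nrm_unitary//; exact: uW_unitary.
by exists P; split=> //; apply: nrm_bop_le.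
Qed.

(** (mu (x) id)(uW). *)
Definition slice_operator : bop (L2 G) := projT1 (cid slice_operator_exists).

Local Notation P := slice_operator.

Lemma slice_operatorE xi eta : dot (P xi) eta = mu (uslice U xi eta).
Proof. by rewrite /slice_operator; case: cid => P []. Qed.

Lemma slice_operator_le1 : nrm P <= 1.
Proof. by rewrite /slice_operator; case: cid => P []. Qed.

Lemma min_tensor_multiplier : AA `<=` multiplier AA.
Proof. by move=> x Ax y Ay; split; apply: min_tensorM => // *; exact: (cstarM Acs). Qed.

Lemma multiplier_lin c x y : multiplier AA x -> multiplier AA y -> multiplier AA (c *: x + y).
Proof.
move=> hx hy z Az; have [h1 h2] := hx z Az; have [h3 h4] := hy z Az; split.
  by rewrite mulrDl bop_scaleMl; exact: min_tensor_lin.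
by rewrite mulrDr bop_scaleMr; exact: min_tensor_lin.
Qed.

(** The values of mu (x) mu at the finite parts of the comultiplication of
    (id (x) om_{xi,eta})(uW) are dot (P (E (P xi))) eta, with E the projection onto
    the span of the family; as soon as it contains P xi this is
    dot (P (P xi)) eta. Strict continuity makes the rest negligible. *)
Lemma slice_operator_idem : P * P = P.
Proof.
have [F [Flin [n [a [C [Aa FC]]]] Ftens] muF] := mu_idem.2.
have [W13 [W23 [W13P W23P WP]]] := ucomulP U.
apply: bop_dotP => xi eta; rewrite mul_bopE.
apply/eqP; rewrite -subr_eq0; apply/eqP/nrm_small => e e_gt0.
pose m := ucomul (uslice U xi eta).
have Mm : multiplier AA m := ucomul_multiplier (uslice_in U xi eta).
have C1 : 0 < nrm C * (n%:R * 2) + 1 by rewrite ltr_wpDl ?mulr_ge0 ?nrm_ge0 ?ler0n.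
pose d := e / (nrm C * (n%:R * 2) + 1); have d_gt0 : 0 < d by rewrite divr_gt0.
have /choice[l hl] i : exists l : seq (L2 G),
    forall e, orthonormal e -> (forall z, z \in l -> proj e z = z) ->
    nrm ((m - comul_part U xi eta e) * a i) <= d /\ nrm (a i * (m - comul_part U xi eta e)) <= d.
  have h := @strictly_small_min_tensor R G U xi eta W13 W23 W13P W23P WP (a i) (Aa i).
  exact: h.
(* One family that serves all the elements a i of the strict seminorm and contains P xi. *)
have [f [of_ fl]] := gram_schmidt (P xi :: flatten [seq l i | i <- enum 'I_n]).
pose S := comul_part U xi eta f.
have small i : nrm ((m - S) * a i) <= d /\ nrm (a i * (m - S)) <= d.
  apply: hl => // z zl; apply: fl; rewrite inE; apply/orP; right.
  by apply/flattenP; exists (l i) => //; apply: map_f; rewrite mem_enum.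
have tens_in x : AA (tensor_op K2 (uslice U x eta) (uslice U xi x)).
  by apply: min_tensor_op; exact: uslice_in.
have FD x y : multiplier AA x -> multiplier AA y -> F (x + y) = F x + F y.
  exact: (linear_onD Flin).
have [SM SE] : multiplier AA S /\ F S = \sum_(x <- f) dot (P x) eta * dot (P xi) x.
  rewrite /S /comul_part; elim: (f) => [|x e' [ih1 ih2]].
    rewrite !big_nil; have M0 := min_tensor_multiplier (@min_tensor0 R _ _ K2 A A); split => //.
    by have := FD 0 0 M0 M0; rewrite addr0 => /(congr1 (fun z => z - F 0)); rewrite addrK subrr.
  have Mt := min_tensor_multiplier (tens_in x).
  rewrite !big_cons; split; first by rewrite -[tensor_op _ _ _]scale1r; exact: multiplier_lin.
  by rewrite FD// ih2 (Ftens _ _ _ (uslice_in U _ _) (uslice_in U _ _) (tensor_opP K2 _ _)) !slice_operatorE.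
have {}SE : F S = dot (P (P xi)) eta.
  rewrite SE -{2}(fl (P xi)) ?mem_head// /proj (big_morph _ (bopD P) (bop0 P)) dot_suml.
  by apply: eq_bigr => x _; rewrite bopZ dotZl mulrC.
have MmS : multiplier AA (m - S).
  by rewrite addrC -scaleN1r; exact: multiplier_lin.
have -> : dot (P (P xi)) eta - dot (P xi) eta = - F (m - S).
  rewrite -SE slice_operatorE muF; last exact: uslice_in.
  by rewrite -/m (linear_onB Flin Mm SM) opprB.
rewrite nrmN.
have h : nrm (F (m - S)) <= nrm C * (n%:R * 2 * d).
  have := FC _ MmS.
  have -> : \sum_i (`|(m - S) * a i| + `|a i * (m - S)|)
     = (\sum_i (nrm ((m - S) * a i) + nrm (a i * (m - S))))%:C :> R[i].
    by rewrite rmorph_sum; apply: eq_bigr => i _; rewrite rmorphD /= !nrmE.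
  set Sm := \sum_i _ => hC.
  have Sm0 : 0 <= Sm by apply: sumr_ge0 => i _; rewrite addr_ge0 ?nrm_ge0.
  apply: (@le_trans _ _ (nrm C * Sm)).
    have -> : nrm C * Sm = nrm (C * Sm%:C) by rewrite nrmM nrm_real ger0_norm.
    rewrite -lecR -!nrmE (le_trans hC)// real_ler_norm// ger0_real//.
    exact: le_trans (normr_ge0 _) hC.
  rewrite ler_wpM2l ?nrm_ge0//; apply: (@le_trans _ _ (\sum_(i < n) (d + d))).
    by apply: ler_sum => i _; have [h1 h2] := small i; exact: lerD.
  by rewrite sumr_const card_ord -mulr_natl; lra.
apply: (le_trans h).
have -> : nrm C * (n%:R * 2 * d) = (nrm C * (n%:R * 2)) * d by ring.
have : (nrm C * (n%:R * 2) + 1) * d = e by rewrite mulrC divfK ?gt_eqF.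
lra.
Qed.

Lemma star_slice_operator : star P = P.
Proof.
apply: contractive_idempotent_selfadjoint; [exact: slice_operator_le1|exact: slice_operator_idem].
Qed.

Lemma rslice_in om a : is_rslice om W a -> A a.
Proof. by move=> h; rewrite C0u_generated; apply: subset_closure; exists om. Qed.

Lemma uslice_star xi eta : slice (star W) xi eta = star (uslice U eta xi).
Proof. by rewrite /uslice star_slice. Qed.

(** By linearity and continuity this is the self-adjointness of [slice_operator],
    read on vector functionals. *)
Lemma antipode_core_invariant om a b : is_rslice om W a -> is_rslice om (star W) b ->
  A b /\ mu b = mu a.
Proof.
move=> ha hb.
pose aN N := \sum_(0 <= n < N) uslice U (nl om n) (nr om n).
pose bN N := \sum_(0 <= n < N) slice (star W) (nl om n) (nr om n).
have sum_in N (F : nat -> bop (uK U)) : (forall n, A (F n)) ->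
    A (\sum_(0 <= n < N) F n) /\ mu (\sum_(0 <= n < N) F n) = \sum_(0 <= n < N) mu (F n).
  move=> AF; elim: N => [|N [ih1 ih2]].
    rewrite !big_nil; split; first exact: (cstar0 Acs).
    by have := stateZ Acs st 0 (cstar0 Acs); rewrite scale0r mul0r.
  rewrite !big_nat_recr//=; split; first exact: (cstarD Acs).
  by rewrite (stateD st) ?ih2.
have in_b n : A (slice (star W) (nl om n) (nr om n)).
  by rewrite uslice_star; apply: (cstar_star Acs); exact: uslice_in.
have ab N : mu (bN N) = mu (aN N).
  rewrite (sum_in N _ in_b).2 (sum_in N _ (fun n => uslice_in U _ _)).2.
  apply: eq_bigr => n _; rewrite uslice_star (state_star Acs st (uslice_in U _ _)).
  by rewrite -!slice_operatorE -dotC -starE star_slice_operator.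
have Aa := rslice_in ha.
have Ab : A b.
  apply: (cstar_closed Acs); apply/closure_nrmP => e e_gt0.
  have e2 : 0 < e / 2 by rewrite divr_gt0.
  have [k hk] := rslice_limit hb e2.
  exists (bN k); first exact: (sum_in k _ in_b).1.
  rewrite nrmBC; apply: (le_lt_trans (hk k (leqnn k))).
  by rewrite ltr_pdivrMr// ltr_pMr// ltr1n.
split => //; apply/eqP; rewrite -subr_eq0; apply/eqP/nrm_small => e e_gt0.
have e2 : 0 < e / 2 by rewrite divr_gt0.
have [k hk] := rslice_limit ha e2; have [j hj] := rslice_limit hb e2.
have h1 := hk (k + j)%N (leq_addr _ _); have h2 := hj (k + j)%N (leq_addl _ _).
rewrite -/(aN _) in h1; rewrite -/(bN _) in h2.
have Aan := (sum_in (k + j)%N _ (fun n => uslice_in U (nl om n) (nr om n))).1.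
have Abn := (sum_in (k + j)%N _ in_b).1; rewrite -/(aN _) in Aan; rewrite -/(bN _) in Abn.
apply: (le_trans (nrm_dist (mu (bN (k + j)%N)) _ _)).
rewrite {2}ab -(stateB st Ab Abn) -(stateB st Aan Aa).
have k1 := state_le Acs st (cstarB Acs Ab Abn).
have k2 := state_le Acs st (cstarB Acs Aan Aa); rewrite [X in _ <= X]nrmBC in k2.
by rewrite [leRHS]splitr; exact: lerD (le_trans k1 h2) (le_trans k2 h1).
Qed.

Lemma antipode_invariant a b : antipode_graph U (a, b) -> [/\ A a, A b & mu b = mu a].
Proof.
move=> hab.
have approx (e : R) : 0 < e -> exists a' b', [/\ A a', A b', mu b' = mu a',
    nrm (a' - a) < e & nrm (b' - b) < e].
  move=> e_gt0.
  have [|[a' b'] [[om [/= ha hb]] [/= h1 h2]]] := hab ([set x | nrm (x - a) < e] `*` [set y | nrm (y - b) < e]).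
    exists ([set x | nrm (x - a) < e], [set y | nrm (y - b) < e]) => //.
    by split; apply/nbhs_nrmP; exists e.
  have [Ab' mu'] := antipode_core_invariant ha hb.
  by exists a', b'; split => //; exact: rslice_in ha.
have Aa : A a.
  by apply: (cstar_closed Acs); apply/closure_nrmP => e /approx[a' [b' [? ? ? ? ?]]]; exists a'.
have Ab : A b.
  by apply: (cstar_closed Acs); apply/closure_nrmP => e /approx[a' [b' [? ? ? ? ?]]]; exists b'.
split => //; apply/eqP; rewrite -subr_eq0; apply/eqP/nrm_small => e e_gt0.
have [a' [b' [Aa' Ab' mu' h1 h2]]] := approx (e / 2) ltac:(by rewrite divr_gt0).
apply: (le_trans (nrm_dist (mu b') _ _)).
rewrite {2}mu' -(stateB st Ab Ab') -(stateB st Aa' Aa).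
have k1 := state_le Acs st (cstarB Acs Ab Ab'); rewrite [X in _ <= X]nrmBC in k1.
have k2 := state_le Acs st (cstarB Acs Aa' Aa).
by rewrite [leRHS]splitr; exact: lerD (le_trans k1 (ltW h2)) (le_trans k2 (ltW h1)).
Qed.

End IdempotentStates.

(** * The scaling group and the unitary antipode *)

Section VectorValued.
Variables (R : realType) (V : normedModType R[i]).
Implicit Types (f : R[i] -> V) (z w h : R[i]).

Lemma within_nrmP (S : set R[i]) f : {within S, continuous f} <->
  forall z, S z -> forall e : R, 0 < e -> exists2 d : R, 0 < d &
    forall w, S w -> nrm (w - z) < d -> nrm (f w - f z) < e.
Proof.
rewrite subspace_continuousP; split=> [cf z Sz e e_gt0|cf z Sz B /nbhs_nrmP[e e_gt0 eB]].
  have : nbhs (f z) [set v | nrm (v - f z) < e] by apply/nbhs_nrmP; exists e.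
  move=> /(cf z Sz) /nbhs_nrmP[d d_gt0 hd]; exists d => // w Sw wz; exact: hd.
have [d d_gt0 hd] := cf z Sz e e_gt0.
by apply/nbhs_nrmP; exists d => // w wz Sw; apply: eB; exact: hd.
Qed.

Lemma derivable_nrmP f w : derivable f w 1 <-> exists l : V,
  forall e : R, 0 < e -> exists2 d : R, 0 < d &
    forall h, h != 0 -> nrm h < d -> nrm (h^-1 *: (f (h + w) - f w) - l) < e.
Proof.
split=> [/cvg_ex[l hl]|[l hl]].
  exists l => e e_gt0.
  have : nbhs l [set v | nrm (v - l) < e] by apply/nbhs_nrmP; exists e.
  move=> /hl /nbhs_nrmP[d d_gt0 hd]; exists d => // h h0 hn.
  by have := hd h; rewrite subr0 /= => /(_ hn h0); rewrite -[h *: 1]/(h * 1) mulr1.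
apply/cvg_ex; exists l => B /nbhs_nrmP[e e_gt0 eB].
have [d d_gt0 hd] := hl e e_gt0; apply/nbhs_nrmP; exists d => // h.
rewrite subr0 => hn h0; apply: eB; rewrite -[h *: 1]/(h * 1) mulr1; exact: hd.
Qed.

End VectorValued.

Lemma derivable_cdiff (R : realType) (g : R[i] -> R[i]) w : derivable g w 1 -> cdiff g w.
Proof.
move=> /derivable_nrmP[l hl].
exists (fun z => if z == w then l else (g z - g w) / (z - w)).
  apply/continuous_nrmP => e e_gt0; have [d d_gt0 hd] := hl e e_gt0.
  exists d => // z zw; rewrite eqxx; case: eqVneq => [_|zw0]; first by rewrite subrr nrm0.
  have := hd (z - w); rewrite subr_eq0 subrK => /(_ zw0 zw).
  by rewrite -[_ *: _]/(_ * _) mulrC.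
apply/nbhs_nrmP; exists 1 => // z _; case: eqVneq => [->|zw0]; first by rewrite subrr mulr0 addr0.
by rewrite divfK ?subr_eq0// addrC subrK.
Qed.

Lemma cont_onB (R : realType) (S : set R[i]) (f g : R[i] -> R[i]) :
  cont_on S f -> cont_on S g -> cont_on S (fun z => f z - g z).
Proof.
move=> cf cg z Sz e e_gt0; have e2 : 0 < e / 2 by rewrite divr_gt0.
have [d1 d1_gt0 h1] := cf z Sz _ e2; have [d2 d2_gt0 h2] := cg z Sz _ e2.
exists (Num.min d1 d2); first by rewrite lt_min d1_gt0.
move=> w Sw; rewrite lt_min => /andP[wd1 wd2].
have -> : f w - g w - (f z - g z) = (f w - f z) - (g w - g z) by ring.
apply: (le_lt_trans (nrmB _ _)); rewrite [e]splitr; apply: ltrD; [exact: h1|exact: h2].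
Qed.

Section Regular.
Variables (R : realType) (H : hilbert R) (A : set (bop H)).
Hypothesis Acs : cstar_alg A.
Implicit Types (f : R[i] -> bop H).

(** What an analytic extension of an orbit satisfies; it is stable under bounded
    linear maps and real translations. *)
Definition regular_on_strip f := [/\ {within strip, continuous f},
  forall w, open_strip w -> derivable f w 1 & forall w, strip w -> A (f w)].

Variables (V : normedModType R[i]) (phi : bop H -> V) (C : R).
Hypotheses (phi_lin : linear_on A phi) (phi_le : forall x, A x -> nrm (phi x) <= C * nrm x).

Let C1 : 0 < `|C| + 1. Proof. by rewrite ltr_wpDl. Qed.

Let phi_small x (e : R) : A x -> nrm x < e / (`|C| + 1) -> nrm (phi x) < e.
Proof.
move=> Ax xe; apply: (le_lt_trans (phi_le Ax)).
apply: (@le_lt_trans _ _ ((`|C| + 1) * nrm x)); last by rewrite mulrC -ltr_pdivlMr.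
by rewrite ler_wpM2r ?nrm_ge0//; apply: (le_trans (ler_norm _)); rewrite lerDl.
Qed.

Lemma strip_translate (t : R) w : strip (w + t%:C) = strip w.
Proof. by rewrite /strip /= raddfD /= addr0. Qed.

Lemma open_strip_translate (t : R) w : open_strip (w + t%:C) = open_strip w.
Proof. by rewrite /open_strip /= raddfD /= addr0. Qed.

Lemma regular_comp_cont f (t : R) : regular_on_strip f ->
  {within strip, continuous (fun w => phi (f (w + t%:C)))}.
Proof.
move=> [/within_nrmP cf _ Af]; apply/within_nrmP => z Sz e e_gt0.
have Szt : strip (z + t%:C) by rewrite strip_translate.
have [d d_gt0 hd] := cf _ Szt (e / (`|C| + 1)) ltac:(by rewrite divr_gt0).
exists d => // w Sw wz; have Swt : strip (w + t%:C) by rewrite strip_translate.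
rewrite -(linear_onB phi_lin (Af _ Swt) (Af _ Szt)); apply: phi_small.
  exact: (cstarB Acs (Af _ Swt) (Af _ Szt)).
by apply: (hd _ Swt); have -> : w + t%:C - (z + t%:C) = w - z by ring.
Qed.

Lemma regular_comp_derivable f (t : R) w : regular_on_strip f -> open_strip w ->
  derivable (fun w => phi (f (w + t%:C))) w 1.
Proof.
move=> [_ df Af] Ow; have Owt : open_strip (w + t%:C) by rewrite open_strip_translate.
have Awt := Af _ (open_strip_strip Owt).
have /derivable_nrmP[l hl] := df _ Owt.
pose q h := h^-1 *: (f (h + (w + t%:C)) - f (w + t%:C)).
have [d0 d0_gt0 hd0] : exists2 d : R, 0 < d & forall h, nrm h < d -> strip (h + (w + t%:C)).
  have h1 := near_Im_lt (proj2 (andP Owt)); have h2 := near_Im_gt (proj1 (andP Owt)).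
  have : nbhs (w + t%:C) [set z | strip z].
    by apply: filterS2 h1 h2 => z z1 z2; rewrite /strip /= !ltW.
  move=> /nbhs_nrmP[d d_gt0 hd]; exists d => // h hn; apply: hd.
  by rewrite addrK.
have Aq h : nrm h < d0 -> A (q h).
  by move=> hn; apply: (cstarZ Acs); apply: (cstarB Acs) => //; apply: Af; exact: hd0.
have Al : A l.
  apply: (cstar_closed Acs); apply/closure_nrmP => e e_gt0.
  have [d d_gt0 hd] := hl e e_gt0; pose s := Num.min d d0 / 2.
  have m0 : 0 < Num.min d d0 by rewrite lt_min d_gt0.
  have s_gt0 : 0 < s by rewrite divr_gt0.
  have sm : s < Num.min d d0 by rewrite ltr_pdivrMr// ltr_pMr// ltr1n.
  move: sm; rewrite lt_min => /andP[sd sd0].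
  have ns : nrm (s%:C : R[i]) = s by rewrite nrm_real gtr0_norm.
  exists (q s%:C); first by apply: Aq; rewrite ns.
  apply: hd; last by rewrite ns.
  by rewrite eq_complex /= negb_and gt_eqF.
apply/derivable_nrmP; exists (phi l) => e e_gt0.
have [d d_gt0 hd] := hl (e / (`|C| + 1)) ltac:(by rewrite divr_gt0).
exists (Num.min d d0); first by rewrite lt_min d_gt0.
move=> h h0; rewrite lt_min => /andP[hd' hd0'].
have Ah : A (f (h + (w + t%:C))) by apply: Af; exact: hd0.
rewrite -addrA -(linear_onB phi_lin Ah Awt) -(linear_onZ Acs _ phi_lin (cstarB Acs Ah Awt)).
rewrite -(linear_onB phi_lin (Aq _ hd0') Al); apply: phi_small; last exact: hd.
exact: (cstarB Acs (Aq _ hd0') Al).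
Qed.

End Regular.

Lemma agree_on_closure (R : realType) (H : hilbert R) (A B : set (bop H)) (phi psi : bop H -> R[i]) (C D : R) :
  cstar_alg A -> B `<=` A -> A `<=` closure (lspan B) ->
  linear_on A (phi : bop H -> (R[i])^o) -> linear_on A (psi : bop H -> (R[i])^o) ->
  (forall x, A x -> nrm (phi x) <= C * nrm x) -> (forall x, A x -> nrm (psi x) <= D * nrm x) ->
  (forall x, B x -> phi x = psi x) -> forall x, A x -> phi x = psi x.
Proof.
move=> Acs BA AB lphi lpsi phiC psiD phipsi x Ax.
have hspan y : lspan B y -> A y /\ phi y = psi y.
  apply: (@lspan_sub _ _ B [set y | A y /\ phi y = psi y]) => /=.
  - have A0 := cstar0 Acs; split => //.
    by rewrite -[0](scale0r (0 : bop H)) (linear_onZ Acs _ lphi A0) (linear_onZ Acs _ lpsi A0) !scale0r.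
  - move=> c u v [Au hu] [Av hv]; split; first exact: (cstar_lin Acs).
    by rewrite lphi// lpsi// hu hv.
  - by move=> b Bb; split; [exact: BA|exact: phipsi].
apply/eqP; rewrite -subr_eq0; apply/eqP/nrm_small => e e_gt0.
have CD : 0 < `|C| + `|D| + 1 by rewrite ltr_wpDl// addr_ge0.
have /closure_nrmP/(_ (e / (`|C| + `|D| + 1)))[|y /hspan[Ay hy] yx] := AB x Ax.
  by rewrite divr_gt0.
have Ayx := cstarB Acs Ay Ax.
have -> : phi x - psi x = - (phi (y - x) - psi (y - x)).
  by rewrite (linear_onB lphi Ay Ax) (linear_onB lpsi Ay Ax) hy opprB addrC; ring.
rewrite nrmN; apply: (le_trans (nrmB _ _)); apply: (le_trans (lerD (phiC _ Ayx) (psiD _ Ayx))).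
rewrite -mulrDl; apply: (@le_trans _ _ ((`|C| + `|D| + 1) * nrm (y - x))).
  rewrite ler_wpM2r ?nrm_ge0//; have := ler_norm C; have := ler_norm D; lra.
by rewrite mulrC -ler_pdivlMr// ltW.
Qed.

Section Invariance.
Variables (R : realType) (G : lcqg R) (U : universal_Cstar G).
Variables (r : bop (uK U) -> bop (uK U)) (tau : R -> bop (uK U) -> bop (uK U)).
Hypothesis hr : unitary_antipode_and_scaling_group r tau.
Variable mu : bop (uK U) -> R[i].
Hypothesis mu_idem : idempotent_state mu.
Local Notation A := (C0u U).

Let Acs : cstar_alg A := C0u_cstar U.
Let st : state A mu := mu_idem.1.

Let rA a : A a -> A (r a). Proof. by case: hr => -[h _ _ _ _] _ _ _; exact: h. Qed.
Let r_lin : linear_on A r. Proof. by case: hr => -[]. Qed.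
Let rK a : A a -> r (r a) = a. Proof. by case: hr => -[_ _ _ _ h] _ _ _; exact: h. Qed.
Let r_le a : A a -> nrm (r a) <= 2 * nrm a.
Proof. by case: hr => -[_ l m s _] _ _ _; exact: (star_antihom_bound Acs l m s). Qed.
Let tauA t a : A a -> A (tau t a). Proof. by case: hr => _ [_ h _ _ _] _ _; exact: h. Qed.
Let tau_lin t : linear_on A (tau t). Proof. by case: hr => _ [h _ _ _ _] _ _; case: (h t). Qed.
Let tau_le t a : A a -> nrm (tau t a) <= 2 * nrm a.
Proof. by case: hr => _ [h _ _ _ _] _ _; exact: (star_hom_bound Acs (h t)). Qed.
Let tau0 a : A a -> tau 0 a = a. Proof. by case: hr => _ [_ _ h _ _] _ _; exact: h. Qed.
Let tauD s t a : A a -> tau (s + t) a = tau s (tau t a).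
Proof. by case: hr => _ [_ _ _ h _] _ _; exact: h. Qed.
Let r_tau t a : A a -> r (tau t a) = tau t (r a). Proof. by case: hr => _ _ h _; exact: h. Qed.

Let mu_lin : linear_on A (mu : bop (uK U) -> (R[i])^o) := state_lin st.
Let mu_le a : A a -> nrm (mu a) <= 1 * nrm a.
Proof. by move=> Aa; rewrite mul1r; exact: (state_le Acs st). Qed.

Let comp_lin (phi : bop (uK U) -> bop (uK U)) : linear_on A phi -> (forall a, A a -> A (phi a)) ->
  linear_on A ((fun a => mu (phi a)) : bop (uK U) -> (R[i])^o).
Proof. by move=> pl pA c x y Ax Ay /=; rewrite pl// mu_lin//; exact: pA. Qed.

Let comp_le (phi : bop (uK U) -> bop (uK U)) (C : R) : (forall a, A a -> A (phi a)) ->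
  (forall a, A a -> nrm (phi a) <= C * nrm a) -> forall a, A a -> nrm (mu (phi a)) <= C * nrm a.
Proof. by move=> pA pC a Aa; apply: (le_trans (mu_le (pA _ Aa))); rewrite mul1r; exact: pC. Qed.

(** S^u = R^u tau_{-i/2}, in the direction that produces elements of the graph. *)
Lemma extension_to_antipode a b f : A a -> A b -> regular_on_strip A f ->
  (forall t, f t%:C = tau t a) -> b = r (f (0 +i* - 2^-1)) -> antipode_graph U (a, b).
Proof.
move=> Aa Ab [cf df Af] fa bE; case: hr => _ _ _ hg; apply/hg; split => //.
by exists (f (0 +i* - 2^-1)) => //; exists f; split.
Qed.

(** Invariance under S^u, applied to the orbits of [a] and of [r a], shows that
    mu o f and mu o r o f match as in [strip_liouville]. *)
Lemma strip_invariance a b : antipode_graph U (a, b) ->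
  (forall t, mu (tau t a) = mu a) /\ mu (r a) = mu a.
Proof.
move=> hab; have [Aa Ab mab] := antipode_invariant mu_idem hab.
have [f [freg fa]] : exists f, regular_on_strip A f /\ forall t : R, f t%:C = tau t a.
  case: hr => _ _ _ hg; have [_ [c [f [cf df Af fa _]] _]] := (hg a b).1 hab.
  by exists f; split => //; split.
have Af w : strip w -> A (f w) by case: freg => _ _; exact.
have bottom (t : R) : strip (t +i* - 2^-1) by rewrite /strip /=; lra.
pose F w := mu (f w); pose F' w := mu (r (f w)).
have shift (phi : bop (uK U) -> bop (uK U)) (C t : R) : linear_on A phi -> (forall a, A a -> A (phi a)) ->
    (forall a, A a -> nrm (phi a) <= C * nrm a) ->
    regular_on_strip A (fun w => phi (f (w + t%:C))).
  move=> pl pA pC; split.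
  - exact: (regular_comp_cont Acs pl pC).
  - by move=> w; exact: (regular_comp_derivable Acs pl pC).
  - by move=> w Sw; apply/pA/Af; rewrite strip_translate.
have scalar (phi : bop (uK U) -> R[i]) (C t : R) : linear_on A (phi : _ -> (R[i])^o) ->
    (forall a, A a -> nrm (phi a) <= C * nrm a) ->
    cont_on strip (fun w => phi (f (w + t%:C))) /\
    forall w, open_strip w -> cdiff (fun w => phi (f (w + t%:C))) w.
  move=> pl pC; split.
    have cf := @regular_comp_cont R _ A Acs R[i] phi C pl pC f t freg.
    by move: cf => /within_nrmP.
  move=> w Ow; apply: derivable_cdiff.
  exact: (@regular_comp_derivable R _ A Acs R[i] phi C pl pC f t w freg Ow).
have E t : t%:C + (0 +i* - 2^-1) = t +i* - 2^-1 :> R[i].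
  by apply/eqP; rewrite eq_complex /= addr0 add0r !eqxx.
have E' t : (0 +i* - 2^-1) + t%:C = t +i* - 2^-1 :> R[i] by rewrite addrC E.
have per t : F (t +i* - 2^-1) = F' t%:C.
  have Artau : A (r (tau t a)) by apply/rA/tauA.
  have h : antipode_graph U (r (tau t a), f (t +i* - 2^-1)).
    apply: (extension_to_antipode Artau (Af _ (bottom t)) (shift r 2 t r_lin rA r_le)) => [s|].
      by rewrite -rmorphD fa (tauD _ _ Aa) r_tau//; exact: tauA.
    by rewrite E' rK//; exact: Af.
  by have [_ _] := antipode_invariant mu_idem h; rewrite /F /F' fa.
have per' t : F' (t +i* - 2^-1) = F t%:C.
  have id_le x : A x -> nrm (id x) <= 1 * nrm x by rewrite mul1r.
  have h : antipode_graph U (tau t a, r (f (t +i* - 2^-1))).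
    apply: (extension_to_antipode (tauA t Aa) (rA (Af _ (bottom t)))
      (shift id 1 t (fun _ _ _ _ _ => erefl) (fun _ h => h) id_le)) => [s|].
      by rewrite -rmorphD fa tauD.
    by rewrite E'.
  by have [_ _] := antipode_invariant mu_idem h; rewrite /F /F' fa.
(* A bound on one square of the strip; translations by real numbers, which tau implements,
   propagate it to the strip. *)
have [m0 hm0] : exists m, forall w, in_square 0 (- 2^-1) 2^-1 w -> nrm (f w) <= m.
  have sq w : in_square 0 (- 2^-1) 2^-1 w -> strip w by case=> _; rewrite addNr /strip.
  case: freg => /within_nrmP cf _ _; apply: square_bounded; first by rewrite invr_gt0.
  move=> z /sq Sz; have [d d_gt0 hd] := cf z Sz 1 ltr01.
  exists (nrm (f z) + 1), d => // w /sq Sw wz.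
  have := nrmD (f w - f z) (f z); rewrite subrK => h.
  by apply: (le_trans h); rewrite addrC lerD2l; exact/ltW/hd.
have bounded (phi : bop (uK U) -> R[i]) (C : R) : 0 <= C -> linear_on A (phi : _ -> (R[i])^o) ->
    (forall a, A a -> nrm (phi a) <= C * nrm a) ->
    forall w, strip w -> nrm (phi (f w)) <= C * 2 * m0.
  move=> C0 pl pC w Sw; pose t := complex.Re w; pose w0 : R[i] := 0 +i* complex.Im w.
  have wE : w = w0 + t%:C.
    by apply/eqP; rewrite eq_complex /= add0r addr0 !eqxx.
  have Sw0 : strip w0 by [].
  pose psi x := phi (tau t x).
  have psi_lin : linear_on A (psi : _ -> (R[i])^o).
    by move=> c x y Ax Ay; rewrite /psi tau_lin// pl//; exact: tauA.
  have psi_le x : A x -> nrm (psi x) <= C * 2 * nrm x.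
    move=> Ax; apply: (le_trans (pC _ (tauA t Ax))).
    by rewrite -mulrA ler_wpM2l// tau_le.
  have [c1 d1] := scalar phi C t pl pC.
  have [c2 d2] := scalar psi (C * 2) 0 psi_lin psi_le.
  have key : phi (f w) = psi (f w0).
    have g0 : forall z, strip z -> phi (f (z + t%:C)) - psi (f (z + 0%:C)) = 0.
      apply: strip_unique; first exact: cont_onB.
        by move=> z Oz; apply: cdiffD; [exact: d1|apply: cdiffN; exact: d2].
      by move=> s; rewrite -!rmorphD !fa addr0 /psi [s + t]addrC (tauD _ _ Aa) subrr.
    have := g0 w0 Sw0; rewrite addr0 -wE => /eqP; rewrite subr_eq0 => /eqP //.
  rewrite key; apply: (le_trans (psi_le _ (Af _ Sw0))).
  rewrite ler_wpM2l ?mulr_ge0//; apply: hm0; split => /=; first by lra.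
  by move: Sw; rewrite /strip /=; lra.
have m0_ge0 : 0 <= m0.
  by apply: (le_trans (nrm_ge0 (f 0))); apply: hm0; split => /=; lra.
have at0 (phi : bop (uK U) -> R[i]) : (fun w => phi (f (w + 0%:C))) = (fun w => phi (f w)).
  by apply/funext => w; rewrite addr0.
have [c1 d1] := scalar mu 1 0 mu_lin mu_le; rewrite at0 in c1 d1.
have r_comp_lin := comp_lin r_lin rA; have r_comp_le := comp_le rA r_le.
have [c2 d2] := scalar (fun x => mu (r x)) 2 0 r_comp_lin r_comp_le.
have /= at0r := at0 (fun x => mu (r x)); rewrite at0r in c2 d2.
have [c hc] : exists c, forall z, strip z -> F z = c /\ F' z = c.
  apply: (@strip_liouville R F F' (2 * 2 * m0)) => //.
  - move=> w Sw; apply: (le_trans (bounded mu 1 ler01 mu_lin mu_le w Sw)).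
    by rewrite ler_wpM2r// ler_wpM2r// ler1n.
  - exact: (bounded (fun x => mu (r x)) 2 _ r_comp_lin r_comp_le).
have real_strip t : strip (t%:C : R[i]) by rewrite /strip /=; lra.
have F0 : c = mu a by have [<- _] := hc _ (real_strip 0); rewrite /F fa tau0.
split=> [t|]; rewrite -F0; first by have [<- _] := hc _ (real_strip t); rewrite /F fa.
by have [_ <-] := hc _ (real_strip 0); rewrite /F' fa tau0.
Qed.

Lemma uslice_antipode xi eta : antipode_graph U (uslice U xi eta, slice (star (uW U)) xi eta).
Proof. by apply: subset_closure; exists (vector_fun xi eta); split; exact: rslice_vector. Qed.

Lemma scaling_invariant t a : A a -> mu (tau t a) = mu a.
Proof.
apply: (agree_on_closure Acs _ (@C0u_uslices _ _ U) (comp_lin (tau_lin t) (tauA t)) mu_lin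
  (comp_le (tauA t) (tau_le t)) mu_le) => [_ [xi [eta ->]]|_ [xi [eta ->]]].
  exact: uslice_in.
exact: (strip_invariance (@uslice_antipode xi eta)).1.
Qed.

Lemma unitary_antipode_invariant a : A a -> mu (r a) = mu a.
Proof.
apply: (agree_on_closure Acs _ (@C0u_uslices _ _ U) (comp_lin r_lin rA) mu_lin
  (comp_le rA r_le) mu_le) => [_ [xi [eta ->]]|_ [xi [eta ->]]].
  exact: uslice_in.
exact: (strip_invariance (@uslice_antipode xi eta)).2.
Qed.

End Invariance.

Theorem proposition4 (R : realType) (G : lcqg R) (U : universal_Cstar G)
    (Ru : bop (uK U) -> bop (uK U)) (tau : R -> bop (uK U) -> bop (uK U))
    (hRtau : unitary_antipode_and_scaling_group Ru tau)
    (omega : bop (uK U) -> complex R) (homega : idempotent_state omega) :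
  [/\ forall a b, antipode_graph U (a, b) -> omega b = omega a,
      forall a, C0u U a -> omega (Ru a) = omega a
    & forall t a, C0u U a -> omega (tau t a) = omega a].
Proof.
split=> [a b hab|a Aa|t a Aa].
- by have [_ _] := antipode_invariant homega hab.
- exact: (unitary_antipode_invariant hRtau homega Aa).
- exact: (scaling_invariant hRtau homega t Aa).
Qed.
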